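(* Let $Y$ be either $\mathbb{H}^Q$ with $3\le Q\le7$, or $\mathbb{G}^{Q,q}$ with $q\ge3$, $q<Q\le Q(q)$. Let $D\ge0$ and let $\mu_n<\|A_Y\|-\|A_{\Lambda_n}\|$, $\mu_n\to0$, be a sequence such that $$\frac1{\|v_n\|^2\big(\|A_Y\|-\|A_{\Lambda_n}\|-\mu_n\big)}\to D ,$$ and put $\lambda_n=\|A_Y\|-\mu_n$. Suppose that $$\lim_n\frac{\|v_n\|^2|S_n|}{|\Lambda_n|}=0,$$ and that, for this choice of $\mu_n$, for every vertex $x$, $$\lim_n\big\langle R_{A_{B_n}}(\lambda_n)R_{S_n(\lambda_n)}(1)R_{A_{B_n}}(\lambda_n)Q_n\delta_x,Q_n\delta_x\big\rangle=\big\langle R_{A_{\mathbb{G}^Q}}(\|A_Y\|)R_{S(\|A_Y\|)}(1)R_{A_{\mathbb{G}^Q}}(\|A_Y\|)\delta_x,\delta_x\big\rangle .$$ Then for each $x\in Y$, $$\lim_n\omega_n(a^\dagger(\delta_x)a(\delta_x))=\omega_D(a^\dagger(\delta_x)a(\delta_x)),$$ where $\omega_n(a^\dagger(u_1)a(u_2))=\langle(e^{H_n-\mu_n\mathbf{1}_n}-\mathbf{1}_n)^{-1}u_1,u_2\rangle$ and $\omega_D(a^\dagger(u_1)a(u_2))=\langle(e^H-\mathbf{1})^{-1}u_1,u_2\rangle+D\langle u_1,v\rangle\langle v,u_2\rangle$. In addition, $\rho_{\Lambda_n}(\mu_n)\to\rho_c$.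
   Context: Graphs. $\mathbb{G}^Q$ is the homogeneous Cayley tree in which every vertex has degree $Q$, $d$ is its graph distance, $A_{\mathbb{G}^Q}$ its adjacency operator on $\ell^2(\mathbb{G}^Q)$, with norm $2\sqrt{Q-1}$. Given a subtree $S\subset\mathbb{G}^Q$ and a root $0\in S$, the perturbed graph $Y$ has the same vertices and an additional self-loop at each vertex of $S$, so $A_Y=A_{\mathbb{G}^Q}+P_{\ell^2(S)}$, where $P_{\ell^2(S)}$ is the orthogonal projection onto $\ell^2(S)$. Then $Y=\mathbb{G}^{Q,q}$ when $S$ is isomorphic to $\mathbb{G}^q$, where $Q(q)=\big[\big(2\sqrt{q-1}+1+\sqrt{4\sqrt{q-1}+1}\big)^2/4\big]+1$ ($[\cdot]$ = integer part); and $Y=\mathbb{H}^Q$ when $S$ is a half-line isomorphic to $\mathbb{N}$ with end vertex $0$. In the cases of the claim $\|A_Y\|>2\sqrt{Q-1}$ and $A_Y$ is transient: $\lim_{\lambda\downarrow\|A_Y\|}\langle(\lambda\mathbf{1}-A_Y)^{-1}\delta_x,\delta_x\rangle<+\infty$ for every vertex $x$. Perron--Frobenius eigenvector $v$ of $A_Y$: for $\lambda>2\sqrt{Q-1}$ put $a(\lambda)=\dfrac{1-\sqrt{1-4(Q-1)/\lambda^2}}{2(Q-1)/\lambda}$. For a vertex $x$ let $y(x)\in S$ be the unique vertex with $d(x,S)=d(x,y(x))$. Then $v(x)=a(\|A_Y\|)^{d(x,S)}\,w(y(x))$, where on $S$: $w(x)=\big(1-a(\|A_{\mathbb{H}^Q}\|)\big)d(x,0)+1$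 if $Y=\mathbb{H}^Q$, and $w(x)=\big(1+\frac{q-2}{q}d(x,0)\big)(q-1)^{-d(x,0)/2}$ if $Y=\mathbb{G}^{Q,q}$. The vector $v$ has positive entries, satisfies $\sum_y (A_Y)_{xy}v(y)=\|A_Y\|v(x)$ for all $x$, and $v(0)=1$. Finite volumes: $B_n$ is the ball of radius $n$ of $\mathbb{G}^Q$ centred at $0$, $\Lambda_n$ the same ball in $Y$ (with the loops), $S_n=S\cap B_n$. With $P_n$ the orthogonal projection onto $\ell^2(\Lambda_n)$ and $\mathbf{1}_n$ the identity of $\ell^2(\Lambda_n)$: $A_{B_n}=P_nA_{\mathbb{G}^Q}P_n$, $A_{\Lambda_n}=P_nA_YP_n$, $H=\|A_Y\|\mathbf{1}-A_Y$, $H_n=P_nHP_n$. $v_n$ is the Perron--Frobenius eigenvector of $A_{\Lambda_n}$ (positive entries, $A_{\Lambda_n}v_n=\|A_{\Lambda_n}\|v_n$, $v_n(0)=1$); one knows that $v_n(x)\to v(x)$ for each $x$ and $\|v_n\|\to+\infty$. $Q_n$ is the orthogonal projection onto $\ell^2(\Lambda_n)\ominus\mathbb{C}v_n$. Resolvents: $R_B(z)=(z\mathbf{1}-B)^{-1}$. $S_n(\lambda)=P_{\ell^2(S_n)}R_{A_{B_n}}(\lambda)P_{\ell^2(S_n)}$ on $\ell^2(S_n)$, $S(\lambda)=P_{\ell^2(S)}R_{A_{\mathbb{G}^Q}}(\lambda)P_{\ell^2(S)}$ on $\ell^2(S)$; $R_{S_n(\lambda)}(1)=(\mathbf{1}-S_n(\lambda))^{-1}$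 and $R_{S(\lambda)}(1)=(\mathbf{1}-S(\lambda))^{-1}$, extended by $0$ on the orthogonal complement of $\ell^2(S_n)$, resp. $\ell^2(S)$. Expressions at $\|A_Y\|$ involving $R_{S(\|A_Y\|)}(1)$ are understood as limits for $\lambda\downarrow\|A_Y\|$ (finite by transience). Krein formula: $R_{A_Y}(\lambda)=R_{A_{\mathbb{G}^Q}}(\lambda)+R_{A_{\mathbb{G}^Q}}(\lambda)R_{S(\lambda)}(1)P_{\ell^2(S)}R_{A_{\mathbb{G}^Q}}(\lambda)$ for $\lambda>\|A_Y\|$. Densities (inverse temperature $1$): $\rho_{\Lambda_n}(\mu)=|\Lambda_n|^{-1}\operatorname{Tr}(e^{H_n-\mu\mathbf{1}_n}-\mathbf{1}_n)^{-1}$, and $\rho_c=\int\frac{dN(h)}{e^h-1}$, where $N$ is the integrated density of states of $H$, i.e. the cumulative function of the probability measure with $\int f\,dN=\lim_n|\Lambda_n|^{-1}\operatorname{Tr}f(H_n)$ for all continuous $f$ (this limit exists). $\langle(e^H-\mathbf{1})^{-1}\delta_x,\delta_x\rangle=\|(e^H-\mathbf{1})^{-1/2}\delta_x\|^2$, and $\langle\delta_x,v\rangle\langle v,\delta_x\rangle=v(x)^2$.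
   Formalization: For G^{Q,q} the standing condition ||A_Y|| > 2 sqrt(Q-1) is an explicit hypothesis; it fails only in borderline cases Q = Q(q) such as q = 5, Q = 17, where ||A_Y|| = 8 = 2 sqrt(16) and a(||A_Y||) is not defined. *)

(* Defs.v *)
From HB Require Import structures.
From mathcomp Require Import all_boot all_order all_algebra finmap complex.
From mathcomp Require Import all_classical all_reals all_analysis.

Set Implicit Arguments.
Unset Strict Implicit.
Unset Printing Implicit Defensive.

Import Order.TTheory GRing.Theory Num.Theory.
Import numFieldNormedType.Exports.

Local Open Scope classical_set_scope.
Local Open Scope card_scope.
Local Open Scope ring_scope.

(* Sealed under a name because the normed topology of a [numFieldType] is not
   inferred on the bare type [R[i]]. *)
Definition Cplx (R : realType) : numClosedFieldType := R[i]%C.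

Definition toC (R : realType) (r : R) : Cplx R := real_complex R r.

Definition cabs (R : realType) (z : Cplx R) : R := complex.Re `|z|.

Section Summation.
Context (R : realType) (I : choiceType).
Implicit Types f : I -> Cplx R.

(* Unconditional summation along the directed set of finite subsets of [I]. *)
Definition has_sum f (s : Cplx R) : Prop :=
  forall eps : R, 0 < eps ->
  exists A : {fset I}, forall B : {fset I}, (A `<=` B)%fset ->
    cabs (\sum_(i <- B) f i - s) < eps.

Definition usum f : Cplx R := xget 0 [set s | has_sum f s].

End Summation.

Section Hilbert.
Context (R : realType) (V : choiceType).

Definition vec : Type := V -> Cplx R.
Definition op : Type := vec -> vec.
Implicit Types (u w : vec) (T B F : op) (E : set V).

Definition sqnorm u : \bar R := \esum_(x in [set: V]) ((cabs (u x)) ^+ 2)%:E.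

Definition l2 u : Prop := (sqnorm u < +oo)%E.

Definition l2norm u : R := Num.sqrt (fine (sqnorm u)).

(* Linear in the first argument. *)
Definition inner u w : Cplx R := usum (fun x => u x * (w x)^*).

Definition delta (x : V) : vec := fun y => (y == x)%:R.

(* l^2(E) is identified with the vectors of l^2(V) that vanish off [E]. *)
Definition l2on E u : Prop := l2 u /\ forall x, ~ E x -> u x = 0.

Definition l2proj E : op := fun u x => if x \in E then u x else 0.

Definition compress E T : op := fun u => l2proj E (T (l2proj E u)).

Definition addop T1 T2 : op := fun u x => T1 u x + T2 u x.
Definition subop T1 T2 : op := fun u x => T1 u x - T2 u x.
Definition scaleop (r : R) T : op := fun u x => toC r * T u x.

Definition opnorm T : R :=
  sup [set l2norm (T u) | u in [set u | l2 u /\ l2norm u <= 1]].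

Definition linear_on E T : Prop :=
  (forall u, l2on E u -> l2on E (T u)) /\
  (forall (c : Cplx R) u w, l2on E u -> l2on E w ->
     T (fun x => c * u x + w x) = (fun x => c * T u x + T w x)).

(* The inverse of [T], seen as an operator on l^2(E) and extended by 0 on the
   orthogonal complement of l^2(E).  It may be unbounded; [inv_dom] says that
   the inverse exists and is defined at [u]. *)
Definition opinv E T : op :=
  fun u => xget (fun=> 0) [set g | l2on E g /\ T g = l2proj E u].

Definition inv_dom E T u : Prop := exists! g, l2on E g /\ T g = l2proj E u.

Definition resolvent E T (z : R) : op := opinv E (subop (scaleop z id) T).

Definition opexp T : op :=
  fun u x => usum (fun k : nat => iter k T u x / k`!%:R).

(* Positivity over the complex field entails self-adjointness. *)
Definition positive_op B : Prop :=
  [/\ linear_on setT B,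
      exists M : R, forall u, l2 u -> l2norm (B u) <= M * l2norm u
    & forall u, l2 u -> 0 <= inner (B u) u].

Definition opsqrt T : op :=
  xget (id : vec -> vec) [set B | positive_op B /\ forall u, l2 u -> B (B u) = T u].

(* f(T) for a self-adjoint [T] on l^2(E) with [E] finite: the linear map acting
   as f(h) on the eigenspace of [T] for each eigenvalue h. *)
Definition funcalc E T (f : R -> R) : op :=
  xget (id : vec -> vec) [set F | linear_on E F /\
    forall (h : R) u, l2on E u ->
      T u = scaleop h id u -> F u = scaleop (f h) id u].

Definition trace E T : Cplx R := \sum_(x \in E) T (delta x) x.

End Hilbert.

Section Trees.
Context (V : choiceType).
Implicit Types (e : rel V) (E S : set V).

Definition connected_in e E : Prop :=
  forall x y, E x -> E y ->
  exists p, [/\ path e x p, last x p = y & forall z, z \in p -> E z].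

(* A two-element [ucycle] is an edge run through back and forth. *)
Definition acyclic_in e E : Prop :=
  forall c : seq V, (forall z, z \in c -> E z) -> ucycle e c -> (size c <= 2)%N.

(* The subgraph induced by [e] on [E] is a tree all of whose vertices have
   degree [k]. *)
Definition homogeneous_tree e E (k : nat) : Prop :=
  [/\ symmetric e /\ irreflexive e, connected_in e E, acyclic_in e E
    & forall x, E x -> [set y | E y /\ e x y] #= `I_k].

Definition half_line e S (o : V) : Prop :=
  exists phi : nat -> V,
    [/\ injective phi, phi 0%N = o, range phi = S
      & forall i j, e (phi i) (phi j) = (j == i.+1) || (i == j.+1)].

Definition least (P : set nat) : nat :=
  xget 0%N [set k | P k /\ forall j, P j -> (k <= j)%N].

Definition gdist e (x y : V) : nat :=
  least [set k | exists p, [/\ path e x p, last x p = y & size p = k]].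

Definition setdist e (x : V) S : nat := least [set gdist e x y | y in S].

Definition nearest e S (o x : V) : V :=
  xget o [set y | S y /\ gdist e x y = setdist e x S].

Definition gball e (o : V) (n : nat) : set V := [set x | (gdist e x o <= n)%N].

Definition vcard (E : set V) : nat := #|` fset_set E|.

End Trees.

(* The two families of perturbed graphs, [GQq q] being G^{Q,q}. *)
Inductive pgraph := HQ | GQq of nat.

Definition Qmax (R : realType) (q : nat) : nat :=
  let s : R := Num.sqrt (q%:R - 1) in
  (Num.truncn ((2 * s + 1 + Num.sqrt (4 * s + 1)) ^+ 2 / 4)).+1.

Definition admissible (R : realType) (Y : pgraph) (Q : nat) : Prop :=
  match Y with
  | HQ => (3 <= Q <= 7)%N
  | GQq q => [/\ (3 <= q)%N, (q < Q)%N & (Q <= Qmax R q)%N]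
  end.

Definition perturbed_set (V : choiceType) (e : rel V) (Y : pgraph)
    (S : set V) (o : V) : Prop :=
  match Y with
  | HQ => half_line e S o
  | GQq q => homogeneous_tree e S q /\ S o
  end.

Section Model.
Context (R : realType) (V : choiceType) (e : rel V) (S : set V) (o : V).

Local Notation vec := (vec R V).
Local Notation op := (op R V).

Definition adjG : op := fun u x => \sum_(y \in [set y | e x y]) u y.

Definition adjY : op := addop adjG (l2proj S).

Definition normY : R := opnorm adjY.

Local Notation B n := (gball e o n).

Definition adjL (n : nat) : op := compress (B n) adjY.
Definition normL (n : nat) : R := opnorm (adjL n).

Definition Ham : op := subop (scaleop normY id) adjY.
Definition Hamn (n : nat) : op := compress (B n) Ham.

(* R_A(z) R_{S(z)}(1) R_A(z) for [A] the restriction of [adjG] to l^2(E), where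
   S(z) is the compression of R_A(z) to l^2(S `&` E).  The cases of interest are
   E = B n and E = setT. *)
Definition krein (E : set V) (z : R) : op :=
  let RA := resolvent E (compress E adjG) z in
  let SE := S `&` E in
  fun u => RA (resolvent SE (compress SE RA) 1 (RA u)).

Definition acoef (Q : nat) (z : R) : R :=
  (1 - Num.sqrt (1 - 4 * (Q%:R - 1) / z ^+ 2)) / (2 * (Q%:R - 1) / z).

(* The values on [S], where d(x,S) = 0; [pf] extends them to all of [V]. *)
Definition wcoef (Y : pgraph) (Q : nat) (x : V) : R :=
  let d := (gdist e x o)%:R in
  match Y with
  | HQ => (1 - acoef Q normY) * d + 1
  | GQq q => (1 + (q%:R - 2) / q%:R * d) *
             (q%:R - 1) `^ (- d / 2)
  end.

Definition pf (Y : pgraph) (Q : nat) : vec := fun x =>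
  toC (acoef Q normY ^+ setdist e x S * wcoef Y Q (nearest e S o x)).

Definition is_pfn (n : nat) (w : vec) : Prop :=
  [/\ forall x, B n x -> 0 < w x,
      forall x, ~ B n x -> w x = 0,
      adjL n w = scaleop (normL n) id w
    & w o = 1].

(* Projection onto the orthogonal complement of [w] in l^2(B n). *)
Definition Qproj (n : nat) (w : vec) : op := fun u x =>
  l2proj (B n) u x - inner u w / toC (l2norm w ^+ 2) * w x.

Definition bose (n : nat) (mu : R) : op :=
  opinv (B n)
    (subop (opexp (subop (Hamn n) (scaleop mu (l2proj (B n))))) (l2proj (B n))).

Definition omegan (n : nat) (mu : R) (u1 u2 : vec) : Cplx R :=
  inner (bose n mu u1) u2.

Definition sqrt_boseH : op := opsqrt (subop (opexp Ham) id).

(* The quadratic form of the unbounded operator (e^H - 1)^{-1}; meaningful for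
   vectors in the domain of (e^H - 1)^{-1/2}. *)
Definition omegaD (D : R) (v : vec) (u1 u2 : vec) : Cplx R :=
  inner (opinv setT sqrt_boseH u1) (opinv setT sqrt_boseH u2)
  + toC D * inner u1 v * inner v u2.

Definition density (n : nat) (mu : R) : R :=
  complex.Re (trace (B n) (bose n mu)) / (vcard (B n))%:R.

Definition is_ids (N : probability (measurableTypeR R) R) : Prop :=
  forall f : R -> R, continuous f ->
    (fun n => trace (B n) (funcalc (B n) (Hamn n) f) / (vcard (B n))%:R) @ \oo
      --> toC (\int[N]_h f h).

(* In [\bar R] the integrand is +oo at h = 0. *)
Definition densityc (N : probability (measurableTypeR R) R) : \bar R :=
  (\int[N]_h ((expR h - 1)%:E)^-1)%E.

End Model.

(* Main.v *)
(* On a ball [B n] the finite-dimensional spectral theorem gives an eigenbasis of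
   [Z - mu n - A_Lambda_n], with [Z] the norm of [A_Y]; these operators converge
   strongly to [H], so [H] has a functional calculus which is the limit of the
   finite ones.  Krein's formula says that the operator in the hypothesis is the
   resolvent of [A_Y] minus that of [A_G], and the latter has no singularity at
   [Z], which lies above the spectrum of [A_G].  Hence the quadratic form of [1/h]
   on [Q_n delta_x] converges to that of [1/H] on [delta_x].  Since
   [1/(e^h - 1) - 1/(e^(h+r) - 1)] is at most a constant times [1/h - 1/(h+r)],
   the same holds for [1/(e^h - 1)].  The remaining component of [delta_x], along
   [v_n], contributes [v_n(x)^2 / (|v_n|^2 (e^eps_n - 1))] with
   [eps_n = Z - |A_Lambda_n| - mu n], which tends to [D v(x)^2].

   The convergence of [v_n] to [v] and of [|A_Lambda_n|] to [|A_Y|] follows from a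
   recursion on the levels of the tree: [v_n] depends only on the distance to [S]
   and on the level of the nearest point of [S], and off [S] the ratio of
   consecutive values is a continued fraction converging to [a(|A_Y|)].

   For the density, [H_n >= Z - 2 sqrt(Q-1) - P_S] shows that at most a multiple of
   [|S_n|] eigenvalues lie below half the gap; each contributes at most
   [1/eps_n], so that the assumption on [|v_n|^2 |S_n| / |Lambda_n|] makes them
   negligible, and above the gap the integrand is continuous and bounded. *)

From HB Require Import structures.
Require Import Defs.
From mathcomp Require Import all_boot all_order all_algebra finmap complex.
From mathcomp Require Import all_classical all_reals all_analysis.
From mathcomp Require Import spectral sesquilinear measurable_realfun ring lra.

Import Order.TTheory GRing.Theory Num.Theory.
Import numFieldNormedType.Exports.

Local Open Scope classical_set_scope.
Local Open Scope ring_scope.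

Set Implicit Arguments.
Unset Strict Implicit.
Unset Printing Implicit Defensive.

(** * The Hilbert space of square-summable vectors *)

(** (e^H - 1)^-1 is unbounded, and [omegaD] refers to it through an inverse of whichever positive
    square root of e^H - 1 [opsqrt] selects. So the limit is described as a number, the supremum
    over shifts r > 0 of the forms of 1/(e^(H+r) - 1), and every positive square root is shown to
    have each [delta x] in its range, with a preimage of that squared norm. A symmetric operator
    with all [delta x] in its range is injective, which makes the inverse well defined. The danger
    in the limit is spectral mass of Q_n delta_x escaping to h = 0. The Krein hypothesis rules it
    out: the sums of 1/h converge to the very number to which the shifted forms increase. The norm
    of A_Y is caught between two estimates. A positive solution of the eigenvalue equation, even
    outside l^2, bounds it from above by the Schur test; too small an eigenvalue on a large ball
    would make sums of positive terms over the spheres of S negative. At the common value the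
    recurrence along S has a double characteristic root: hence the affine factor of w and the
    quadratic equation behind Q(q). *)

Section ComplexNumbers.
Context (R : realType).
Implicit Types (z w : Cplx R) (r : R).
Local Notation toC := (@toC R).

HB.instance Definition _ := GRing.RMorphism.copy toC (real_complex R).

Lemma toC_inj : injective toC.
Proof. exact: complexI. Qed.

Lemma ler_toC r1 r2 : (toC r1 <= toC r2) = (r1 <= r2).
Proof. exact: lecR. Qed.

Lemma ltr_toC r1 r2 : (toC r1 < toC r2) = (r1 < r2).
Proof. exact: ltcR. Qed.

Lemma conj_toC r : (toC r)^* = toC r.
Proof. exact: conjc_real. Qed.

Lemma cabsE z : toC (cabs z) = `|z|.
Proof. by rewrite /cabs (normc_def (z : R[i])). Qed.

Lemma cabs_ge0 z : 0 <= cabs z.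
Proof. by rewrite -ler_toC rmorph0 cabsE normr_ge0. Qed.

Lemma cabsM z w : cabs (z * w) = cabs z * cabs w.
Proof. by apply: toC_inj; rewrite rmorphM !cabsE normrM. Qed.

Lemma cabs_le_add z w : cabs (z + w) <= cabs z + cabs w.
Proof. by rewrite -ler_toC rmorphD !cabsE ler_normD. Qed.

Lemma cabsN z : cabs (- z) = cabs z.
Proof. by apply: toC_inj; rewrite !cabsE normrN. Qed.

Lemma cabsB z w : cabs (z - w) = cabs (w - z).
Proof. by rewrite -cabsN opprB. Qed.

Lemma cabs_conj z : cabs z^* = cabs z.
Proof. by apply: toC_inj; rewrite !cabsE norm_conjC. Qed.

Lemma cabs_toC r : cabs (toC r) = `|r|.
Proof.
rewrite /cabs (normc_def (toC r : R[i])) /=.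
by rewrite expr0n /= addr0 sqrtr_sqr.
Qed.

Lemma cabs0 : cabs (0 : Cplx R) = 0.
Proof. by rewrite -(rmorph0 toC) cabs_toC normr0. Qed.

Lemma cabs_eq0 z : (cabs z == 0) = (z == 0).
Proof. by rewrite -(inj_eq toC_inj) cabsE rmorph0 normr_eq0. Qed.

Lemma cabs_sqr z : toC (cabs z ^+ 2) = z * z^*.
Proof. by rewrite rmorphXn /= cabsE normCK. Qed.

Lemma cabs_sum (I : Type) (s : seq I) (P : pred I) (F : I -> Cplx R) :
  cabs (\sum_(i <- s | P i) F i) <= \sum_(i <- s | P i) cabs (F i).
Proof.
rewrite -ler_toC cabsE rmorph_sum /=.
rewrite [X in _ <= X](eq_bigr (fun i => `|F i|)) ?ler_norm_sum // => i _; rewrite cabsE.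
Qed.

Lemma cabs_real z : 0 <= z -> z = toC (cabs z).
Proof. by move=> z0; rewrite cabsE ger0_norm. Qed.

Lemma cabs_small z : (forall eps : R, 0 < eps -> cabs z <= eps) -> z = 0.
Proof.
move=> h; apply/eqP; rewrite -cabs_eq0 eq_le cabs_ge0 andbT.
apply/ler_addgt0Pr => eps e0; rewrite add0r; exact: h.
Qed.

Lemma cabs_le_ReIm z :
  cabs z <= `|complex.Re (z : R[i])| + `|complex.Im (z : R[i])|.
Proof.
rewrite {1}[z](complexE (z : R[i])); apply: le_trans (cabs_le_add _ _) _.
rewrite cabsM !cabs_toC lerD2l.
suff -> : cabs ('i%C : R[i]) = 1 by rewrite mul1r.
by rewrite /cabs (normc_def ('i%C : R[i])) /= expr0n expr1n /= add0r sqrtr1.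
Qed.

Lemma normr_Re_le z : `|complex.Re (z : R[i])| <= cabs z.
Proof. by rewrite -ler_toC cabsE; exact: normc_ge_Re. Qed.

Lemma normr_Im_le z : `|complex.Im (z : R[i])| <= cabs z.
Proof.
rewrite -normrN -ReiNIm -ler_toC cabsE; apply: (le_trans (normc_ge_Re _)).
rewrite normrM (normc_def ('i%C : R[i])) /= expr0n expr1n /= add0r.
by rewrite sqrtr1 mulr1.
Qed.

(** Four nonnegative parts, each at most [cabs z], reduce absolute summability to sums of
    nonnegative reals. *)
Lemma complex_split z : exists q : (R * R) * (R * R),
  [/\ [/\ 0 <= q.1.1, 0 <= q.1.2, 0 <= q.2.1 & 0 <= q.2.2],
      [/\ q.1.1 <= cabs z, q.1.2 <= cabs z, q.2.1 <= cabs z & q.2.2 <= cabs z]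
    & z = toC q.1.1 - toC q.1.2 + 'i * (toC q.2.1 - toC q.2.2)].
Proof.
have key (x : R) : `|x| <= cabs z -> exists a b : R, [/\ 0 <= a, 0 <= b, a <= cabs z,
    b <= cabs z & x = a - b].
  move=> hx; exists (Num.max x 0), (Num.max (- x) 0).
  have := ler_norm x; have := ler_norm (- x); rewrite normrN.
  have := cabs_ge0 z.
  by case: (leP x 0) => h1; case: (leP (- x) 0) => h2; split; lra.
have [a [b [a0 b0 aM bM ab]]] := key _ (normr_Re_le z).
have [c [d [c0 d0 cM dM cd]]] := key _ (normr_Im_le z).
exists ((a, b), (c, d)); split=> //=.
by rewrite -!rmorphB -ab -cd; exact: complexE.
Qed.

End ComplexNumbers.

Section Summability.
Context (R : realType) (I : choiceType).
Implicit Types (f g : I -> Cplx R) (s t : Cplx R) (X A B : {fset I}).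
Local Notation toC := (@toC R).

Lemma fset_sum_mono (r : I -> R) A B : (forall i, 0 <= r i) -> (A `<=` B)%fset ->
  \sum_(i <- A) r i <= \sum_(i <- B) r i.
Proof.
move=> r0 AB; rewrite [leRHS](big_fsetID _ (mem A)) /=.
have -> : [fset x in B | x \in A]%fset = A.
  by apply/fsetP => i; rewrite !inE /= andb_idl //; exact: fsubsetP.
by rewrite lerDl sumr_ge0.
Qed.

Lemma has_sum_unique f s t : has_sum f s -> has_sum f t -> s = t.
Proof.
move=> hs ht; apply/eqP; rewrite -subr_eq0; apply/eqP.
apply: cabs_small => eps e0; have e2 : 0 < eps / 2 by rewrite divr_gt0.
have [A hA] := hs _ e2; have [B hB] := ht _ e2.
have := hA (A `|` B)%fset (fsubsetUl _ _).
have := hB (A `|` B)%fset (fsubsetUr _ _).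
set S := \sum_(i <- _) _ => h1 h2.
have -> : s - t = (S - t) - (S - s) by ring.
by apply: le_trans (cabs_le_add _ _) _; rewrite cabsN; lra.
Qed.

Lemma usumE f s : has_sum f s -> usum f = s.
Proof.
by move=> hs; apply: xget_unique => // t ht; exact: has_sum_unique ht hs.
Qed.

Lemma has_sum_lin (c : Cplx R) f g s t : has_sum f s -> has_sum g t ->
  has_sum (fun i => c * f i + g i) (c * s + t).
Proof.
move=> hf hg eps e0.
have c0 : 0 < cabs c + 1 by rewrite ltr_wpDl // cabs_ge0.
have e1 : 0 < eps / 2 / (cabs c + 1) by rewrite !divr_gt0.
have e2 : 0 < eps / 2 by rewrite divr_gt0.
have [A hA] := hf _ e1; have [B hB] := hg _ e2.
exists (A `|` B)%fset => X; rewrite fsubUset => /andP[AX BX].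
rewrite big_split /= -mulr_sumr.
have -> : c * \sum_(i <- X) f i + \sum_(i <- X) g i - (c * s + t) =
  c * (\sum_(i <- X) f i - s) + (\sum_(i <- X) g i - t) by ring.
apply: le_lt_trans (cabs_le_add _ _) _; rewrite cabsM.
have h1 := hA _ AX; have h2 := hB _ BX.
have : cabs c * cabs (\sum_(i <- X) f i - s) <= eps / 2.
  apply: (@le_trans _ _ (cabs c * (eps / 2 / (cabs c + 1)))).
    by apply: ler_wpM2l (ltW h1); exact: cabs_ge0.
  rewrite mulrA ler_pdivrMr // mulrC ler_pM2l //; lra.
by move: h2; lra.
Qed.

Lemma has_sum_fset A f : (forall i, i \notin A -> f i = 0) ->
  has_sum f (\sum_(i <- A) f i).
Proof.
move=> f0 eps e0; exists A => B AB.
rewrite -(big_fset_incl _ AB) ?subrr ?cabs0 // => i _; exact: f0.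
Qed.

Lemma has_sum_nonneg (r : I -> R) M : (forall i, 0 <= r i) ->
  (forall X, \sum_(i <- X) r i <= M) -> exists s : R, has_sum (fun i => toC (r i)) (toC s).
Proof.
move=> r0 rM; pose E := [set \sum_(i <- X) r i | X in [set: {fset I}]].
have supE : has_sup E.
  split; first by exists (\sum_(i <- fset0) r i), fset0.
  by exists M => _ [X _ <-].
exists (sup E) => eps e0.
have [_ [A _ <-] hA] := sup_adherent e0 supE.
exists A => B AB.
rewrite -rmorph_sum -rmorphB /= cabs_toC ltr_norml.
have h1 := fset_sum_mono r0 AB.
have h2 : \sum_(i <- B) r i <= sup E.
  by apply: ub_le_sup; [exact: (proj2 supE)|exists B].
by move: hA h1 h2 e0; set u := sup E; lra.
Qed.

(** Each of the four nonnegative parts of [f] sums to the supremum of its finite partial sums, and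
    [has_sum_lin] recombines them. *)
Lemma has_sum_abs f M : (forall X, \sum_(i <- X) cabs (f i) <= M) ->
  exists s, has_sum f s.
Proof.
move=> fM; have /choice[q hq] := fun i => complex_split (f i).
have key (r : I -> R) : (forall i, 0 <= r i <= cabs (f i)) ->
    exists s : R, has_sum (fun i => toC (r i)) (toC s).
  move=> hr; apply: (@has_sum_nonneg _ M) => [i|X].
    by case/andP: (hr i).
  by apply: le_trans (fM X); apply: ler_sum => i _; case/andP: (hr i).
have [a ha] : exists s : R, has_sum (fun i => toC (q i).1.1) (toC s).
  by apply: key => i; case: (hq i) => -[-> _ _ _] [-> _ _ _].
have [b hb] : exists s : R, has_sum (fun i => toC (q i).1.2) (toC s).
  by apply: key => i; case: (hq i) => -[_ -> _ _] [_ -> _ _].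
have [c hc] : exists s : R, has_sum (fun i => toC (q i).2.1) (toC s).
  by apply: key => i; case: (hq i) => -[_ _ -> _] [_ _ -> _].
have [d hd] : exists s : R, has_sum (fun i => toC (q i).2.2) (toC s).
  by apply: key => i; case: (hq i) => -[_ _ _ ->] [_ _ _ ->].
have hcd := has_sum_lin (-1) hd hc.
have hab := has_sum_lin (-1) hb ha.
have H := has_sum_lin 'i hcd hab.
exists ('i * (-1 * toC d + toC c) + (-1 * toC b + toC a)); move: H.
congr (has_sum _ _); apply/funext => i; case: (hq i) => _ _ {1}->; ring.
Qed.

Lemma has_sum_bound f s M : has_sum f s ->
  (forall X, cabs (\sum_(i <- X) f i) <= M) -> cabs s <= M.
Proof.
move=> hs hM; apply/ler_addgt0Pr => eps e0.
have [A hA] := hs _ e0; have := hA A (fsubset_refl _) => h.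
have -> : s = \sum_(i <- A) f i - (\sum_(i <- A) f i - s) by ring.
apply: le_trans (cabs_le_add _ _) _; rewrite cabsN; have := hM A; lra.
Qed.

End Summability.

Lemma cauchy_schwarz_sum (R : realFieldType) (I : Type) (s : seq I) (f g : I -> R) :
  (\sum_(i <- s) f i * g i) ^+ 2 <=
  (\sum_(i <- s) f i ^+ 2) * (\sum_(i <- s) g i ^+ 2).
Proof.
set A := \sum_(i <- s) f i ^+ 2; set B := \sum_(i <- s) g i ^+ 2.
set C := \sum_(i <- s) f i * g i.
have key (t : R) : 0 <= B * t ^+ 2 - 2 * C * t + A.
  have -> : B * t ^+ 2 - 2 * C * t + A = \sum_(i <- s) (f i - t * g i) ^+ 2.
    rewrite (eq_bigr (fun i => f i ^+ 2 - 2 * t * (f i * g i) + t ^+ 2 * g i ^+ 2));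
      last by move=> i _; ring.
    rewrite big_split sumrB /= -!mulr_sumr -/A -/B -/C; ring.
  by apply: sumr_ge0 => i _; exact: sqr_ge0.
have B0 : 0 <= B by apply: sumr_ge0 => i _; exact: sqr_ge0.
have A0 : 0 <= A by apply: sumr_ge0 => i _; exact: sqr_ge0.
have [B00|Bn0] := eqVneq B 0.
  have [->|C0] := eqVneq C 0; first by rewrite expr0n /= mulr_ge0.
  (* For B = 0 the quadratic is affine in t, and this t makes it equal to -1. *)
  have := key ((A + 1) / (2 * C)); rewrite B00 mul0r add0r.
  have -> : - (2 * C * ((A + 1) / (2 * C))) + A = - 1 by field.
  by lra.
have {}B0 : 0 < B by rewrite lt_def Bn0.
have := key (C / B).
have -> : B * (C / B) ^+ 2 - 2 * C * (C / B) + A = (A * B - C ^+ 2) / B by field.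
by rewrite pmulr_lge0 ?invr_gt0 // subr_ge0.
Qed.

Section SquareSummable.
Context (R : realType) (V : choiceType).
Implicit Types (u w : vec R V) (X : {fset V}) (c : Cplx R).
Local Notation toC := (@toC R).
Local Notation N u X := (\sum_(x <- X) cabs (u x) ^+ 2).

Lemma sqnorm_ge u X : ((N u X)%:E <= sqnorm u)%E.
Proof.
apply: esum_ge; exists [set` X].
  by split=> //; exact: finite_fset.
by rewrite fsbig_finite ?finite_fset // set_fsetK sumEFin.
Qed.

Lemma l2_bound u M : 0 <= M -> (forall X, N u X <= M ^+ 2) ->
  l2 u /\ l2norm u <= M.
Proof.
move=> M0 hM.
have h : (sqnorm u <= (M ^+ 2)%:E)%E.
  apply: ge_ereal_sup => _ [X [Xfin _] <-].
  by rewrite fsbig_finite // sumEFin lee_fin.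
have h0 : (0%:E <= sqnorm u)%E by apply: esum_ge0 => x _; rewrite lee_fin sqr_ge0.
split; first by apply: le_lt_trans h _; rewrite ltry.
rewrite /l2norm -(ger0_norm M0) -sqrtr_sqr ler_wsqrtr //.
by move: h h0; case: (sqnorm u).
Qed.

Lemma l2norm_ge0 u : 0 <= l2norm u.
Proof. exact: sqrtr_ge0. Qed.

Lemma l2norm_fset u X : l2 u -> N u X <= l2norm u ^+ 2.
Proof.
have := sqnorm_ge u X; rewrite /l2 /l2norm.
have h0 : (0%:E <= sqnorm u)%E by apply: esum_ge0 => x _; rewrite lee_fin sqr_ge0.
move: h0; case: (sqnorm u) => [r||] //=; rewrite !lee_fin => r0 h _.
by rewrite sqr_sqrtr.
Qed.

Lemma cabs_le_l2norm u x : l2 u -> cabs (u x) <= l2norm u.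
Proof.
move=> lu; have := l2norm_fset [fset x]%fset lu; rewrite big_seq_fset1.
by rewrite ler_pXn2r // nnegrE ?cabs_ge0 ?l2norm_ge0.
Qed.

Lemma cauchy_schwarz_fset u w X : l2 u -> l2 w ->
  \sum_(x <- X) cabs (u x) * cabs (w x) <= l2norm u * l2norm w.
Proof.
move=> lu lw.
have h : (\sum_(x <- X) cabs (u x) * cabs (w x)) ^+ 2 <= (l2norm u * l2norm w) ^+ 2.
  apply: le_trans (cauchy_schwarz_sum _ _ _) _.
  rewrite exprMn ler_pM ?l2norm_fset ?sumr_ge0 // => i _; exact: sqr_ge0.
rewrite -(@ler_pXn2r _ 2) // nnegrE ?mulr_ge0 ?l2norm_ge0 //.
by apply: sumr_ge0 => i _; rewrite mulr_ge0 ?cabs_ge0.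
Qed.

Lemma l2_lin c u w : l2 u -> l2 w -> l2 (fun x => c * u x + w x) /\
  l2norm (fun x => c * u x + w x) <= cabs c * l2norm u + l2norm w.
Proof.
move=> lu lw; apply: l2_bound => [|X].
  by rewrite addr_ge0 ?mulr_ge0 ?cabs_ge0 ?l2norm_ge0.
apply: (@le_trans _ _ (\sum_(x <- X) (cabs c ^+ 2 * cabs (u x) ^+ 2 +
   2 * cabs c * (cabs (u x) * cabs (w x)) + cabs (w x) ^+ 2))).
  apply: ler_sum => x _.
  apply: (@le_trans _ _ ((cabs c * cabs (u x) + cabs (w x)) ^+ 2)).
    rewrite ler_pXn2r ?nnegrE ?cabs_ge0 ?addr_ge0 ?mulr_ge0 ?cabs_ge0 //.
    by rewrite -cabsM cabs_le_add.
  by rewrite le_eqVlt; apply/orP; left; apply/eqP; ring.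
rewrite !big_split /= -!mulr_sumr.
have h1 := l2norm_fset X lu; have h2 := l2norm_fset X lw.
have h3 := cauchy_schwarz_fset X lu lw.
have c0 := cabs_ge0 c.
have : cabs c ^+ 2 * N u X <= cabs c ^+ 2 * l2norm u ^+ 2.
  by apply: ler_wpM2l => //; exact: sqr_ge0.
have : 2 * cabs c * \sum_(x <- X) cabs (u x) * cabs (w x)
     <= 2 * cabs c * (l2norm u * l2norm w).
  by apply: ler_wpM2l => //; rewrite mulr_ge0.
rewrite sqrrD exprMn -mulr_natl mulrA; lra.
Qed.

Lemma l2_0 : l2 ((fun=> 0) : vec R V) /\ l2norm ((fun=> 0) : vec R V) <= 0.
Proof.
by apply: l2_bound => // X; rewrite big1 ?expr0n //= => x _; rewrite cabs0 expr0n.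
Qed.

Lemma l2Z c u : l2 u -> l2 (fun x => c * u x).
Proof.
move=> lu; have [h _] := l2_lin c lu (proj1 l2_0).
by move: h; congr l2; apply/funext => x; rewrite addr0.
Qed.

Lemma l2D u w : l2 u -> l2 w -> l2 (fun x => u x + w x).
Proof.
move=> lu lw; have [h _] := l2_lin 1 lu lw.
by move: h; congr l2; apply/funext => x; rewrite mul1r.
Qed.

Lemma l2B u w : l2 u -> l2 w -> l2 (fun x => u x - w x).
Proof.
move=> lu lw; have [h _] := l2_lin (-1) lw lu.
by move: h; congr l2; apply/funext => x; rewrite mulN1r addrC.
Qed.

Lemma l2normD u w : l2 u -> l2 w -> l2norm (fun x => u x + w x) <= l2norm u + l2norm w.
Proof.
move=> lu lw; have [_] := l2_lin 1 lu lw.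
rewrite -(rmorph1 toC) cabs_toC normr1 rmorph1 mul1r; congr (_ <= _); congr l2norm.
by apply/funext => x; rewrite mul1r.
Qed.

Lemma l2norm_le_fset u M : 0 <= M -> (forall X, N u X <= M ^+ 2) -> l2norm u <= M.
Proof. by move=> M0 h; case: (l2_bound M0 h). Qed.

Lemma l2normZ c u : l2 u -> l2norm (fun x => c * u x) = cabs c * l2norm u.
Proof.
have key d w : l2 w -> l2norm (fun x => d * w x) <= cabs d * l2norm w.
  move=> lw; apply: l2norm_le_fset; first by rewrite mulr_ge0 ?cabs_ge0 ?l2norm_ge0.
  move=> X; rewrite (eq_bigr (fun x => cabs d ^+ 2 * cabs (w x) ^+ 2)).
    by rewrite -mulr_sumr exprMn ler_wpM2l ?sqr_ge0 // l2norm_fset.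
  by move=> x _; rewrite cabsM exprMn.
move=> lu; apply/eqP; rewrite eq_le key //=.
have [->|c0] := eqVneq c 0; first by rewrite cabs0 mul0r l2norm_ge0.
have := key c^-1 _ (l2Z c lu).
have -> : (fun x => c^-1 * (c * u x)) = u by apply/funext => x; rewrite mulKf.
have e1 : cabs c^-1 * cabs c = 1.
  by rewrite -cabsM mulVf // -(rmorph1 toC) cabs_toC normr1.
have c1 : 0 < cabs c by rewrite lt_def cabs_ge0 cabs_eq0 c0.
move=> h; apply: le_trans (ler_wpM2l (ltW c1) h) _.
by rewrite mulrA (mulrC (cabs c)) e1 mul1r.
Qed.

Lemma l2normN u : l2 u -> l2norm (fun x => - u x) = l2norm u.
Proof.
move=> lu; rewrite -[RHS]mul1r -[1](@normr1 R) -normrN -cabs_toC -l2normZ //.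
by congr l2norm; apply/funext => x; rewrite rmorphN1 mulN1r.
Qed.

Lemma l2norm_subC u w : l2 u -> l2 w ->
  l2norm (fun x => u x - w x) = l2norm (fun x => w x - u x).
Proof.
move=> lu lw; rewrite -l2normN; last exact: l2B.
by congr l2norm; apply/funext => x; rewrite opprB.
Qed.

Lemma l2_dist_triangle u w (v : vec R V) : l2 u -> l2 w -> l2 v ->
  l2norm (fun x => u x - w x) <= l2norm (fun x => u x - v x) + l2norm (fun x => v x - w x).
Proof.
move=> lu lw lv; apply: le_trans (l2normD (l2B lu lv) (l2B lv lw)).
by rewrite le_eqVlt; apply/orP; left; apply/eqP; congr l2norm; apply/funext => x; ring.
Qed.

Lemma inner_has_sum u w : l2 u -> l2 w ->
  has_sum (fun x => u x * (w x)^*) (inner u w).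
Proof.
move=> lu lw; have [s hs] : exists s, has_sum (fun x => u x * (w x)^*) s.
  apply: (@has_sum_abs _ _ _ (l2norm u * l2norm w)) => X.
  rewrite (eq_bigr (fun x => cabs (u x) * cabs (w x))) ?cauchy_schwarz_fset //.
  by move=> x _; rewrite cabsM cabs_conj.
by rewrite /inner (usumE hs).
Qed.

Lemma cauchy_schwarz u w : l2 u -> l2 w -> cabs (inner u w) <= l2norm u * l2norm w.
Proof.
move=> lu lw; apply: has_sum_bound (inner_has_sum lu lw) _ => X.
apply: le_trans (cabs_sum _ _ _) _.
rewrite (eq_bigr (fun x => cabs (u x) * cabs (w x))) ?cauchy_schwarz_fset //.
by move=> x _; rewrite cabsM cabs_conj.
Qed.

Lemma inner_linl c u w v : l2 u -> l2 w -> l2 v ->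
  inner (fun x => c * u x + w x) v = c * inner u v + inner w v.
Proof.
move=> lu lw lv; apply: usumE.
have := has_sum_lin c (inner_has_sum lu lv) (inner_has_sum lw lv).
by congr (has_sum _ _); apply/funext => x; ring.
Qed.

Lemma has_sum_conj (f : V -> Cplx R) s : has_sum f s ->
  has_sum (fun x => (f x)^*) s^*.
Proof.
move=> h eps e0; have [A hA] := h _ e0; exists A => B AB.
by rewrite -rmorph_sum -rmorphB cabs_conj hA.
Qed.

Lemma inner_conj u w : l2 u -> l2 w -> inner w u = (inner u w)^*.
Proof.
move=> lu lw; apply: usumE.
have := has_sum_conj (inner_has_sum lu lw); congr (has_sum _ _).
by apply/funext => x; rewrite rmorphM /= conjCK mulrC.
Qed.

Lemma inner_linr c u w v : l2 u -> l2 w -> l2 v ->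
  inner v (fun x => c * u x + w x) = c^* * inner v u + inner v w.
Proof.
move=> lu lw lv; rewrite inner_conj //; last exact: (proj1 (l2_lin _ _ _)).
by rewrite inner_linl // rmorphD rmorphM /= -!inner_conj.
Qed.

(** [inner] is an unordered complex sum and [l2norm] an extended real one. Finite partial sums give
    one inequality between them, Cauchy-Schwarz the other. *)
Lemma inner_self u : l2 u -> inner u u = toC (l2norm u ^+ 2).
Proof.
move=> lu.
have [s hs] : exists s : R, has_sum (fun x => toC (cabs (u x) ^+ 2)) (toC s).
  apply: (@has_sum_nonneg _ _ _ (l2norm u ^+ 2)) => [i|X]; first exact: sqr_ge0.
  exact: l2norm_fset.
have e : inner u u = toC s.
  apply: usumE; move: hs; congr (has_sum _ _); apply/funext => x.
  by rewrite cabs_sqr.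
have hub X : N u X <= s.
  apply/ler_addgt0Pr => eps e0; have [A hA] := hs _ e0.
  have := hA (A `|` X)%fset (fsubsetUl _ _).
  rewrite -rmorph_sum -rmorphB cabs_toC => /ltW; rewrite ler_norml => /andP[_].
  have := @fset_sum_mono _ _ (fun x => cabs (u x) ^+ 2) _ _ (fun x => sqr_ge0 _)
     (fsubsetUr A X); lra.
have s0 : 0 <= s by have := hub fset0; rewrite big_seq_fset0.
rewrite e; congr toC; apply/eqP; rewrite eq_le; apply/andP; split; last first.
  rewrite -(sqr_sqrtr s0) ler_pXn2r ?nnegrE ?l2norm_ge0 ?sqrtr_ge0 //.
  by apply: l2norm_le_fset => [|X]; rewrite ?sqrtr_ge0 ?sqr_sqrtr.
apply: (@le_trans _ _ (cabs (toC s))); first by rewrite cabs_toC ler_norm.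
by rewrite -e expr2; exact: cauchy_schwarz.
Qed.

End SquareSummable.

(** * Convergence in norm and completeness *)

Section StrongConvergence.
Context (R : realType) (V : choiceType).
Implicit Types (u w : vec R V) (X : {fset V}) (c : Cplx R).
Local Notation toC := (@toC R).
Local Notation "u \-v w" := (fun x => u x - w x) (at level 50).

(* A record rather than a plain definition, so that conversion never looks
   inside the filters. *)
Record l2cvg (un : nat -> vec R V) (u : vec R V) : Prop := L2cvg {
  l2cvgE : (fun n => l2norm (un n \-v u)) @ \oo --> (0 : R) }.

Record ccvg (z : nat -> Cplx R) (l : Cplx R) : Prop := Ccvg {
  ccvgE : (fun n => cabs (z n - l)) @ \oo --> (0 : R) }.

Lemma cvg0_le (f g : nat -> R) : (forall n, 0 <= f n) ->
  (\forall n \near \oo, f n <= g n) -> g @ \oo --> (0 : R) -> f @ \oo --> (0 : R).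
Proof.
move=> f0 fg g0; apply: (squeeze_cvgr _ (cvg_cst 0) g0).
by near=> n; rewrite f0 /=; near: n.
Unshelve. all: by end_near. Qed.

Lemma cvg0_add (f g : nat -> R) : f @ \oo --> (0 : R) -> g @ \oo --> (0 : R) ->
  (fun n => f n + g n) @ \oo --> (0 : R).
Proof. by move=> hf hg; have := cvgD hf hg; rewrite addr0; exact. Qed.

Lemma cvg0_mul (f g : nat -> R) (l : R) : f @ \oo --> (0 : R) -> g @ \oo --> l ->
  (fun n => f n * g n) @ \oo --> (0 : R).
Proof. by move=> hf hg; have := cvgM hf hg; rewrite mul0r; exact. Qed.

Lemma cvg0_scale (c : R) (f : nat -> R) : f @ \oo --> (0 : R) ->
  (fun n => c * f n) @ \oo --> (0 : R).
Proof.
by move=> hf; have := cvgM (cvg_cst c) hf; rewrite mulr0; exact.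
Qed.

Lemma cvg0_eps (f : nat -> R) : (forall n, 0 <= f n) ->
  (forall eps, 0 < eps -> \forall n \near \oo, f n <= eps) -> f @ \oo --> (0 : R).
Proof.
move=> f0 h; apply/cvgr0Pnorm_le => eps e0; near=> n.
by rewrite ger0_norm //; near: n; exact: h.
Unshelve. all: by end_near. Qed.

Lemma ccvg_cvg z l : ccvg z l -> z @ \oo --> l.
Proof.
move=> [h]; apply/cvgrPdist_lt => eps e0.
have eE := cabs_real (ltW e0).
have e1 : 0 < cabs eps by rewrite -ltr_toC -eE rmorph0.
move/cvgr0Pnorm_lt : h => /(_ _ e1); apply: filterS => n.
by rewrite ger0_norm ?cabs_ge0 // cabsB [X in _ -> _ < X]eE -cabsE ltr_toC.
Qed.

Lemma ccvg_unique z l l' : ccvg z l -> ccvg z l' -> l = l'.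
Proof.
move=> [h] [h']; apply/eqP; rewrite -subr_eq0 -cabs_eq0; apply/eqP.
have hh : (fun=> cabs (l - l')) @ \oo --> (0 : R).
  have := cvg0_add h h'; apply: (@cvg0_le (fun=> _)) => [n|].
    exact: cabs_ge0.
  near=> n.
  have -> : l - l' = (z n - l') - (z n - l) by ring.
  by apply: le_trans (cabs_le_add _ _) _; rewrite cabsN addrC.
exact: (cvg_unique _ (cvg_cst (cabs (l - l'))) hh).
Unshelve. all: by end_near. Qed.

Lemma l2cvg_pointwise un u x : (forall n, l2 (un n)) -> l2 u -> l2cvg un u ->
  ccvg (fun n => un n x) (u x).
Proof.
move=> lun lu [hu]; split; apply: cvg0_le hu => [n|]; first exact: cabs_ge0.
by near=> n; apply: (cabs_le_l2norm x); exact: l2B.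
Unshelve. all: by end_near. Qed.

Lemma l2cvg_unique un u w : (forall n, l2 (un n)) -> l2 u -> l2 w ->
  l2cvg un u -> l2cvg un w -> u = w.
Proof.
move=> lun lu lw hu hw; apply/funext => x.
by apply: (@ccvg_unique (fun n => un n x)); exact: l2cvg_pointwise.
Qed.

(** Fatou's lemma for the counting measure: every finite partial sum of squares passes to the
    limit. *)
Lemma l2norm_fatou (un : nat -> vec R V) u M : (forall n, l2 (un n)) ->
  (forall x, ccvg (fun n => un n x) (u x)) -> 0 <= M ->
  (\forall n \near \oo, l2norm (un n) <= M) -> l2 u /\ l2norm u <= M.
Proof.
move=> lun hx M0 hM; apply: l2_bound => // X.
have cv x : (fun n => cabs (un n x) ^+ 2) @ \oo --> cabs (u x) ^+ 2.
  have h1 : (fun n => cabs (un n x)) @ \oo --> cabs (u x).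
    apply/subr_cvg0; apply/cvgr0Pnorm_le => eps e0.
    move/cvgr0Pnorm_le : (ccvgE (hx x)) => /(_ _ e0); apply: filterS => n.
    rewrite ger0_norm ?cabs_ge0 // => h; rewrite ler_norml.
    have := cabs_le_add (un n x - u x) (u x); have := cabs_le_add (u x - un n x) (un n x).
    rewrite !subrK (cabsB (u x)); lra.
  by under eq_fun do rewrite expr2; rewrite expr2; exact: cvgM.
have : (fun n => \sum_(x <- X) cabs (un n x) ^+ 2) @ \oo -->
    \sum_(x <- X) cabs (u x) ^+ 2.
  apply: (@cvg_big _ _ +%R) => [|x _]; [exact: add_continuous|exact: cv].
move=> h; rewrite -(cvg_lim _ h) //; apply: limr_le; first exact: cvgP h.
near=> n; apply: (le_trans (l2norm_fset X (lun n))).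
rewrite ler_pXn2r ?nnegrE ?l2norm_ge0 //; by near: n.
Unshelve. all: by end_near. Qed.

Definition l2cauchy (un : nat -> vec R V) : Prop :=
  forall eps : R, 0 < eps -> exists N, forall m n, (N <= m)%N -> (N <= n)%N ->
    l2norm (un m \-v un n) <= eps.

(** Real and imaginary parts of the coordinates are Cauchy. [l2norm_fatou], applied to [un n - un m]
    as m grows, upgrades the coordinatewise limit to a limit in norm. *)
Lemma l2_complete un : (forall n, l2 (un n)) -> l2cauchy un ->
  exists u, l2 u /\ l2cvg un u.
Proof.
move=> lun hc.
have [u hu] : exists u : vec R V, forall x, ccvg (fun n => un n x) (u x).
  suff /choice[u hu] : forall x, exists z, ccvg (fun n => un n x) z by exists u.
  move=> x.
  have key (f : Cplx R -> R) : (forall z z', `|f z - f z'| <= cabs (z - z')) ->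
      exists r : R, (fun n => `|f (un n x) - r|) @ \oo --> (0 : R).
    move=> hf; suff [r hr] : exists r : R, (fun n => f (un n x)) @ \oo --> r.
      by exists r; apply/norm_cvg0P/subr_cvg0.
    apply/cvg_ex/cauchy_cvgP/cauchy_ballP => eps e0.
    have [N hN] := hc _ (divr_gt0 e0 (ltr0n _ 2)).
    exists ([set f (un n x) | n in [set n | (N <= n)%N]],
            [set f (un n x) | n in [set n | (N <= n)%N]]) => /=.
      by split; exists N => // n /= Nn; exists n.
    move=> [_ _] /= [[m hm <-] [n hn <-]]; rewrite /ball /=.
    apply: le_lt_trans (hf _ _) _.
    apply: le_lt_trans (cabs_le_l2norm x (l2B (lun m) (lun n))) _.
    by have := hN _ _ hm hn; lra.
  have [|a ha] := key (fun z => complex.Re (z : R[i])).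
    by move=> z z'; rewrite -raddfB normr_Re_le.
  have [|b hb] := key (fun z => complex.Im (z : R[i])).
    by move=> z z'; rewrite -raddfB normr_Im_le.
  exists (Complex a b).
  split; have := cvg0_add ha hb; apply: cvg0_le => [n|]; first exact: cabs_ge0.
  near=> n; apply: le_trans (cabs_le_ReIm _) _; by rewrite !raddfB.
have lu : l2 u.
  have [N hN] := hc _ ltr01.
  have [] // := @l2norm_fatou un u (l2norm (un N) + 1) lun hu.
    by rewrite addr_ge0 ?l2norm_ge0.
  exists N => // n /= Nn.
  have -> : un n = (fun x => un N x + (un n x - un N x)).
    by apply/funext => x; ring.
  apply: le_trans (l2normD (lun N) (l2B (lun n) (lun N))) _.
  by rewrite lerD2l hN.
exists u; split=> //; split; apply: cvg0_eps => [n|eps e0]; first exact: l2norm_ge0.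
have [N hN] := hc _ e0; exists N => // n /= Nn.
have [] // := @l2norm_fatou (fun m => un n \-v un m) (un n \-v u) eps.
- by move=> m; exact: l2B.
- move=> x; split; move: (ccvgE (hu x)); apply: cvg0_le => [m|]; first exact: cabs_ge0.
  near=> m; rewrite le_eqVlt; apply/orP; left; apply/eqP.
  by rewrite cabsB; congr cabs; ring.
- exact: ltW.
- by exists N => // m /= Nm; exact: hN.
Unshelve. all: by end_near. Qed.

Lemma l2cvg_norm un u : (forall n, l2 (un n)) -> l2 u -> l2cvg un u ->
  (fun n => l2norm (un n)) @ \oo --> l2norm u.
Proof.
move=> lun lu [h]; apply/subr_cvg0/norm_cvg0P; move: h.
apply: cvg0_le => [n|]; first exact: normr_ge0.
near=> n; rewrite ler_norml.
have h1 := l2normD (l2B (lun n) lu) lu.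
have h2 := l2normD (l2B lu (lun n)) (lun n).
have e1 : (fun x => un n x - u x + u x) = un n by apply/funext => x; rewrite subrK.
have e2 : (fun x => u x - un n x + un n x) = u by apply/funext => x; rewrite subrK.
move: h1 h2; rewrite e1 e2 (l2norm_subC lu (lun n)); lra.
Unshelve. all: by end_near. Qed.

Lemma l2cvg_inner un u wn w : (forall n, l2 (un n)) -> l2 u ->
  (forall n, l2 (wn n)) -> l2 w -> l2cvg un u -> l2cvg wn w ->
  ccvg (fun n => inner (un n) (wn n)) (inner u w).
Proof.
move=> lun lu lwn lw hu hw.
have h : (fun n => l2norm (un n \-v u) * l2norm (wn n) +
   l2norm u * l2norm (wn n \-v w)) @ \oo --> (0 : R).
  apply: cvg0_add; last exact: (cvg0_scale _ (l2cvgE hw)).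
  exact: (cvg0_mul (l2cvgE hu) (l2cvg_norm lwn lw hw)).
split; apply: cvg0_le h => [n|]; first exact: cabs_ge0.
near=> n.
have h1 := inner_linl 1 (l2B (lun n) lu) lu (lwn n).
have h2 := inner_linr 1 (l2B (lwn n) lw) lw lu.
have e1 : (fun x => 1 * (un n x - u x) + u x) = un n by apply/funext => x; ring.
have e2 : (fun x => 1 * (wn n x - w x) + w x) = wn n by apply/funext => x; ring.
move: h1 h2; rewrite e1 e2 => -> ->.
rewrite rmorph1 !mul1r addrA addrK.
apply: le_trans (cabs_le_add _ _) _; apply: lerD; apply: cauchy_schwarz => //; exact: l2B.
Unshelve. all: by end_near. Qed.

Lemma l2cvg_lin c un u wn w : (forall n, l2 (un n)) -> l2 u ->
  (forall n, l2 (wn n)) -> l2 w -> l2cvg un u -> l2cvg wn w ->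
  l2cvg (fun n x => c * un n x + wn n x) (fun x => c * u x + w x).
Proof.
move=> lun lu lwn lw [hu] [hw].
have : (fun n => cabs c * l2norm (un n \-v u) + l2norm (wn n \-v w)) @ \oo --> (0 : R).
  by apply: cvg0_add => //; exact: cvg0_scale.
move=> h; split; apply: cvg0_le h => [n|]; first exact: l2norm_ge0.
near=> n; apply: le_trans (proj2 (l2_lin c (l2B (lun n) lu) (l2B (lwn n) lw))).
by rewrite le_eqVlt; apply/orP; left; apply/eqP; congr l2norm; apply/funext => x; ring.
Unshelve. all: by end_near. Qed.

Lemma l2cvg_cst u : l2 u -> l2cvg (fun=> u) u.
Proof.
move=> lu; split; apply: cvg0_eps => [n|eps e0]; first exact: l2norm_ge0.
exists 0%N => // n _ /=; rewrite (_ : u \-v u = fun=> 0).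
  by apply: le_trans (proj2 (l2_0 R V)) (ltW e0).
by apply/funext => x; rewrite subrr.
Qed.

Lemma l2cvg_dist un wn u : (forall n, l2 (un n)) -> (forall n, l2 (wn n)) -> l2 u ->
  l2cvg un u -> (fun n => l2norm (wn n \-v un n)) @ \oo --> (0 : R) -> l2cvg wn u.
Proof.
move=> lun lwn lu [h] h'; split; have := cvg0_add h' h.
apply: cvg0_le => [n|]; first exact: l2norm_ge0.
by near=> n; exact: l2_dist_triangle.
Unshelve. all: by end_near. Qed.

Lemma l2_delta (x : V) : l2 (delta R x).
Proof.
have [] // := @l2_bound R V (delta R x) 1 => // X.
rewrite expr1n; have [xX|xX] := boolP (x \in X).
  rewrite (big_fsetD1 x) //= big1_fset /delta.
    by rewrite eqxx -(rmorph1 toC) cabs_toC normr1 expr1n addr0.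
  by move=> y; rewrite !inE => /andP[/negPf-> _] _; rewrite cabs0 expr0n.
rewrite big1_fset // /delta => y yX _.
case: eqP => [E|_]; first by rewrite -E yX in xX.
by rewrite cabs0 expr0n.
Qed.

Lemma inner_finr u w X : (forall x, x \notin X -> w x = 0) ->
  inner u w = \sum_(x <- X) u x * (w x)^*.
Proof.
move=> h; apply: usumE; apply: has_sum_fset => x xX.
by rewrite h // rmorph0 mulr0.
Qed.

Lemma inner_finl u w X : (forall x, x \notin X -> u x = 0) ->
  inner u w = \sum_(x <- X) u x * (w x)^*.
Proof.
move=> h; apply: usumE; apply: has_sum_fset => x xX.
by rewrite h // mul0r.
Qed.

Lemma delta_out (x y : V) : y \notin [fset x]%fset -> delta R x y = 0.
Proof. by rewrite inE /delta => /negPf ->. Qed.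

Lemma inner_delta u (x : V) : inner u (delta R x) = u x.
Proof.
rewrite (inner_finr u (@delta_out x)) big_seq_fset1.
by rewrite /delta eqxx rmorph1 mulr1.
Qed.

Lemma inner_deltal u (x : V) : inner (delta R x) u = (u x)^*.
Proof. by rewrite (inner_finl u (@delta_out x)) big_seq_fset1 /delta eqxx mul1r. Qed.

Lemma l2_fin u X : (forall x, x \notin X -> u x = 0) -> l2 u /\
  l2norm u ^+ 2 = \sum_(x <- X) cabs (u x) ^+ 2.
Proof.
move=> h; have lu : l2 u.
  have s0 : 0 <= \sum_(x <- X) cabs (u x) ^+ 2 by apply: sumr_ge0 => x _; exact: sqr_ge0.
  have [] // := @l2_bound R V u (Num.sqrt (\sum_(x <- X) cabs (u x) ^+ 2)).
  move=> A; rewrite sqr_sqrtr //.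
  rewrite (big_fsetID _ (mem X)) /= [X in _ + X]big1_fset ?addr0.
    apply: fset_sum_mono => [i|]; first exact: sqr_ge0.
    by apply/fsubsetP => i; rewrite !inE => /andP[].
  by move=> i; rewrite !inE => /andP[_ /h ->] _; rewrite cabs0 expr0n.
split=> //; apply: (@toC_inj R); rewrite -inner_self // (inner_finl u h) rmorph_sum.
by apply: eq_bigr => x _; rewrite /= cabs_sqr.
Qed.

Lemma eq_l2cvg un wn u : un =1 wn -> l2cvg un u -> l2cvg wn u.
Proof. by move=> /funext ->. Qed.

End StrongConvergence.

(** * Orthonormal families and the finite spectral theorem *)

Section OrthonormalFamily.
Context (R : realType) (V : choiceType) (N : nat).
Variables (phi : 'I_N -> vec R V) (h : 'I_N -> R).
Implicit Types (u w : vec R V) (c : 'I_N -> Cplx R) (F G : R -> R).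
Local Notation toC := (@toC R).

Definition orthonormal_family : Prop :=
  (forall i, l2 (phi i)) /\ forall i j, inner (phi i) (phi j) = (i == j)%:R.

Definition lincomb c : vec R V := fun x => \sum_i c i * phi i x.

(** [F] of the operator with eigenvectors [phi i] and eigenvalues [h i], set to 0 on the orthogonal
    complement of their span. *)
Definition diag_op F u : vec R V := lincomb (fun i => toC (F (h i)) * inner u (phi i)).

Hypothesis on : orthonormal_family.

Let lphi i : l2 (phi i). Proof. by case: on. Qed.

Lemma l2_sum (s : seq 'I_N) c : l2 (fun x => \sum_(i <- s) c i * phi i x).
Proof.
elim: s => [|i s IH].
  by under eq_fun do rewrite big_nil; exact: (proj1 (l2_0 R V)).
under eq_fun do rewrite big_cons; exact: (proj1 (l2_lin _ _ _)).
Qed.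

Lemma l2_lincomb c : l2 (lincomb c).
Proof. exact: l2_sum. Qed.

Lemma inner_lincomb c w : l2 w -> inner (lincomb c) w = \sum_i c i * inner (phi i) w.
Proof.
move=> lw; rewrite /lincomb; elim: (index_enum _) => [|i s IH].
  under [X in inner X]eq_fun do rewrite big_nil.
  by rewrite big_nil; apply: usumE; have := has_sum_fset (A := fset0)
    (f := fun x => 0 * (w x)^*) (fun x _ => mul0r _); rewrite big_seq_fset0.
under [X in inner X]eq_fun do rewrite big_cons.
by rewrite big_cons inner_linl ?IH //; exact: l2_sum.
Qed.

Lemma inner_lincomb_phi c j : inner (lincomb c) (phi j) = c j.
Proof.
rewrite inner_lincomb // (bigD1 j) //= big1 ?addr0.
  by rewrite (proj2 on) eqxx mulr1.
by move=> i /negPf ij; rewrite (proj2 on) ij mulr0.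
Qed.

Lemma lincomb_norm c : l2norm (lincomb c) ^+ 2 = \sum_i cabs (c i) ^+ 2.
Proof.
apply: (@toC_inj R); rewrite -inner_self; last exact: l2_lincomb.
rewrite inner_lincomb; last exact: l2_lincomb.
rewrite rmorph_sum; apply: eq_bigr => i _ /=.
by rewrite cabs_sqr (inner_conj (l2_lincomb c)) // inner_lincomb_phi.
Qed.

(** For the projection p of [u] onto the span, <u, p> = |p|^2, and Cauchy-Schwarz gives |p| <=
    |u|. *)
Lemma bessel u : l2 u -> \sum_i cabs (inner u (phi i)) ^+ 2 <= l2norm u ^+ 2.
Proof.
move=> lu; set c := fun i => inner u (phi i).
have e : inner u (lincomb c) = toC (\sum_i cabs (c i) ^+ 2).
  rewrite (inner_conj (l2_lincomb c)) // inner_lincomb // rmorph_sum rmorph_sum.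
  apply: eq_bigr => i _ /=; rewrite cabs_sqr rmorphM /= mulrC; congr (_ * _).
  by rewrite -(inner_conj (lphi i)).
have := cauchy_schwarz lu (l2_lincomb c); rewrite e cabs_toC.
have n2 := lincomb_norm c; rewrite -n2 ger0_norm ?sqr_ge0 //.
have [->|n0] := eqVneq (l2norm (lincomb c)) 0; first by rewrite expr0n /= sqr_ge0.
have np : 0 < l2norm (lincomb c) by rewrite lt_def n0 l2norm_ge0.
rewrite expr2 ler_pM2r // => hh.
by rewrite -expr2 ler_pXn2r // nnegrE l2norm_ge0.
Qed.

Lemma l2_diag_op F u : l2 (diag_op F u).
Proof. exact: l2_lincomb. Qed.

Lemma diag_op_norm F u M : 0 <= M -> l2 u -> (forall i, `|F (h i)| <= M) ->
  l2norm (diag_op F u) <= M * l2norm u.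
Proof.
move=> M0 lu FM; rewrite -(@ler_pXn2r _ 2) ?nnegrE ?mulr_ge0 ?l2norm_ge0 //.
rewrite lincomb_norm exprMn; apply: le_trans (ler_wpM2l (sqr_ge0 M) (bessel lu)).
rewrite mulr_sumr; apply: ler_sum => i _; rewrite cabsM exprMn cabs_toC.
rewrite ler_wpM2r ?sqr_ge0 // ler_pXn2r ?nnegrE ?normr_ge0 //.
Qed.

Lemma diag_op_comp F G u : l2 u ->
  diag_op F (diag_op G u) = diag_op (fun t => F t * G t) u.
Proof.
move=> lu; apply/funext => x; apply: eq_bigr => i _.
by rewrite inner_lincomb_phi rmorphM /= mulrA.
Qed.

Lemma diag_op_lin F (a : Cplx R) u w : l2 u -> l2 w ->
  diag_op F (fun x => a * u x + w x) = fun x => a * diag_op F u x + diag_op F w x.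
Proof.
move=> lu lw; apply/funext => x; rewrite /diag_op /lincomb mulr_sumr -big_split.
by apply: eq_bigr => i _; rewrite inner_linl //=; ring.
Qed.

Lemma eq_diag_op F G u : (forall i, F (h i) = G (h i)) -> diag_op F u = diag_op G u.
Proof. by move=> FG; apply/funext => x; apply: eq_bigr => i _; rewrite FG. Qed.

Lemma diag_op_linF F G (a : R) u :
  diag_op (fun t => a * F t + G t) u = fun x => toC a * diag_op F u x + diag_op G u x.
Proof.
apply/funext => x; rewrite /diag_op /lincomb mulr_sumr -big_split.
by apply: eq_bigr => i _; rewrite rmorphD rmorphM /=; ring.
Qed.

Lemma inner_diag_op F u w : l2 u -> l2 w -> inner (diag_op F u) w =
  \sum_i toC (F (h i)) * (inner u (phi i) * (inner w (phi i))^*).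
Proof.
move=> lu lw; rewrite inner_lincomb //; apply: eq_bigr => i _.
by rewrite mulrA -(inner_conj lw).
Qed.

Lemma inner_diag_op_self F u : l2 u -> inner (diag_op F u) u =
  toC (\sum_i F (h i) * cabs (inner u (phi i)) ^+ 2).
Proof.
move=> lu; rewrite inner_diag_op // rmorph_sum; apply: eq_bigr => i _.
by rewrite rmorphM /= cabs_sqr.
Qed.

Lemma diag_op_sym F u w : l2 u -> l2 w -> inner (diag_op F u) w = inner u (diag_op F w).
Proof.
move=> lu lw; rewrite [RHS](inner_conj (l2_diag_op F w)) // !inner_diag_op //.
rewrite rmorph_sum; apply: eq_bigr => i _.
by rewrite !rmorphM /= conj_toC conjCK; congr (_ * _); rewrite mulrC.
Qed.

Lemma diag_op_phi F i : diag_op F (phi i) = fun x => toC (F (h i)) * phi i x.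
Proof.
apply/funext => x; rewrite /diag_op /lincomb (bigD1 i) //= big1 ?addr0.
  by rewrite (proj2 on) eqxx mulr1.
by move=> j ji; rewrite (proj2 on) eq_sym (negPf ji) mulr0 mul0r.
Qed.

End OrthonormalFamily.

Lemma hermitian_diagonalization (R : realType) n (A : 'M[Cplx R]_n) :
  (forall i j, A j i = (A i j)^*) ->
  exists (P : 'M[Cplx R]_n) (d : 'I_n -> R),
  [/\ forall i j, \sum_k P i k * (P j k)^* = (i == j)%:R,
      forall j k, \sum_i (P i j)^* * P i k = (j == k)%:R
    & forall i j, \sum_k P i k * A k j = toC (d i) * P i j].
Proof.
move=> hA.
have herm : A \is hermsymmx.
  by apply/is_hermitianmxP; rewrite expr0 scale1r; apply/matrixP => i j; rewrite !mxE hA.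
have /orthomx_spectralP eA := hermitian_normalmx herm.
have real := hermitian_spectral_diag_real herm.
have unit := spectral_unitarymx A.
set P := spectralmx A in eA unit; set D := spectral_diag A in eA real.
exists P, (fun i => complex.Re (D 0 i : R[i])); split.
- move=> i j; have /unitarymxP/matrixP/(_ i j) := unit; rewrite !mxE => <-.
  by apply: eq_bigr => k _; rewrite !mxE.
- move=> j k; have /unitarymxP/mulmx1C/matrixP/(_ j k) := unit; rewrite !mxE => <-.
  by apply: eq_bigr => i _; rewrite !mxE.
- move=> i j.
  have : P *m A = diag_mx D *m P.
    by rewrite eA !mulmxA mulmxV ?mul1mx // unitarymx_unit.
  move=> /matrixP /(_ i j); rewrite mul_diag_mx !mxE => ->; congr (_ * _).
  by have /mxOverP/(_ 0 i) := real => h; rewrite -[LHS]RRe_real.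
Qed.

Section FiniteSpectralTheorem.
Context (R : realType) (V : choiceType).
Implicit Types (u w : vec R V) (E : set V) (T : op R V).
Local Notation toC := (@toC R).

Lemma l2on_lin E c u w : l2on E u -> l2on E w -> l2on E (fun x => c * u x + w x).
Proof.
move=> [lu hu] [lw hw]; split; first exact: (proj1 (l2_lin _ _ _)).
by move=> x Ex; rewrite hu ?hw ?mulr0 ?addr0.
Qed.

Lemma linear_on0 E T : linear_on E T -> T (fun=> 0) = fun=> 0.
Proof.
move=> [_ hT]; have l0 : l2on E ((fun=> 0) : vec R V) by split=> //; exact: (proj1 (l2_0 R V)).
have := hT 1 _ _ l0 l0.
have -> : (fun x : V => 1 * 0 + 0) = ((fun=> 0) : vec R V) by apply/funext => x; ring.
move=> h; apply/funext => x; move/(congr1 (fun f => f x)) : h => /=; set z := T _ x.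
by rewrite mul1r => h; apply: (addIr z); rewrite add0r -h.
Qed.

Lemma linear_on_sum E T (I : Type) (s : seq I) (c : I -> Cplx R) (v : I -> vec R V) :
  linear_on E T -> (forall i, l2on E (v i)) ->
  l2on E (fun x => \sum_(i <- s) c i * v i x) /\
  T (fun x => \sum_(i <- s) c i * v i x) = fun x => \sum_(i <- s) c i * T (v i) x.
Proof.
move=> linT hv; elim: s => [|i s [IH1 IH2]].
  split; first by under eq_fun do rewrite big_nil; split=> //; exact: (proj1 (l2_0 R V)).
  under [X in T X]eq_fun do rewrite big_nil.
  by rewrite (linear_on0 linT); under [RHS]eq_fun do rewrite big_nil.
split; first by under eq_fun do rewrite big_cons; exact: l2on_lin.
under [X in T X]eq_fun do rewrite big_cons.
by rewrite (proj2 linT) // IH2; under [RHS]eq_fun do rewrite big_cons.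
Qed.

Theorem finite_eigenbasis E T : finite_set E -> linear_on E T ->
  (forall u w, l2on E u -> l2on E w -> inner (T u) w = inner u (T w)) ->
  exists (phi : 'I_(vcard E) -> vec R V) (h : 'I_(vcard E) -> R),
  [/\ orthonormal_family phi,
      forall i, l2on E (phi i),
      forall i, T (phi i) = fun x => toC (h i) * phi i x
    & forall u, l2on E u -> u = lincomb phi (fun i => inner u (phi i))].
Proof.
move=> Efin linT symT; pose X := fset_set E.
pose e (i : 'I_(vcard E)) : V := tnth (in_tuple (enum_fset X)) i.
have eX i : e i \in X by exact: mem_tnth.
have eE i : E (e i) by move: (eX i); rewrite /X in_fset_set // => /set_mem.
have einj i j : (e i == e j) = (i == j).
  apply/eqP/eqP => [h|-> //]; apply/val_inj/eqP => /=.
  have := fset_uniq X; rewrite /e !(tnth_nth (e i)) /= in h.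
  by move=> uX; rewrite -(nth_uniq (e i) (ltn_ord i) (ltn_ord j) uX) h.
have sumX (F : V -> Cplx R) : \sum_(x <- X) F x = \sum_i F (e i).
  by rewrite big_tnth.
have ld x : E x -> l2on E (delta R x).
  move=> Ex; split; first exact: l2_delta.
  by move=> y Ey; apply: delta_out; rewrite inE; apply/eqP => yx; rewrite yx in Ey.
have lE u x : l2on E u -> x \notin X -> u x = 0.
  by move=> [_ hu]; rewrite in_fset_set // => /negP h; apply: hu => /mem_set.
have expand u : l2on E u -> u = fun x => \sum_i u (e i) * delta R (e i) x.
  move=> lu; apply/funext => x; rewrite -(sumX (fun y => u y * delta R y x)).
  have [xX|xX] := boolP (x \in X).
    rewrite (big_fsetD1 x) //= big1_fset ?addr0 /delta ?eqxx ?mulr1 //.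
    by move=> y; rewrite !inE => /andP[/negPf yx _] _; rewrite eq_sym yx mulr0.
  rewrite lE // big1_fset // => y yX _; rewrite /delta.
  by case: eqP => [xy|_]; rewrite ?mulr0 // xy yX in xX *.
have Texp u : l2on E u -> T u = fun x => \sum_i u (e i) * T (delta R (e i)) x.
  move=> lu; rewrite {1}(expand u lu).
  have [_ ->] // := @linear_on_sum E T _ (index_enum _) (fun i => u (e i))
    (fun i => delta R (e i)) linT (fun i => ld _ (eE i)).
(* Row convention: a vector is the row of its values and [T] acts by multiplication on the right, so
   P A = D P says that the rows of [P] are eigenvectors. *)
pose A := \matrix_(i, j < vcard E) T (delta R (e i)) (e j).
have hA i j : A j i = (A i j)^*.
  rewrite !mxE -[T (delta _ (e j)) _]inner_delta symT; try exact: ld.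
  by rewrite inner_deltal.
have [P [d [PP PP' PA]]] := hermitian_diagonalization hA.
pose phi i : vec R V := fun x => \sum_j P i j * delta R (e j) x.
have phie i j : phi i (e j) = P i j.
  rewrite /phi (bigD1 j) //= big1 ?addr0 /delta ?eqxx ?mulr1 // => k kj.
  by rewrite einj eq_sym (negPf kj) mulr0.
have lphi i : l2on E (phi i).
  have [] // := @linear_on_sum E T _ (index_enum _) (fun j => P i j)
    (fun j => delta R (e j)) linT (fun i => ld _ (eE i)).
have innE u i : inner u (phi i) = \sum_j u (e j) * (P i j)^*.
  rewrite (@inner_finr _ _ _ _ X); last by move=> x xX; exact: lE.
  by rewrite sumX; apply: eq_bigr => j _; rewrite phie.
exists phi, d; split=> //.
- split=> [i|i j]; first by case: (lphi i).
  by rewrite innE; under eq_bigr do rewrite phie; exact: PP.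
- move=> i; rewrite Texp //; apply/funext => x.
  have [Ex|Ex] := pselect (E x); last first.
    rewrite (proj2 (lphi i)) // mulr0 big1 // => j _.
    by rewrite (proj2 (proj1 linT _ (ld _ (eE j)))) ?mulr0.
  have [k ->] : exists k, x = e k.
    have : x \in X by rewrite in_fset_set // mem_set.
    by move=> /(seq_tnthP) [k ->]; exists k.
  rewrite phie -PA; apply: eq_bigr => j _; rewrite phie mxE //.
- move=> u lu; rewrite {1}(expand u lu); apply/funext => x; rewrite /lincomb.
  under [RHS]eq_bigr do rewrite innE /phi mulr_suml.
  rewrite exchange_big /=; apply: eq_bigr => j _.
  under eq_bigr do rewrite mulr_sumr.
  rewrite exchange_big /= (bigD1 j) //= [X in _ + X]big1 ?addr0.
    have h : \sum_i (P i j)^* * P i j = 1 by rewrite PP' eqxx.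
    rewrite -[X in X * _]mulr1 -h mulr_sumr mulr_suml.
    by apply: eq_bigr => i _; ring.
  move=> k kj; have := PP' j k; rewrite eq_sym (negPf kj) => h.
  transitivity (u (e j) * delta R (e k) x * (\sum_i (P i j)^* * P i k)).
    by rewrite mulr_sumr; apply: eq_bigr => i _; ring.
  by rewrite h mulr0.
Qed.

End FiniteSpectralTheorem.

(** * Functional calculus along converging eigenbases *)

Section Weierstrass.
Context (R : realType).
Implicit Types (f g : R -> R) (p : {poly R}) (x y c : R).

(* [bern n x f] is the expectation of [f] under the binomial law B(n, x),
   described by conditioning on one trial. *)
Fixpoint bern n x (f : nat -> R) : R :=
  if n is m.+1 then x * bern m x (fun k => f k.+1) + (1 - x) * bern m x f else f 0%N.

Lemma bern_poly n (f : nat -> R) : exists p, forall x, bern n x f = p.[x].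
Proof.
elim: n f => [|n IH] f; first by exists (f 0%N)%:P => x; rewrite hornerC.
have [p hp] := IH (fun k => f k.+1); have [q hq] := IH f.
exists ('X * p + (1 - 'X) * q) => x.
by rewrite /= hp hq !hornerE.
Qed.

Lemma bern_le n x f g : 0 <= x <= 1 -> (forall k : nat, (k <= n)%N -> f k%:R <= g k%:R) ->
  bern n x (fun k => f k%:R) <= bern n x (fun k => g k%:R).
Proof.
move=> /andP[x0 x1].
suff h (f' g' : nat -> R) : (forall k, (k <= n)%N -> f' k <= g' k) -> bern n x f' <= bern n x g'.
  exact: h.
elim: n f' g' => [|n IH] f' g' fg; first exact: fg.
rewrite /= lerD // ler_wpM2l ?subr_ge0 //; apply: IH => k kn; apply: fg => //.
exact: leqW.
Qed.

(** Mean and variance of the binomial law: E (k - c)^2 = (n x - c)^2 + n x (1 - x). *)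
Lemma bern_quad n x (a b c : R) :
  bern n x (fun k => a + b * (k%:R - c) ^+ 2) =
  a + b * ((n%:R * x - c) ^+ 2 + n%:R * (x * (1 - x))).
Proof.
elim: n a b c => [|n IH] a b c /=; first by rewrite !mul0r addr0.
have -> : bern n x (fun k => a + b * (k.+1%:R - c) ^+ 2) =
          bern n x (fun k => a + b * (k%:R - (c - 1)) ^+ 2).
  by congr bern; apply/funext => k; rewrite -natr1; ring.
rewrite !IH -natr1; ring.
Qed.

(** Bernstein's proof. By compactness one n0 satisfies |f x - f y| <= eps/2 + n0 (x - y)^2
    everywhere: near points by continuity, far points because |f| <= K. Taking the expectation at y
    = k/(N+1), the square becomes a variance of order 1/(N+1). *)
Lemma weierstrass_unit f : continuous f -> forall eps, 0 < eps ->
  exists p, forall x, 0 <= x <= 1 -> `|f x - p.[x]| <= eps.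
Proof.
move=> cf eps e0.
have [K hK] : exists K, forall y, 0 <= y <= 1 -> `|f y| <= K.
  have cnf : {within `[0, 1], continuous (fun y => `|f y|)}.
    apply: continuous_subspaceT => y; apply: continuous_comp; first exact: cf.
    exact: norm_continuous.
  have [c _ hc] := EVT_max ler01 cnf.
  by exists `|f c| => y hy; apply: hc; rewrite in_itv.
have [n0 hn0] : exists n0 : nat, forall x, 0 <= x <= 1 ->
   forall y, 0 <= y <= 1 -> `|f x - f y| <= eps / 2 + n0%:R * (x - y) ^+ 2.
  have := @segment_compact R 0 1; rewrite compact_near_coveringP.
  move=> /(_ _ \oo (fun n x => 0 <= x <= 1 -> forall y, 0 <= y <= 1 ->
    `|f x - f y| <= eps / 2 + n%:R * (x - y) ^+ 2)).
  case.
    move=> x xI.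
    have e4 : 0 < eps / 4 by rewrite divr_gt0.
    have /cvgrPdist_le /(_ _ e4) /nbhs_ballP [d /= d0 hd] := cf x.
    exists ([set x' | `|x - x'| < d / 2], [set n : nat | 2 * K <= n%:R * (d / 2) ^+ 2]).
      split => /=.
        by apply/nbhs_ballP; exists (d / 2) => //=; rewrite divr_gt0.
      have d2 : 0 < (d / 2) ^+ 2 by rewrite exprn_gt0 // divr_gt0.
      have := @nbhs_infty_ger R (2 * K / (d / 2) ^+ 2); apply: filterS => n.
      by rewrite ler_pdivrMr.
    move=> [x' n] /= [hx' hn] x'I y yI.
    have [hy|hy] := ltP `|x' - y| (d / 2).
      have h1 := hd x' (lt_le_trans hx' _); have h2 := hd y.
      have {}h1 : `|f x - f x'| <= eps / 4 by apply: h1; lra.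
      have {}h2 : `|f x - f y| <= eps / 4.
        apply: h2; rewrite /ball /=; have := ler_distD x' x y; lra.
      have := ler_distD (f x) (f x') (f y); rewrite (distrC (f x') (f x)).
      have : 0 <= n%:R * (x' - y) ^+ 2 by rewrite mulr_ge0 ?sqr_ge0.
      lra.
    apply: (@le_trans _ _ (2 * K)).
      have := ler_normB (f x') (f y); have := hK _ x'I; have := hK _ yI; lra.
    have h : (d / 2) ^+ 2 <= (x' - y) ^+ 2.
      rewrite -[leRHS]real_normK ?num_real // ler_pXn2r ?nnegrE ?normr_ge0 //.
      by rewrite ltW // divr_gt0.
    have : n%:R * (d / 2) ^+ 2 <= n%:R * (x' - y) ^+ 2 by rewrite ler_wpM2l.
    by move: hn; lra.
  move=> n0 _ /(_ n0 (leqnn _)) h; exists n0 => x xI; exact: h.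
have [N hN] : exists N : nat, 2 * n0%:R / eps <= N%:R.
  by exists (Num.truncn (2 * n0%:R / eps)).+1; apply/ltW/truncnS_gt.
have [p hp] := bern_poly N.+1 (fun k => f (k%:R / N.+1%:R)).
exists p => x xI; rewrite -hp.
have N0 : 0 < N.+1%:R :> R by rewrite ltr0n.
have quad (a b : R) : bern N.+1 x (fun k => a + b * (x - k%:R / N.+1%:R) ^+ 2) =
    a + b * (x * (1 - x) / N.+1%:R).
  have -> : (fun k : nat => a + b * (x - k%:R / N.+1%:R) ^+ 2) =
     (fun k : nat => a + b / N.+1%:R ^+ 2 * (k%:R - N.+1%:R * x) ^+ 2).
    have e (m r : R) : m != 0 -> b * (x - r / m) ^+ 2 = b / m ^+ 2 * (r - m * x) ^+ 2.
      by move=> m0; field.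
    by apply/funext => k; rewrite e // gt_eqF.
  have e (m : R) : m != 0 -> a + b / m ^+ 2 * ((m * x - m * x) ^+ 2 + m * (x * (1 - x)))
      = a + b * (x * (1 - x) / m) by move=> m0; field.
  by rewrite bern_quad e // gt_eqF.
have xx : x * (1 - x) / N.+1%:R * n0%:R <= eps / 2.
  have [x0 x1] := andP xI.
  have h1 : x * (1 - x) <= 1 by nra.
  apply: (@le_trans _ _ (n0%:R / N.+1%:R)).
    rewrite mulrC ler_wpM2l // ler_pdivrMr // mulVf ?gt_eqF //.
  rewrite ler_pdivrMr // mulrAC ler_pdivlMr // -natr1 mulrDr mulr1.
  have := hN; rewrite ler_pdivrMr //; nra.
have kI (k : nat) : (k <= N.+1)%N -> 0 <= (k%:R : R) / N.+1%:R <= 1.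
  by move=> kN; rewrite divr_ge0 //= ler_pdivrMr // mul1r ler_nat.
have hk (k : nat) : (k <= N.+1)%N ->
    `|f x - f (k%:R / N.+1%:R)| <= eps / 2 + n0%:R * (x - k%:R / N.+1%:R) ^+ 2.
  by move=> /kI; exact: hn0.
have U := @bern_le N.+1 x (fun r => f (r / N.+1%:R))
   (fun r => f x + eps / 2 + n0%:R * (x - r / N.+1%:R) ^+ 2) xI.
have L := @bern_le N.+1 x (fun r => f x - eps / 2 + - n0%:R * (x - r / N.+1%:R) ^+ 2)
   (fun r => f (r / N.+1%:R)) xI.
rewrite !quad in U L.
have q1 (a b c q : R) : `|a - b| <= c + q -> b <= a + c + q.
  by rewrite ler_norml => /andP[]; lra.
have q2 (a b c q : R) : `|a - b| <= c + q -> a - c - q <= b.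
  by rewrite ler_norml => /andP[]; lra.
have {}U := U (fun k kN => q1 _ _ _ _ (hk k kN)).
have {}L := L (fun k kN => eq_ind_r (fun t => _ + t <= _) (q2 _ _ _ _ (hk k kN)) (mulNr _ _)).
have e1 (a b c q : R) : c * q <= eps / 2 -> b <= a + eps / 2 + q * c ->
    a - eps / 2 + - q * c <= b -> `|a - b| <= eps.
  by rewrite ler_norml mulNr [q * c]mulrC => h h1 h2; apply/andP; split; lra.
exact: e1 xx U L.
Qed.

Lemma weierstrass (M : R) f : continuous f -> forall eps, 0 < eps ->
  exists p, forall x, 0 <= x <= M -> `|f x - p.[x]| <= eps.
Proof.
move=> cf eps e0.
have [M0|M0] := leP M 0.
  exists (f 0)%:P => x /andP[x0 xM]; rewrite hornerC.
  have -> : x = 0 by lra.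
  by rewrite subrr normr0 ltW.
have cg : continuous (fun x => f (M * x)).
  by move=> x; apply: continuous_comp; [exact: mulrl_continuous|exact: cf].
have [p hp] := weierstrass_unit cg e0.
exists (p \Po (M^-1 *: 'X)) => x /andP[x0 xM].
rewrite horner_comp !hornerE.
have -> : f x = f (M * (M^-1 * x)) by rewrite mulVKf ?gt_eqF.
by apply: hp; rewrite mulr_ge0 ?invr_ge0 ?(ltW M0) //= mulrC ler_pdivrMr ?mul1r.
Qed.

End Weierstrass.

(* Like [l2cvg], sealed against conversion. *)
Record rcont (R : realType) (F : R -> R) : Prop := Rcont { rcontE : continuous F }.

Lemma rcont_lin (R : realType) (a : R) (F G : R -> R) : rcont F -> rcont G ->
  rcont (fun t => a * F t + G t).
Proof.
move=> [cF] [cG]; split=> t.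
apply: (@cvgD _ _ _ _ _ (fun t => a * F t) G); last exact: cG.
by apply: cvgM; [exact: cvg_cst|exact: cF].
Qed.

Lemma rcont_mul (R : realType) (F G : R -> R) : rcont F -> rcont G ->
  rcont (fun t => F t * G t).
Proof. by move=> [cF] [cG]; split=> t; apply: cvgM; [exact: cF|exact: cG]. Qed.

Lemma rcont_cst (R : realType) (a : R) : rcont (fun=> a).
Proof. by split=> t; exact: cvg_cst. Qed.

Lemma rcont_id (R : realType) : rcont (@id R).
Proof. by split=> t; exact: cvg_id. Qed.

Section FunctionalCalculus.
Context (R : realType) (V : choiceType).
Variables (N : nat -> nat) (phi : forall n, 'I_(N n) -> vec R V).
Variables (h : forall n, 'I_(N n) -> R) (M : R) (K : op R V).
Arguments phi : clear implicits.
Arguments h : clear implicits.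
Implicit Types (u w : vec R V) (F G : R -> R).
Local Notation toC := (@toC R).
Local Notation D n F u := (diag_op (phi n) (h n) F u).

(* [K] is the strong limit of the operators diagonalized by [phi n], [h n]; its
   functional calculus is the strong limit of theirs. *)
Definition approximable : Prop :=
  [/\ 0 <= M,
      forall n, orthonormal_family (phi n),
      forall n i, 0 <= h n i <= M,
      forall u, l2 u -> l2cvg (fun n => D n (fun=> 1) u) u
    & forall u, l2 u -> l2 (K u) /\ l2cvg (fun n => D n id u) (K u)].

(** Closed by [Qed], so that conversion never unfolds the choice behind [fc]; only its defining
    equation is visible. *)
Lemma fc_spec : {f : (R -> R) -> vec R V -> vec R V | forall F u,
  f F u = xget (fun=> 0) [set g | l2 g /\ l2cvg (fun n => D n F u) g]}.
Proof. by eexists=> F u. Qed.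

Definition fc := sval fc_spec.

Let fcE F u : fc F u = xget (fun=> 0) [set g | l2 g /\ l2cvg (fun n => D n F u) g].
Proof. exact: (svalP fc_spec). Qed.

Hypothesis app : approximable.

Let M0 : 0 <= M. Proof. by case: app. Qed.
Let on n : orthonormal_family (phi n). Proof. by case: app. Qed.
Let hM n i : 0 <= h n i <= M. Proof. by case: app. Qed.

Definition bounded_by C F : Prop := 0 <= C /\ forall t, 0 <= t <= M -> `|F t| <= C.

Lemma continuous_bounded F : rcont F -> exists C, bounded_by C F.
Proof.
move=> [cF]; have cnf : {within `[0, M], continuous (fun y => `|F y|)}.
  apply: continuous_subspaceT => y; apply: continuous_comp; first exact: cF.
  exact: norm_continuous.
have [c _ hc] := EVT_max M0 cnf.
by exists `|F c|; split=> // t tM; apply: hc; rewrite in_itv.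
Qed.

Let D_norm n C F u : l2 u -> bounded_by C F -> l2norm (D n F u) <= C * l2norm u.
Proof. by move=> lu [C0 hC]; apply: diag_op_norm => // i; exact: hC. Qed.

Let lD n F u : l2 (D n F u). Proof. exact: l2_diag_op. Qed.

(** The finite operators are bounded by C uniformly in n, so replacing [u] by [un n] costs at most C
    |un n - u|. *)
Lemma diag_op_moving C F (un : nat -> vec R V) u g : bounded_by C F ->
  (forall n, l2 (un n)) -> l2 u -> l2 g -> l2cvg un u ->
  l2cvg (fun n => D n F u) g -> l2cvg (fun n => D n F (un n)) g.
Proof.
move=> bF lun lu lg hu hF.
apply: (l2cvg_dist (fun n => lD n F u) (fun n => lD n F (un n)) lg hF).
apply: cvg0_le (cvg0_scale C (l2cvgE hu)) => [n|]; first exact: l2norm_ge0.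
near=> n.
have -> : (fun x => D n F (un n) x - D n F u x) = D n F (fun x => -1 * u x + un n x).
  by rewrite diag_op_lin //; apply/funext => x; ring.
have -> : (fun x => un n x - u x) = (fun x => -1 * u x + un n x).
  by apply/funext => x; ring.
by apply: D_norm => //; exact: (proj1 (l2_lin _ _ _)).
Unshelve. all: by end_near. Qed.

(** The class of functions with strong limits. It contains 1 and [id], is closed under linear
    combinations and, by [diag_op_moving], under products; hence it contains the polynomials and, by
    [weierstrass] on [0, M], all continuous functions. *)
Let good F := (exists C, bounded_by C F) /\
  forall u, l2 u -> exists g, l2 g /\ l2cvg (fun n => D n F u) g.

Let good1 : good (fun=> 1).
Proof.
split; first by exists 1; split=> // t _; rewrite normr1.
by move=> u lu; exists u; split=> //; case: app => _ _ _ + _; exact.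
Qed.

Let good_id : good id.
Proof.
split; first by exists M; split=> // t /andP[t0 tM]; rewrite ger0_norm.
by move=> u lu; exists (K u); case: app => _ _ _ _; exact.
Qed.

Let good_lin (a : R) F G : good F -> good G -> good (fun t => a * F t + G t).
Proof.
move=> [[C [C0 hC]] gF] [[C' [C'0 hC']] gG]; split.
  exists (`|a| * C + C'); split; first by rewrite addr_ge0 ?mulr_ge0.
  move=> t tM; apply: le_trans (ler_normD _ _) _; rewrite normrM lerD ?hC' //.
  by rewrite ler_wpM2l ?hC.
move=> u lu; have [f [lf hf]] := gF _ lu; have [g [lg hg]] := gG _ lu.
exists (fun x => toC a * f x + g x); split; first exact: (proj1 (l2_lin _ _ _)).
apply: eq_l2cvg (l2cvg_lin (toC a) (fun n => lD n F u) lf (fun n => lD n G u) lg hf hg).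
by move=> n; rewrite diag_op_linF.
Qed.

Let good_mul F G : good F -> good G -> good (fun t => F t * G t).
Proof.
move=> [[C [C0 hC]] gF] [[C' [C'0 hC']] gG]; split.
  exists (C * C'); split; first by rewrite mulr_ge0.
  by move=> t tM; rewrite normrM ler_pM ?hC ?hC'.
move=> u lu; have [g [lg hg]] := gG _ lu; have [f [lf hf]] := gF _ lg.
exists f; split=> //.
apply: eq_l2cvg (@diag_op_moving C F (fun n => D n G u) g f (conj C0 hC)
  (fun n => lD _ _ _) lg lf hg hf).
by move=> n; rewrite diag_op_comp.
Qed.

Let good_poly (p : {poly R}) : good (fun t => p.[t]).
Proof.
elim/poly_ind: p => [|p c IH].
  have := good_lin (-1) good1 good1; congr good; apply/funext => t.
  by rewrite horner0; ring.
have := good_lin c good1 (good_mul IH good_id); congr good; apply/funext => t.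
by rewrite !hornerE addrC.
Qed.

Let good_rcont F : rcont F -> good F.
Proof.
move=> cF; split; first exact: continuous_bounded.
move=> u lu; apply: l2_complete => // eps e0.
have u1 : 0 < l2norm u + 1 by rewrite ltr_wpDl // l2norm_ge0.
have e1 : 0 < eps / 4 / (l2norm u + 1) by rewrite !divr_gt0.
have [p hp] := weierstrass M (rcontE cF) e1.
have [_ /(_ u lu) [g [lg hg]]] := good_poly p.
have e4 : 0 < eps / 4 by rewrite divr_gt0.
move/cvgr0Pnorm_le : (l2cvgE hg) => /(_ _ e4) [N0 _ hN].
exists N0.
have key n : (N0 <= n)%N -> l2norm (fun x => D n F u x - g x) <= eps / 2.
  move=> Nn; have := hN n Nn; rewrite /= ger0_norm ?l2norm_ge0 // => h1.
  apply: le_trans (l2_dist_triangle (lD n F u) lg (lD n (fun t => p.[t]) u)) _.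
  have -> : (fun x => D n F u x - D n (fun t => p.[t]) u x) =
     D n (fun t => -1 * p.[t] + F t) u.
    by rewrite diag_op_linF; apply/funext => x; rewrite rmorphN1; ring.
  have b : bounded_by (eps / 4 / (l2norm u + 1)) (fun t => -1 * p.[t] + F t).
    by split; [exact: ltW|move=> t tM; rewrite mulN1r addrC hp].
  have := D_norm n lu b => h2.
  have : eps / 4 / (l2norm u + 1) * l2norm u <= eps / 4.
    by rewrite mulrAC ler_pdivrMr // ler_wpM2l ?(ltW e4) // lerDl.
  lra.
move=> m n Nm Nn; apply: le_trans (l2_dist_triangle (lD m F u) (lD n F u) lg) _.
rewrite (l2norm_subC lg); last exact: lD.
by have := key _ Nm; have := key _ Nn; lra.
Qed.

Lemma fcP F u : rcont F -> l2 u ->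
  l2 (fc F u) /\ l2cvg (fun n => D n F u) (fc F u).
Proof.
rewrite fcE => /good_rcont [_ /(_ u) h1] /h1 h2.
exact: (@xgetPex _ _ [set g | l2 g /\ l2cvg (fun n => D n F u) g] h2).
Qed.

Lemma l2_fc F u : rcont F -> l2 u -> l2 (fc F u).
Proof. by move=> cF lu; case: (fcP cF lu). Qed.

Lemma fc_unique F u g : rcont F -> l2 u -> l2 g ->
  l2cvg (fun n => D n F u) g -> fc F u = g.
Proof.
move=> cF lu lg hg; have [l1 l2'] := fcP cF lu.
exact: (l2cvg_unique (fun n => lD n F u) l1 lg l2' hg).
Qed.

Lemma fc_cvg F (un : nat -> vec R V) u : rcont F -> (forall n, l2 (un n)) ->
  l2 u -> l2cvg un u -> l2cvg (fun n => D n F (un n)) (fc F u).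
Proof.
move=> cF lun lu hu; have [C bC] := continuous_bounded cF.
have [l1 h1] := fcP cF lu; exact: (diag_op_moving bC lun lu l1 hu h1).
Qed.

Lemma fc_norm C F u : rcont F -> l2 u -> bounded_by C F ->
  l2norm (fc F u) <= C * l2norm u.
Proof.
move=> cF lu bF; have [l1 h1] := fcP cF lu.
have h2 := l2cvg_norm (fun n => lD n F u) l1 h1.
rewrite -(cvg_lim _ h2) //; apply: limr_le; first exact: cvgP h2.
by near=> n; exact: D_norm.
Unshelve. all: by end_near. Qed.

Lemma fc_lin F (a : Cplx R) u w : rcont F -> l2 u -> l2 w ->
  fc F (fun x => a * u x + w x) = fun x => a * fc F u x + fc F w x.
Proof.
move=> cF lu lw; have [lf hf] := fcP cF lu; have [lg hg] := fcP cF lw.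
apply: fc_unique => //; try exact: (proj1 (l2_lin _ _ _)).
apply: eq_l2cvg (l2cvg_lin a (fun n => lD n F u) lf (fun n => lD n F w) lg hf hg).
by move=> n; rewrite diag_op_lin.
Qed.

Lemma fc_linF (a : R) F G u : rcont F -> rcont G -> l2 u ->
  fc (fun t => a * F t + G t) u = fun x => toC a * fc F u x + fc G u x.
Proof.
move=> cF cG lu; have [lf hf] := fcP cF lu; have [lg hg] := fcP cG lu.
apply: fc_unique => //; first exact: rcont_lin.
  exact: (proj1 (l2_lin _ _ _)).
apply: eq_l2cvg (l2cvg_lin (toC a) (fun n => lD n F u) lf (fun n => lD n G u) lg hf hg).
by move=> n; rewrite diag_op_linF.
Qed.

Lemma fc_mul F G u : rcont F -> rcont G -> l2 u ->
  fc F (fc G u) = fc (fun t => F t * G t) u.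
Proof.
move=> cF cG lu; have [lg hg] := fcP cG lu.
apply/esym/fc_unique => //; first exact: rcont_mul.
  exact: l2_fc.
apply: eq_l2cvg (fc_cvg cF (fun n => lD n G u) lg hg).
by move=> n; rewrite diag_op_comp.
Qed.

Lemma fc_id u : l2 u -> fc id u = K u.
Proof.
move=> lu; have [_ _ _ _ /(_ _ lu) [l1 h1]] := app.
by apply: fc_unique => //; exact: rcont_id.
Qed.

Lemma fc_1 u : l2 u -> fc (fun=> 1) u = u.
Proof.
move=> lu; have [_ _ _ /(_ _ lu) h1 _] := app.
by apply: fc_unique => //; exact: rcont_cst.
Qed.

Lemma fc_ext F G u : (forall t, 0 <= t <= M -> F t = G t) -> fc F u = fc G u.
Proof.
move=> FG; rewrite !fcE; congr (xget _ _); apply/funext => g.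
suff e : (fun n => D n F u) = (fun n => D n G u) by rewrite e.
by apply/funext => n; apply: eq_diag_op => i; exact: FG.
Qed.

Lemma fc_sym F u w : rcont F -> l2 u -> l2 w ->
  inner (fc F u) w = inner u (fc F w).
Proof.
move=> cF lu lw; have [lf hf] := fcP cF lu; have [lg hg] := fcP cF lw.
apply: (@ccvg_unique _ (fun n => inner (D n F u) w)).
  exact: (l2cvg_inner (fun n => lD n F u) lf (fun=> lw) lw hf (l2cvg_cst lw)).
rewrite (_ : (fun n => _) = fun n => inner u (D n F w)).
  exact: (l2cvg_inner (fun=> lu) lu (fun n => lD n F w) lg (l2cvg_cst lu) hg).
by apply/funext => n; rewrite diag_op_sym.
Qed.

(** The integral of [F] against the spectral measure of [K] at [u]. *)
Definition ell F u : R := complex.Re (inner (fc F u) u : R[i]).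

(** Weak convergence of spectral measures, along vectors that move with n. *)
Lemma ell_cvg F (un : nat -> vec R V) u : rcont F -> (forall n, l2 (un n)) ->
  l2 u -> l2cvg un u ->
  (fun n => \sum_i F (h n i) * cabs (inner (un n) (phi n i)) ^+ 2) @ \oo --> ell F u.
Proof.
move=> cF lun lu hu; have hD := fc_cvg cF lun lu hu.
have := l2cvg_inner (fun n => lD n F (un n)) (l2_fc cF lu) lun lu hD hu.
move=> [hc]; apply/subr_cvg0/norm_cvg0P.
apply: cvg0_le hc => [n|]; first exact: normr_ge0.
near=> n; rewrite inner_diag_op_self //.
apply: le_trans (normr_Re_le _); rewrite raddfB //.
Unshelve. all: by end_near. Qed.

Lemma inner_fc F u : rcont F -> l2 u -> inner (fc F u) u = toC (ell F u).
Proof.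
move=> cF lu; have e := fc_sym cF lu lu.
have : (inner (fc F u) u)^* = inner (fc F u) u.
  by rewrite -(inner_conj (l2_fc cF lu)) // -e.
by move=> /CrealP h1; rewrite /ell; exact/esym/RRe_real.
Qed.

Lemma ell_le F G u : rcont F -> rcont G -> l2 u ->
  (forall t, 0 <= t <= M -> F t <= G t) -> ell F u <= ell G u.
Proof.
move=> cF cG lu FG.
have hF := ell_cvg cF (fun=> lu) lu (l2cvg_cst lu).
have hG := ell_cvg cG (fun=> lu) lu (l2cvg_cst lu).
apply: (ler_cvg_to hF hG); near=> n.
by apply: ler_sum => i _; rewrite ler_wpM2r ?sqr_ge0 // FG.
Unshelve. all: by end_near. Qed.

Lemma ell_lin (a : R) F G u : rcont F -> rcont G -> l2 u ->
  ell (fun t => a * F t + G t) u = a * ell F u + ell G u.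
Proof.
move=> cF cG lu; apply: (@toC_inj R).
rewrite -inner_fc //; last exact: rcont_lin.
rewrite fc_linF // inner_linl ?inner_fc //; try exact: l2_fc.
by rewrite rmorphD rmorphM.
Qed.

Lemma ell_scale (a : R) F u : rcont F -> l2 u -> ell (fun t => a * F t) u = a * ell F u.
Proof.
move=> cF lu; have z : ell (fun=> 0) u = 0.
  have := ell_lin (-1) cF cF lu; rewrite (_ : (fun t : R => _) = fun=> 0).
    by move=> ->; ring.
  by apply/funext => t; ring.
have := ell_lin a cF (rcont_cst 0) lu; rewrite z addr0 => <-.
by congr (ell _ u); apply/funext => t; rewrite addr0.
Qed.

Lemma ell_ge0 F u : rcont F -> l2 u ->
  (forall t, 0 <= t <= M -> 0 <= F t) -> 0 <= ell F u.
Proof.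
move=> cF lu F0; have c0 := rcont_cst (0 : R).
have := ell_le c0 cF lu F0; apply: le_trans.
have := ell_lin (-1) c0 c0 lu.
rewrite (_ : (fun t : R => _) = fun=> 0) ?mulN1r; first by lra.
by apply/funext => t; ring.
Qed.

Lemma inner_fc_fc F G u : rcont F -> rcont G -> l2 u ->
  inner (fc F u) (fc G u) = toC (ell (fun t => F t * G t) u).
Proof.
move=> cF cG lu; rewrite -fc_sym //; last exact: l2_fc.
rewrite fc_mul // inner_fc //; last exact: rcont_mul.
by under [X in ell X _]eq_fun do rewrite mulrC.
Qed.

Lemma fc_norm_sq F u : rcont F -> l2 u ->
  l2norm (fc F u) ^+ 2 = ell (fun t => F t ^+ 2) u.
Proof.
move=> cF lu; apply: (@toC_inj R); rewrite -inner_self; last exact: l2_fc.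
by rewrite inner_fc_fc.
Qed.

End FunctionalCalculus.

(** * The exponential series of an operator *)

Section Exponential.
Context (R : realType).
Local Notation toC := (@toC R).
Local Notation A n := [fset k in iota 0 n]%fset.

Let sumA (t : R) n : \sum_(k <- A n) t ^+ k / k`!%:R = series (exp_coeff t) n.
Proof.
rewrite /series /= /index_iota subn0; apply: perm_big; apply: uniq_perm.
- exact: fset_uniq.
- exact: iota_uniq.
- by move=> k; rewrite !inE.
Qed.

Let series_le (t : R) n : 0 <= t -> series (exp_coeff t) n <= expR t.
Proof.
move=> t0; apply: nondecreasing_cvgn_le; last exact: is_cvg_series_exp_coeff.
apply/nondecreasing_seqP => m.
by rewrite /series /= big_nat_recr //= lerDl exp_coeff_ge0.
Qed.

(** An unordered sum needs one finite set valid for all t in [0, M]: the tail of the series at t is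
    dominated termwise by the tail at M. *)
Lemma exp_fset_bound (M eps : R) : 0 <= M -> 0 < eps ->
  exists X : {fset nat}, forall B, (X `<=` B)%fset -> forall t, 0 <= t <= M ->
    `|\sum_(k <- B) t ^+ k / k`!%:R - expR t| <= eps.
Proof.
move=> M0 e0.
have cM : series (exp_coeff M) @ \oo --> expR M by exact: is_cvg_series_exp_coeff.
have [N _ hN] := (cvgrPdist_le _ _).1 cM _ e0.
exists (A N) => B NB t /andP[t0 tM].
have pos k : 0 <= t ^+ k / k`!%:R by rewrite divr_ge0 ?exprn_ge0.
have hB : \sum_(k <- B) t ^+ k / k`!%:R <= expR t.
  have [m hm] : exists m, (B `<=` A m)%fset.
    exists (\max_(k <- B) k).+1; apply/fsubsetP => k kB.
    rewrite !inE /= mem_iota /= ltnS.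
    have -> : (k <= \max_(i <- B) i)%N.
      exact: (@leq_bigmax_seq _ (enum_fset B) xpredT id k kB).
    by case: (k).
  by apply: le_trans (fset_sum_mono pos hm) _; rewrite sumA series_le.
have hA := fset_sum_mono pos NB; rewrite sumA in hA.
have hN' := hN N (leqnn _); rewrite /= ger0_norm ?subr_ge0 ?series_le // in hN'.
suff h : expR t <= series (exp_coeff t) N + eps.
  by rewrite ler_norml; apply/andP; split; lra.
have ct : series (exp_coeff t) @ \oo --> expR t by exact: is_cvg_series_exp_coeff.
rewrite -(cvg_lim _ ct) //; apply: limr_le; first exact: cvgP ct.
exists N => // m /= Nm.
rewrite -lerBlDl; apply: le_trans hN'.
apply: (@le_trans _ _ (series (exp_coeff M) m - series (exp_coeff M) N)); last first.
  by rewrite lerD2r series_le.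
rewrite !sub_series_geq //; apply: ler_sum => k _; rewrite /exp_coeff /=.
by rewrite ler_wpM2r ?invr_ge0 // lerXn2r ?nnegrE.
Qed.

Lemma exp_has_sum (t : R) : 0 <= t ->
  has_sum (fun k : nat => toC (t ^+ k / k`!%:R)) (toC (expR t)).
Proof.
move=> t0 eps e0.
have [X hX] := exp_fset_bound t0 (divr_gt0 e0 (ltr0n _ 2)).
exists X => B XB; rewrite -rmorph_sum -rmorphB cabs_toC.
by have := hX B XB t; rewrite t0 lexx => /(_ isT); lra.
Qed.

End Exponential.

Section OperatorExponential.
Context (R : realType) (V : choiceType).
Variables (N : nat -> nat) (phi : forall n, 'I_(N n) -> vec R V).
Variables (h : forall n, 'I_(N n) -> R) (M : R) (K : op R V).
Hypothesis app : approximable phi h M K.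
Implicit Types (u : vec R V).
Local Notation toC := (@toC R).
Local Notation fc := (fc phi h).

Lemma rcont_expR : rcont (@expR R).
Proof. by split; exact: continuous_expR. Qed.

Lemma rcont_exp (k : nat) : rcont (fun t : R => t ^+ k).
Proof.
elim: k => [|k IH].
  by have := @rcont_cst R 1; congr rcont; apply/funext => t; rewrite expr0.
have := rcont_mul (@rcont_id R) IH; congr rcont; apply/funext => t.
by rewrite exprS.
Qed.

Lemma fc_iter k u : l2 u -> iter k K u = fc (fun t => t ^+ k) u.
Proof.
move=> lu; elim: k => [|k IH] /=.
  by under [X in fc X]eq_fun do rewrite expr0; rewrite (fc_1 app).
rewrite IH -(fc_id app); last by apply: (l2_fc app) => //; exact: rcont_exp.
rewrite (fc_mul app (@rcont_id R) (@rcont_exp k) lu); congr (fc _ u).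
by apply/funext => t; rewrite exprS.
Qed.

Lemma fc_sum (I : Type) (s : seq I) (c : I -> R) (F : I -> R -> R) u :
  (forall i, rcont (F i)) -> l2 u ->
  rcont (fun t => \sum_(i <- s) c i * F i t) /\
  fc (fun t => \sum_(i <- s) c i * F i t) u = fun x => \sum_(i <- s) toC (c i) * fc (F i) u x.
Proof.
move=> cF lu; elim: s => [|i s [IH1 IH2]].
  have e0 : (fun t : R => \sum_(i <- [::]) c i * F i t) = (fun t => -1 * 1 + 1).
    by apply/funext => t; rewrite big_nil mulN1r addrC subrr.
  split; first by rewrite e0; apply: rcont_lin; exact: rcont_cst.
  rewrite e0 (fc_linF app) ?(fc_1 app) //; try exact: rcont_cst.
  by apply/funext => x; rewrite big_nil rmorphN1; ring.
have e0 : (fun t : R => \sum_(j <- i :: s) c j * F j t) =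
   (fun t => c i * F i t + \sum_(j <- s) c j * F j t).
  by apply/funext => t; rewrite big_cons.
rewrite e0; split; first exact: rcont_lin.
by rewrite (fc_linF app) // IH2; apply/funext => x; rewrite big_cons.
Qed.

(** [fc_norm] turns uniform approximation of the exponential on [0, M] by partial sums into
    approximation in norm, hence at every coordinate. *)
Lemma opexp_fc u : l2 u -> opexp K u = fc (@expR R) u.
Proof.
move=> lu; apply/funext => x; apply: usumE => eps e0.
have u1 : 0 < l2norm u + 1 by rewrite ltr_wpDl // l2norm_ge0.
have M0 : 0 <= M by case: app.
have [X hX] := exp_fset_bound M0 (divr_gt0 (divr_gt0 e0 (ltr0n _ 2)) u1).
exists X => B XB.
have [cS eS] := fc_sum B (fun k => (k`!%:R)^-1) rcont_exp lu.
have -> : \sum_(k <- B) iter k K u x / k`!%:R - fc (@expR R) u x =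
   fc (fun t => -1 * expR t + \sum_(k <- B) (k`!%:R)^-1 * t ^+ k) u x.
  rewrite (fc_linF app) // ?eS; last exact: rcont_expR.
  rewrite rmorphN1 mulN1r addrC; congr (_ + _); apply: eq_bigr => k _.
  by rewrite fc_iter // mulrC fmorphV rmorph_nat.
have cE := rcont_lin (-1) rcont_expR cS.
apply: le_lt_trans (cabs_le_l2norm x (l2_fc app cE lu)) _.
have := @fc_norm _ _ _ _ _ _ _ app (eps / 2 / (l2norm u + 1)) _ u cE lu.
have hb : bounded_by M (eps / 2 / (l2norm u + 1))
   (fun t => -1 * expR t + \sum_(k <- B) (k`!%:R)^-1 * t ^+ k).
  split; first by rewrite !divr_ge0 ?(ltW e0) ?(ltW u1).
  move=> t /(hX B XB); rewrite mulN1r [in X in _ -> X]addrC.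
  by under [in X in _ -> X]eq_bigr do rewrite mulrC.
move=> /(_ hb) h1; apply: le_lt_trans h1 _.
rewrite mulrAC ltr_pdivrMr // -subr_gt0.
have := l2norm_ge0 u; move: e0; set n := l2norm u; nra.
Qed.

End OperatorExponential.

(** * The quadratic form of (e^K - 1)^-1 *)

Section BoseFunctions.
Context (R : realType).
Implicit Types (s t : R).

Definition pos t : R := (t + `|t|) / 2.

Lemma pos_ge0 t : 0 <= pos t.
Proof. by rewrite /pos divr_ge0 //; have := ler_norm (- t); rewrite normrN; lra. Qed.

Lemma posE t : 0 <= t -> pos t = t.
Proof. by move=> t0; rewrite /pos ger0_norm //; lra. Qed.

Lemma rcont_pos : rcont pos.
Proof.
split=> t; apply: cvgM; last exact: cvg_cst.
by apply: (@cvgD _ _ _ _ _ id (fun t => `|t|)); [exact: cvg_id|exact: norm_continuous].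
Qed.

Lemma rcont_comp (F G : R -> R) : rcont F -> rcont G -> rcont (fun t => F (G t)).
Proof. by move=> [cF] [cG]; split=> t; apply: continuous_comp; [exact: cG|exact: cF]. Qed.

Lemma rcont_inv (F : R -> R) : (forall t, F t != 0) -> rcont F -> rcont (fun t => (F t)^-1).
Proof. by move=> F0 [cF]; split=> t; apply: cvgV; [exact: F0|exact: cF]. Qed.

Lemma rcont_shift s : rcont (fun t => t + s).
Proof.
have := rcont_lin 1 (@rcont_id R) (rcont_cst s); congr rcont; apply/funext => t.
by rewrite mul1r.
Qed.

(* 1 / (e^h - 1) and 1 / h, regularized by a shift [s] and cut off for [h < 0]
   to be continuous on the whole line. *)
Definition bosef s t : R := (expR (pos t + s) - 1)^-1.
Definition resf s t : R := (pos t + s)^-1.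

Lemma expm1_ge t : t <= expR t - 1.
Proof. by have := expR_ge1Dx t; lra. Qed.

Lemma rcont_resf s : 0 < s -> rcont (resf s).
Proof.
move=> s0; apply: rcont_inv => [t|].
  by rewrite gt_eqF // ltr_wpDl // pos_ge0.
exact: (rcont_comp (rcont_shift s) rcont_pos).
Qed.

Lemma rcont_expm1 : rcont (fun t : R => expR t - 1).
Proof. exact: (rcont_comp (rcont_shift (-1)) (@rcont_expR R)). Qed.

Lemma rcont_bosef s : 0 < s -> rcont (bosef s).
Proof.
move=> s0; apply: rcont_inv => [t|].
  have h1 := expm1_ge (pos t + s); have h2 := pos_ge0 t.
  by rewrite gt_eqF //; lra.
exact: (rcont_comp rcont_expm1 (rcont_comp (rcont_shift s) rcont_pos)).
Qed.

Lemma expR_diff s t : s <= t -> expR t - expR s <= (t - s) * expR t.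
Proof.
move=> st; have := expR_ge1Dx (s - t); have := expR_gt0 t.
have -> : expR s = expR t * expR (s - t) by rewrite -expRD; congr expR; lra.
by nra.
Qed.

Lemma expR_diff_ge s t : 0 <= s -> s <= t -> t - s <= expR t - expR s.
Proof.
move=> s0 st; have := expR_ge1Dx (t - s).
have -> : expR t = expR s * expR (t - s) by rewrite -expRD; congr expR; lra.
have : 1 <= expR s by have := expR_ge1Dx s; lra.
by nra.
Qed.

Section Pointwise.
Variables (M s t : R).
Hypotheses (s0 : 0 < s) (s1 : s <= 1) (t0 : 0 <= t) (tM : t <= M).
Let C := expR (M + 1).

Let den s' : 0 < s' -> 0 < expR (t + s') - 1.
Proof. by move=> s0'; have := expm1_ge (t + s'); have := t0; lra. Qed.

Lemma bosefE s' : bosef s' t = (expR (t + s') - 1)^-1.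
Proof. by rewrite /bosef posE. Qed.

Lemma resfE s' : resf s' t = (t + s')^-1.
Proof. by rewrite /resf posE. Qed.

Lemma bosef_gt0 : 0 < bosef s t.
Proof. by rewrite bosefE invr_gt0 den. Qed.

Lemma bosef_le_resf : bosef s t <= resf s t.
Proof.
rewrite bosefE resfE lef_pV2 ?posrE ?den ?expm1_ge //.
by have := s0; have := t0; lra.
Qed.

Lemma bosef_anti s' : s <= s' -> bosef s' t <= bosef s t.
Proof.
move=> ss'; rewrite !bosefE lef_pV2 ?posrE ?den ?(lt_le_trans s0) //.
by rewrite lerD2r ler_expR lerD2l.
Qed.

(** The numerator e^(t+s) - e^t is at most s e^(t+s) <= s C because t + s <= M + 1, and the
    denominators satisfy e^t - 1 >= t. *)
Lemma bosef_sub_le : 0 < t -> (expR t - 1)^-1 - bosef s t <= C * (t^-1 - resf s t).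
Proof.
move=> tp; rewrite bosefE resfE.
have d1 := den s0; have d2 : 0 < expR t - 1 by have := expm1_ge t; lra.
have -> : (expR t - 1)^-1 - (expR (t + s) - 1)^-1 =
   (expR (t + s) - expR t) * ((expR t - 1)^-1 * (expR (t + s) - 1)^-1).
  by field; rewrite !gt_eqF.
have -> : t^-1 - (t + s)^-1 = s * (t^-1 * (t + s)^-1).
  by field; rewrite !gt_eqF // addr_gt0.
rewrite mulrA; apply: ler_pM.
- by rewrite subr_ge0 ler_expR lerDl ltW.
- by rewrite mulr_ge0 // invr_ge0 ltW.
- have h : expR (t + s) <= C by rewrite ler_expR lerD.
  apply: le_trans (expR_diff _) _; first by rewrite lerDl ltW.
  by rewrite addrC addKr mulrC ler_wpM2r // ltW.
- apply: ler_pM; rewrite ?invr_ge0 ?(ltW d1) ?(ltW d2) //.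
    by rewrite lef_pV2 ?posrE // expm1_ge.
  by rewrite lef_pV2 ?posrE ?expm1_ge // addr_gt0.
Qed.

(** How far [bosef s] is from inverting e^t - 1. The bound vanishes with s after integration, since
    the integrals of [bosef s] stay bounded. *)
Lemma bosef_defect : 0 <= 1 - (expR t - 1) * bosef s t <= C * s * bosef s t.
Proof.
rewrite bosefE; have d1 := den s0.
have -> : 1 - (expR t - 1) * (expR (t + s) - 1)^-1 =
  (expR (t + s) - expR t) * (expR (t + s) - 1)^-1 by field; rewrite gt_eqF.
rewrite mulr_ge0 ?invr_ge0 ?(ltW d1) ?subr_ge0 ?ler_expR ?lerDl ?(ltW s0) //=.
rewrite ler_wpM2r ?invr_ge0 ?(ltW d1) //.
have h : expR (t + s) <= C by rewrite ler_expR lerD.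
apply: le_trans (expR_diff _) _; first by rewrite lerDl ltW.
by rewrite addrC addKr mulrC ler_wpM2r // ltW.
Qed.

Lemma bosef_bound : (expR t - 1) * bosef s t <= 1.
Proof. by have := bosef_defect; lra. Qed.

(** The exponentials at shifts s and s/2 differ by at least s/2. The square is thus controlled by an
    increment in the shift, whose integral tends to 0 when the integrals of [bosef s] have a finite
    supremum. *)
Lemma bosef_half : s * bosef s t ^+ 2 <= 2 * (bosef (s / 2) t - bosef s t).
Proof.
have s2 : 0 < s / 2 by rewrite divr_gt0.
have ss : s / 2 <= s by have := s0; lra.
have d1 := den s0; have d2 := den s2.
have b1 := bosef_gt0.
have -> : bosef (s / 2) t - bosef s t =
  (expR (t + s) - expR (t + s / 2)) * (bosef (s / 2) t * bosef s t).
  by rewrite !bosefE; field; rewrite !gt_eqF.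
have h1 : bosef s t <= bosef (s / 2) t.
  by rewrite !bosefE lef_pV2 ?posrE // lerD2r ler_expR lerD2l.
have h2 : s / 2 <= expR (t + s) - expR (t + s / 2).
  apply: le_trans (expR_diff_ge _ _); have := t0; lra.
have h3 : bosef s t * bosef s t <= bosef (s / 2) t * bosef s t.
  by rewrite ler_wpM2r // ltW.
have : s / 2 * (bosef s t * bosef s t) <=
  (expR (t + s) - expR (t + s / 2)) * (bosef (s / 2) t * bosef s t).
  by apply: (ler_pM (ltW s2) _ h2 h3); rewrite mulr_ge0 // ltW.
by rewrite expr2; lra.
Qed.

End Pointwise.
End BoseFunctions.

Section PositiveOperators.
Context (R : realType) (V : choiceType) (B : op R V).
Implicit Types (u w : vec R V).
Local Notation toC := (@toC R).
Hypothesis posB : positive_op B.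

Let lT u : l2 u -> l2on setT u. Proof. by move=> lu; split=> // x []. Qed.

Lemma positive_op_l2 u : l2 u -> l2 (B u).
Proof. by move=> lu; case: posB => -[/(_ u (lT lu)) [] ]. Qed.

Lemma positive_op_lin (c : Cplx R) u w : l2 u -> l2 w ->
  B (fun x => c * u x + w x) = fun x => c * B u x + B w x.
Proof. by move=> lu lw; case: posB => -[_ h] _ _; exact: h (lT lu) (lT lw). Qed.

(** Polarization: positivity makes the form real on [c u + w], and c = 1 and c = i determine the
    rest. *)
Lemma positive_op_sym u w : l2 u -> l2 w -> inner (B u) w = inner u (B w).
Proof.
move=> lu lw; have lBu := positive_op_l2 lu; have lBw := positive_op_l2 lw.
have real v : l2 v -> (inner (B v) v)^* = inner (B v) v.
  by move=> lv; case: posB => _ _ /(_ _ lv) /ger0_real /CrealP.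
rewrite [RHS](inner_conj lBw) //.
set a := inner (B u) w; set b := inner (B w) u.
have key (c : Cplx R) : (c * a + c^* * b)^* = c * a + c^* * b.
  have lv := proj1 (l2_lin c lu lw).
  have := real _ lv; rewrite positive_op_lin // inner_linl // !inner_linr //.
  rewrite -/a -/b.
  have ru := real _ lu; have rw := real _ lw.
  move: ru rw; set p := inner (B u) u; set q := inner (B w) w => ru rw.
  rewrite !(rmorphD, rmorphM) /= !conjCK ru rw => h.
  apply: (addIr (c * c^* * p + q)); apply: etrans (etrans h _); ring.
have h1 := key 1; have h2 := key 'i.
rewrite rmorph1 !mul1r rmorphD /= in h1.
rewrite conjCi rmorphD !rmorphM rmorphN /= conjCi in h2.
have h3 : a - b = - a^* + b^*.
  apply: (mulfI (neq0Ci (Cplx R))); rewrite mulrBr -mulNr -h2; ring.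
have h4 : a + a = b^* + b^*.
  have -> : a + a = (a + b) + (a - b) by ring.
  by rewrite -h1 h3; ring.
apply: (@mulfI _ (2 : Cplx R)); first by rewrite pnatr_eq0.
by rewrite !mulr_natl !mulr2n.
Qed.

Lemma positive_op_cvg (un : nat -> vec R V) u : (forall n, l2 (un n)) -> l2 u ->
  l2cvg un u -> l2cvg (fun n => B (un n)) (B u).
Proof.
move=> lun lu [hu]; have [_ [C hC] _] := posB.
split; have := cvg0_scale C hu; apply: cvg0_le => [n|]; first exact: l2norm_ge0.
near=> n.
have <- : B (fun x => -1 * u x + un n x) = (fun x => B (un n) x - B u x).
  by rewrite positive_op_lin //; apply/funext => x; ring.
have <- : (fun x => -1 * u x + un n x) = (fun x => un n x - u x).
  by apply/funext => x; ring.
by apply: hC; exact: (proj1 (l2_lin _ _ _)).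
Unshelve. all: by end_near. Qed.

End PositiveOperators.

(** Arithmetic for the norm in [bose_vector]: Phi is the supremum, a and b are the integrals of
    [bosef] at shifts s and s/2, and d is the squared norm of the approximate preimage. *)
Lemma squeeze_defect (R : realType) (C eps Phi a b d : R) : 0 < C -> 0 < eps ->
  Phi - eps / (1 + 2 * C) <= a -> b <= Phi -> a <= Phi -> d <= a ->
  a - d <= 2 * C * (b - a) -> `|Phi - d| <= eps.
Proof.
move=> C0 e0 h1 h2 h3 h4 h5; have K0 : 0 < 1 + 2 * C by lra.
have h7 : (1 + 2 * C) * (Phi - a) <= eps by rewrite mulrC -ler_pdivlMr //; lra.
have h8 : 2 * C * (b - a) <= 2 * C * (Phi - a) by rewrite ler_wpM2l; lra.
rewrite ler_norml; apply/andP; split; lra.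
Qed.

Lemma squeeze_gap (R : realType) (eps Phi a b : R) :
  `|Phi - a| <= eps / 4 + eps / 4 -> a <= b -> b - a <= eps / 4 * 2 -> `|Phi - b| <= eps.
Proof. by rewrite !ler_norml => /andP[? ?] ? ?; apply/andP; split; lra. Qed.

Lemma defect_half (R : realType) (E z c f f' : R) :
  (1 - (E - 1) * f) * f <= c * z * f * f -> c * (z * (f * f)) <= c * (2 * (f' - f)) ->
  -1 * ((E - 1) * (f * f)) + f <= 2 * c * (-1 * f + f').
Proof. by move=> h1 h2; lra. Qed.

Section BoseVector.
Context (R : realType) (V : choiceType).
Variables (N : nat -> nat) (phi : forall n, 'I_(N n) -> vec R V).
Variables (h : forall n, 'I_(N n) -> R) (M : R) (K : op R V).
Hypothesis app : approximable phi h M K.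
Implicit Types (u : vec R V).
Local Notation toC := (@toC R).
Local Notation fc := (fc phi h).
Local Notation ell := (ell phi h).
Arguments phi : clear implicits.
Arguments h : clear implicits.

Let M0 : 0 <= M. Proof. by case: app. Qed.

(** Exhibits one positive square root of e^K - 1, which guarantees that the choice made by [opsqrt]
    satisfies its specification. *)
Definition sqrt_bose : op R V := fc (fun t => Num.sqrt (expR (pos t) - 1)).

Lemma rcont_sqrt_bose : rcont (fun t : R => Num.sqrt (expR (pos t) - 1)).
Proof.
have := rcont_comp (@rcont_expm1 R) (@rcont_pos R) => -[c].
split=> t; exact: (continuous_comp (c t) (@sqrt_continuous R _)).
Qed.

Lemma exp_sub1_fc u : l2 u ->
  (fun x => opexp K u x - u x) = fc (fun t => expR t - 1) u.
Proof.
move=> lu; rewrite (opexp_fc app) //.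
have := fc_linF app (-1) (@rcont_cst R 1) (@rcont_expR R) lu.
rewrite (fc_1 app) // => e.
rewrite (_ : (fun t : R => expR t - 1) = (fun t => -1 * 1 + expR t)).
  by rewrite e; apply/funext => x; rewrite rmorphN1; ring.
by apply/funext => t; ring.
Qed.

Lemma sqrt_bose_positive : positive_op sqrt_bose.
Proof.
have cS := rcont_sqrt_bose; split.
- split=> [u [lu _]|c u w [lu _] [lw _]]; last exact: (fc_lin app).
  by split; [exact: (l2_fc app)|move=> x []].
- have [C hC] := continuous_bounded app cS.
  by exists C => u lu; exact: (fc_norm app cS lu hC).
- move=> u lu; rewrite (inner_fc app) // -(rmorph0 toC) ler_toC.
  by apply: (ell_ge0 app) => // t _; exact: sqrtr_ge0.
Qed.

Lemma sqrt_bose_sq u : l2 u -> sqrt_bose (sqrt_bose u) = fun x => opexp K u x - u x.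
Proof.
move=> lu; rewrite exp_sub1_fc // /sqrt_bose.
rewrite (fc_mul app rcont_sqrt_bose rcont_sqrt_bose lu); apply: (fc_ext app).
move=> t /andP[t0 _]; rewrite posE // -expr2 sqr_sqrtr //.
by have := expm1_ge t; lra.
Qed.

Variables (u : vec R V) (G : R).
Hypothesis lu : l2 u.
Hypothesis resolvent_le : forall s, 0 < s -> ell (resf s) u <= G.
Hypothesis resolvent_ge : forall eps, 0 < eps -> exists s, 0 < s <= 1 /\
  G - eps <= ell (resf s) u.

Lemma ell_bosef_le s : 0 < s -> ell (bosef s) u <= G.
Proof.
move=> s0; apply: le_trans (resolvent_le s0); apply: (ell_le app) => //.
- exact: rcont_bosef.
- exact: rcont_resf.
- by move=> t /andP[t0 _]; exact: bosef_le_resf.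
Qed.

Lemma ell_bosef_anti s s' : 0 < s -> s <= s' -> ell (bosef s') u <= ell (bosef s) u.
Proof.
move=> s0 ss'; apply: (ell_le app) => //.
- by apply: rcont_bosef; exact: lt_le_trans ss'.
- exact: rcont_bosef.
- by move=> t /andP[t0 _]; exact: bosef_anti.
Qed.

(** The form of (e^K - 1)^-1 at [u], by monotone convergence as the shift decreases to 0; it is
    finite because [bosef s] is at most [resf s], whose integrals are bounded by G. *)
Definition bose_value : R := sup [set ell (bosef s) u | s in [set s | 0 < s]].

Lemma bose_value_ub s : 0 < s -> ell (bosef s) u <= bose_value.
Proof.
move=> s0; apply: ub_le_sup; last by exists s.
by exists G => _ [s' /= s'0 <-]; exact: ell_bosef_le.
Qed.

Lemma bose_value_ge0 : 0 <= bose_value.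
Proof.
apply: le_trans (bose_value_ub ltr01); apply: (ell_ge0 app) => //.
  exact: rcont_bosef.
by move=> t /andP[t0 _]; rewrite ltW // bosef_gt0.
Qed.

Lemma bose_value_approx eps : 0 < eps -> exists s0, 0 < s0 /\
  forall s, 0 < s <= s0 -> bose_value - eps <= ell (bosef s) u.
Proof.
move=> e0.
have hs : has_sup [set ell (bosef s) u | s in [set s | 0 < s]].
  split; first by exists (ell (bosef 1) u), 1 => //=.
  by exists G => _ [s' /= s'0 <-]; exact: ell_bosef_le.
have [_ [s0 /= s00 <-] h1] := sup_adherent e0 hs.
exists s0; split=> [//|s /andP[sp ss0]].
exact: le_trans (ltW h1) (ell_bosef_anti sp ss0).
Qed.

Lemma bose_quadratic_form (un : nat -> vec R V) :
  (forall n, l2 (un n)) -> l2cvg un u -> (forall n i, 0 < h n i) ->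
  (fun n => \sum_i (h n i)^-1 * cabs (inner (un n) (phi n i)) ^+ 2) @ \oo --> G ->
  (fun n => \sum_i (expR (h n i) - 1)^-1 * cabs (inner (un n) (phi n i)) ^+ 2) @ \oo
    --> bose_value.
Proof.
move=> lun hun hpos hG; apply/cvgrPdist_le => eps e0.
pose C := expR (M + 1).
have C0 : 0 < C by exact: expR_gt0.
have e5 : 0 < eps / 4 by rewrite divr_gt0.
have eC : 0 < eps / 4 / C by rewrite divr_gt0.
have [s0 [s00 hs0]] := bose_value_approx e5.
have [s1 [/andP[s10 s11] hs1]] := resolvent_ge eC.
pose s := Num.min s0 s1.
have sp : 0 < s by rewrite lt_min s00.
have sle0 : s <= s0 by rewrite ge_min lexx.
have sle1 : s <= s1 by rewrite ge_min lexx orbT.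
have sl1 : s <= 1 by exact: le_trans s11.
have b1 : bose_value - eps / 4 <= ell (bosef s) u by apply: hs0; rewrite sp.
have b2 : G - eps / 4 / C <= ell (resf s) u.
  apply: le_trans hs1 _; apply: (ell_le app) => //; try exact: rcont_resf.
  move=> t /andP[t0 _]; rewrite !resfE // lef_pV2 ?posrE ?ltr_wpDl //.
  by rewrite lerD2l.
have b3 := bose_value_ub sp.
have cf := ell_cvg app (rcont_bosef sp) lun lu hun.
have cr := ell_cvg app (rcont_resf sp) lun lu hun.
have hM n i : 0 <= h n i <= M by case: app.
pose w n i := cabs (inner (un n) (phi n i)) ^+ 2.
have lo n : \sum_i bosef s (h n i) * w n i <= \sum_i (expR (h n i) - 1)^-1 * w n i.
  apply: ler_sum => i _; rewrite ler_wpM2r ?sqr_ge0 //.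
  have /andP[t0 _] := hM n i; rewrite bosefE // lef_pV2 ?posrE.
  - by rewrite lerD2r ler_expR lerDl ltW.
  - by have := expm1_ge (h n i + s); lra.
  - by have := expm1_ge (h n i); have := hpos n i; lra.
have hi n : \sum_i (expR (h n i) - 1)^-1 * w n i - \sum_i bosef s (h n i) * w n i <=
    C * (\sum_i (h n i)^-1 * w n i - \sum_i resf s (h n i) * w n i).
  rewrite -!sumrB mulr_sumr; apply: ler_sum => i _; rewrite -!(mulrBl (w n i)) [leRHS]mulrA.
  rewrite ler_wpM2r ?sqr_ge0 //; have /andP[t0 tM] := hM n i.
  exact: bosef_sub_le.
near=> n.
have n1 : `|bose_value - \sum_i bosef s (h n i) * w n i| <= eps / 4 + eps / 4.
  have : `|ell (bosef s) u - \sum_i bosef s (h n i) * w n i| <= eps / 4.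
    by near: n; exact: (cvgrPdist_le _ _).1 cf _ e5.
  by rewrite !ler_norml => /andP[? ?]; apply/andP; split; lra.
have n2 : `|G - \sum_i (h n i)^-1 * w n i| <= eps / 4 / C / 2.
  by near: n; apply: (cvgrPdist_le _ _).1 hG _ _; rewrite divr_gt0.
have n3 : `|ell (resf s) u - \sum_i resf s (h n i) * w n i| <= eps / 4 / C / 2.
  by near: n; apply: (cvgrPdist_le _ _).1 cr _ _; rewrite divr_gt0.
have n4 : \sum_i (h n i)^-1 * w n i - \sum_i resf s (h n i) * w n i <=
   (eps / 4 / C) * 2.
  by move: n2 n3; rewrite !ler_norml => /andP[? ?] /andP[? ?]; lra.
have n5 : C * ((eps / 4 / C) * 2) = eps / 4 * 2 by field; rewrite gt_eqF.
have n6 := ler_wpM2l (ltW C0) n4; rewrite n5 in n6.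
exact: (squeeze_gap n1 (lo n) (le_trans (hi n) n6)).
Unshelve. all: by end_near. Qed.

Variable B : op R V.
Hypothesis posB : positive_op B.
Hypothesis sqB : forall w, l2 w -> B (B w) = fun x => opexp K w x - w x.

(** By symmetry |B F u|^2 = <B^2 F u, F u>, so only B^2 enters and any positive square root gives
    the same value. *)
Lemma norm_sqrt_fc F : rcont F ->
  l2norm (B (fc F u)) ^+ 2 = ell (fun t => (expR t - 1) * F t ^+ 2) u.
Proof.
move=> cF; have lF := l2_fc app cF lu; have lB := positive_op_l2 posB lF.
apply: (@toC_inj R); rewrite -inner_self // -(positive_op_sym posB lB lF) sqB //.
rewrite exp_sub1_fc // (fc_mul app (@rcont_expm1 R) cF lu).
rewrite (inner_fc_fc app (rcont_mul (@rcont_expm1 R) cF) cF lu).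
by congr (toC (ell _ u)); apply/funext => t; rewrite mulrA.
Qed.

(* The vector is the limit of [B] applied to [1 / (e^(K + r) - 1) u] as [r -> 0]. *)
Theorem bose_vector : exists psi, [/\ l2 psi, B psi = u & l2norm psi ^+ 2 = bose_value].
Proof.
pose C := expR (M + 1).
have C0 : 0 < C by exact: expR_gt0.
pose s n : R := n.+1%:R^-1.
have s0 n : 0 < s n by rewrite invr_gt0.
have s1 n : s n <= 1 by rewrite invf_le1 ?ler1n.
have sle m n : (m <= n)%N -> s n <= s m by move=> mn; rewrite lef_pV2 ?posrE // ler_nat.
have cs n := rcont_bosef (s0 n).
pose psi n := B (fc (bosef (s n)) u).
have lf n : l2 (fc (bosef (s n)) u) by exact: (l2_fc app).
have lpsi n : l2 (psi n) by exact: (positive_op_l2 posB).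
(* The difference d of the two regularizations satisfies d >= 0 and (e^t - 1) d <= 1, so (e^t - 1)
   d^2 <= d, and the integral of d is an increment of a sequence bounded by [bose_value]. *)
have dist m n : (m <= n)%N ->
    l2norm (fun x => psi n x - psi m x) ^+ 2 <= bose_value - ell (bosef (s m)) u.
  move=> mn.
  have -> : (fun x => psi n x - psi m x) =
      B (fc (fun t => -1 * bosef (s m) t + bosef (s n) t) u).
    rewrite (fc_linF app) // (positive_op_lin posB) //; apply/funext => x.
    by rewrite rmorphN1 /psi; ring.
  have cd := rcont_lin (-1) (cs m) (cs n).
  rewrite norm_sqrt_fc //.
  apply: (@le_trans _ _ (ell (fun t => -1 * bosef (s m) t + bosef (s n) t) u)).
    apply: (ell_le app) => //.
      by apply: (rcont_mul (@rcont_expm1 R)); exact: (rcont_mul cd cd).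
    move=> t /andP[t0 tM]; have a1 := bosef_anti (s0 n) t0 (sle _ _ mn).
    have b1 := bosef_gt0 (s0 n) t0; have b2 := bosef_gt0 (s0 m) t0.
    have b3 := bosef_bound (s0 n) (s1 n) t0 tM.
    have e1 : 0 <= expR t - 1 by have := expm1_ge t; lra.
    have h1 : (expR t - 1) * (-1 * bosef (s m) t + bosef (s n) t) <= 1.
      by apply: le_trans b3; rewrite ler_wpM2l //; lra.
    rewrite expr2 mulrA -[leRHS]mul1r ler_wpM2r //; lra.
  rewrite (ell_lin app) // mulN1r addrC lerD2r; exact: bose_value_ub.
have tail eps : 0 < eps -> exists n0, forall n, (n0 <= n)%N ->
    bose_value - eps <= ell (bosef (s n)) u.
  move=> e0; have [s' [s'0 hs']] := bose_value_approx e0.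
  exists (Num.truncn s'^-1) => n hn; apply: hs'; rewrite s0 /=.
  rewrite -[s']invrK lef_pV2 ?posrE ?invr_gt0 //.
  by apply: ltW; apply: lt_le_trans (truncnS_gt _) _; rewrite ler_nat ltnS.
have [] := l2_complete lpsi.
  move=> eps e0; have e2 : 0 < eps ^+ 2 by rewrite exprn_gt0.
  have [n0 hn0] := tail _ e2; exists n0.
  have key m n : (n0 <= m)%N -> (m <= n)%N ->
      l2norm (fun x => psi n x - psi m x) <= eps.
    move=> nm mn; rewrite -(@ler_pXn2r _ 2) ?nnegrE ?l2norm_ge0 ?(ltW e0) //.
    by apply: le_trans (dist _ _ mn) _; have := hn0 _ nm; lra.
  move=> m n nm nn; have [mn|/ltnW mn] := leqP m n; last exact: key.
  by rewrite (l2norm_subC (lpsi m)) //; exact: key.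
move=> g [lg hg]; exists g.
have Cs n t : 0 <= t <= M -> 0 <= 1 - (expR t - 1) * bosef (s n) t <= C * s n * bosef (s n) t.
  by move=> /andP[t0 tM]; exact: bosef_defect.
split=> //.
- have hB := positive_op_cvg posB lpsi lg hg.
  apply: (l2cvg_unique (fun n => positive_op_l2 posB (lpsi n)) _ lu hB) => //.
    exact: (positive_op_l2 posB).
  split; apply: cvg0_eps => [n|eps e0]; first exact: l2norm_ge0.
  have V0 : 0 < bose_value + 1 by rewrite ltr_wpDl // bose_value_ge0.
  have hs : \forall n \near \oo, C * (bose_value + 1) / eps ^+ 2 <= n%:R.
    exact: nbhs_infty_ger.
  move: hs; apply: filterS => n hn.
  have e2 : 0 < eps ^+ 2 by rewrite exprn_gt0.
  rewrite -(@ler_pXn2r _ 2) ?nnegrE ?l2norm_ge0 ?(ltW e0) //.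
  have cd := rcont_mul (@rcont_expm1 R) (cs n).
  have -> : (fun x => B (psi n) x - u x) =
     fc (fun t => -1 * 1 + (expR t - 1) * bosef (s n) t) u.
    rewrite (fc_linF app (-1) (@rcont_cst R 1) cd lu) (fc_1 app) // /psi sqB //.
    have e := exp_sub1_fc (lf n).
    rewrite (fc_mul app (@rcont_expm1 R) (cs n) lu) in e.
    by rewrite -e; apply/funext => x; rewrite rmorphN1; ring.
  have cd1 := rcont_lin (-1) (@rcont_cst R 1) cd.
  rewrite (fc_norm_sq app) //.
  (* The defect lies in [0, 1], so its square is at most the defect itself. *)
  apply: (@le_trans _ _ (ell (fun t => (C * s n) * bosef (s n) t) u)).
    apply: (ell_le app) => //.
    - exact: (rcont_mul cd1 cd1).
    - exact: (rcont_mul (rcont_cst _) (cs n)).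
    move=> t tM; have /andP[d1 d2] := Cs n t tM.
    have e1 : 0 <= (expR t - 1) * bosef (s n) t.
      have /andP[t0 _] := tM.
      by rewrite mulr_ge0 ?(ltW (bosef_gt0 _ _)) //; have := expm1_ge t; lra.
    by move: d1 d2 e1; set x := (expR t - 1) * _; set y := C * _ * _; nra.
  rewrite (ell_scale app) //.
  have b1 := bose_value_ub (s0 n).
  apply: (@le_trans _ _ (C * s n * (bose_value + 1))).
    by rewrite ler_wpM2l ?mulr_ge0 ?(ltW C0) ?(ltW (s0 n)) //; lra.
  rewrite mulrAC ler_pdivrMr // -ler_pdivrMl // mulrC.
  by apply: le_trans hn _; rewrite ler_nat.
- have hn := l2cvg_norm lpsi lg hg.
  have h2 : (fun n => l2norm (psi n) ^+ 2) @ \oo --> l2norm g ^+ 2.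
    by rewrite expr2; under eq_fun do rewrite expr2; exact: cvgM.
  suff h3 : (fun n => l2norm (psi n) ^+ 2) @ \oo --> bose_value.
    exact: (cvg_unique _ h2 h3).
  (* The squared norm falls short of the integral of [bosef] by at most 2 C times the increment
     between the shifts s_n and s_n / 2. That increment and the distance to the supremum are each at
     most eps / (1 + 2 C). *)
  have K0 : 0 < 1 + 2 * C by rewrite addr_gt0 // mulr_gt0.
  apply/cvgrPdist_le => eps e0.
  have e1 : 0 < eps / (1 + 2 * C) by rewrite divr_gt0.
  have [n0 hn0] := tail _ e1; exists n0 => // n /= nn; have t1 := hn0 _ nn.
  rewrite /psi norm_sqrt_fc //.
  have cff := rcont_mul (cs n) (cs n).
  have cef := rcont_mul (@rcont_expm1 R) cff.
  have s2 : 0 < s n / 2 by rewrite divr_gt0.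
  have up : ell (fun t => (expR t - 1) * bosef (s n) t ^+ 2) u <= ell (bosef (s n)) u.
    apply: (ell_le app) => // t /andP[t0 tM].
    have := bosef_bound (s0 n) (s1 n) t0 tM; have b := bosef_gt0 (s0 n) t0.
    by move=> hh; rewrite expr2 mulrA -[leRHS]mul1r ler_wpM2r // ltW.
  have lo : ell (bosef (s n)) u - ell (fun t => (expR t - 1) * bosef (s n) t ^+ 2) u <=
      2 * C * (ell (bosef (s n / 2)) u - ell (bosef (s n)) u).
    have e2 := ell_lin app (-1) cef (cs n) lu.
    have e3 := ell_lin app (-1) (cs n) (rcont_bosef s2) lu.
    have c3 := rcont_lin (-1) (cs n) (rcont_bosef s2).
    rewrite -[X in _ * (_ - X)]mul1r -mulNr [X in _ * X]addrC -e3.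
    rewrite -(ell_scale app) //.
    apply: (@le_trans _ _ (ell (fun t => -1 * ((expR t - 1) *
         (bosef (s n) t * bosef (s n) t)) + bosef (s n) t) u)).
      by rewrite e2 mulN1r addrC.
    apply: (ell_le app) => //.
    - exact: (rcont_lin (-1) cef (cs n)).
    - exact: (rcont_mul (rcont_cst _) c3).
    move=> t tM; have /andP[d1 d2] := Cs n t tM.
    have /andP[t0 tM'] := tM; have hf := bosef_half (s0 n) t0.
    have b := bosef_gt0 (s0 n) t0.
    have h5 := ler_wpM2r (ltW b) d2; have h6 := ler_wpM2l (ltW C0) hf.
    by rewrite expr2 in h6; exact: defect_half h5 h6.
  have b1 := bose_value_ub s2; have b2 := bose_value_ub (s0 n).
  exact: (squeeze_defect C0 e0 t1 b1 b2 up lo).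
Qed.

End BoseVector.

(** * Levels and parents in a tree *)

Lemma leastP (P : set nat) : (exists k, P k) ->
  P (least P) /\ forall j, P j -> (least P <= j)%N.
Proof.
move=> exP; have ex' : exists k, `[< P k >] by have [k Pk] := exP; exists k; exact/asboolP.
apply: (@xgetPex _ 0%N [set k | P k /\ forall j, P j -> (k <= j)%N]).
case: (ex_minnP ex') => m /asboolP Pm min; exists m; split=> // j Pj.
exact/min/asboolP.
Qed.

Section GraphDistance.
Context (V : choiceType) (e : rel V).
Implicit Types (x y z : V) (E : set V).
Hypothesis conn : connected_in e setT.

Lemma gdist_path x y : exists p, [/\ path e x p, last x p = y & size p = gdist e x y].
Proof.
have [|[p ?] _] := @leastP [set k | exists p, [/\ path e x p, last x p = y & size p = k]];
  last by exists p.
by have [] // := conn (x := x) (y := y) => p [h1 h2 _]; exists (size p), p.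
Qed.

Lemma gdist_le x y p : path e x p -> last x p = y -> (gdist e x y <= size p)%N.
Proof.
move=> h1 h2.
have [|_ h] := @leastP [set k | exists p, [/\ path e x p, last x p = y & size p = k]].
  by exists (size p), p.
by apply: h; exists p.
Qed.

Lemma gdist_refl x : gdist e x x = 0%N.
Proof. by have := @gdist_le x x [::] isT erefl; rewrite leqn0 => /eqP. Qed.

Lemma gdist_eq0 x y : gdist e x y = 0%N -> x = y.
Proof. by have [p [_ <- <-]] := gdist_path x y => /size0nil ->. Qed.

Lemma gdist_step x y z : e x y -> (gdist e x z <= (gdist e y z).+1)%N.
Proof.
move=> exy; have [p [h1 h2 <-]] := gdist_path y z.
by apply: (@gdist_le x z (y :: p)) => //=; rewrite exy.
Qed.

Lemma gdist_next x y : x != y -> exists z, e x z /\ gdist e x y = (gdist e z y).+1.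
Proof.
move=> xy; have [[|z p] /= [h1 h2 h3]] := gdist_path x y.
  by rewrite h2 eqxx in xy.
have /andP[exz pz] := h1; exists z; split=> //.
apply/eqP; rewrite eqn_leq gdist_step //= -h3 ltnS; exact: gdist_le.
Qed.

End GraphDistance.

Section RootedTree.
Context (V : choiceType) (e : rel V) (o : V).
Implicit Types (x y z : V) (E : set V).
Hypothesis sym : symmetric e.
Hypothesis irr : irreflexive e.
Hypothesis conn : connected_in e setT.
Hypothesis acyc : acyclic_in e setT.
Local Notation lev x := (gdist e x o).

(** [y] and [z] lie in the same component of the tree with [x] removed. *)
Definition linked_off x y z : Prop :=
  exists p, [/\ path e y p, last y p = z & x \notin y :: p].

Lemma linked_off_sym x y z : linked_off x y z -> linked_off x z y.
Proof.
move=> [p [h1 h2 h3]]; exists (rev (belast y p)); split.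
- rewrite -h2 rev_path; move: h1; congr path; apply/funext => a; apply/funext => b.
  by rewrite sym.
- by rewrite -h2; case: (p) => //= a s; rewrite rev_cons last_rcons.
- have -> : z :: rev (belast y p) = rev (y :: p) by rewrite [in RHS]lastI h2 rev_rcons.
  by rewrite mem_rev.
Qed.

Lemma linked_off_trans x y z w : linked_off x y z -> linked_off x z w -> linked_off x y w.
Proof.
move=> [p [h1 h2 h3]] [q [g1 g2 g3]]; exists (p ++ q); split.
- by rewrite cat_path h1 h2.
- by rewrite last_cat h2.
- by move: h3 g3; rewrite !inE mem_cat !negb_or => /andP[-> ->] /andP[_ ->].
Qed.

(* Two neighbours of [x] joined by a path avoiding [x] would close a cycle. *)
Lemma neighbors_linked_off x y z : e x y -> e x z -> linked_off x y z -> y = z.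
Proof.
move=> exy exz [p [h1 h2 h3]]; move: h3 h2.
case/shortenP: h1 => q pq uq sub h3 h2.
have h4 : x \notin y :: q.
  apply: contra h3; rewrite !inE => /orP[->//|/sub ->]; exact: orbT.
have : (size (x :: y :: q) <= 2)%N.
  apply: acyc => //; rewrite /ucycle /cycle /= -/(path _ _ _) rcons_path exy pq h2 sym exz /=.
  by move: h4 uq => /= -> ->.
by rewrite /= !ltnS leqn0 => /nilP q0; rewrite -h2 q0.
Qed.

Lemma lev_geodesic x : exists p, [/\ path e x p, last x p = o
  & forall z, z \in p -> (lev z < lev x)%N].
Proof.
move: {2}(lev x) (erefl (lev x)) => n; elim: n x => [|n IH] x hx.
  by exists [::]; split=> //; exact: (gdist_eq0 conn hx).
have xo : x != o by apply/eqP => xo; rewrite xo (gdist_refl e) in hx.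
have [y [exy hy]] := gdist_next conn xo.
have yn : lev y = n by move: hy; rewrite hx => -[].
have [p [p1 p2 p3]] := IH y yn; exists (y :: p); split=> //=; first by rewrite exy.
move=> z; rewrite inE => /orP[/eqP ->|/p3 h]; first by rewrite hy.
by rewrite hy; exact: ltnW.
Qed.

(** A geodesic to the root descends strictly after its first vertex, so it cannot meet an [x] at the
    level of [y] or above it. *)
Lemma linked_off_root x y : x != y -> (lev y <= lev x)%N -> linked_off x y o.
Proof.
move=> xy yx; have [p [p1 p2 p3]] := lev_geodesic y; exists p; split=> //.
rewrite inE (negPf xy) /=; apply/negP => /p3; by rewrite ltnNge yx.
Qed.

(** Both neighbours are linked to the root off [x], hence to each other. Equal levels are allowed,
    which also excludes edges inside a level. *)
Lemma lower_neighbor_unique x y z : e x y -> e x z ->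
  (lev y <= lev x)%N -> (lev z <= lev x)%N -> y = z.
Proof.
move=> exy exz hy hz.
have ne w : e x w -> x != w by move=> exw; apply/eqP => xw; rewrite -xw irr in exw.
apply: (neighbors_linked_off exy exz).
apply: (linked_off_trans (linked_off_root (ne _ exy) hy)).
exact/linked_off_sym/linked_off_root/hz/ne.
Qed.

(** At the root there is no lower neighbour, and the choice falls back on the root itself. *)
Definition parent x : V := xget x [set p | e x p /\ lev x = (lev p).+1].

Lemma parentP x : x != o -> e x (parent x) /\ lev x = (lev (parent x)).+1.
Proof.
move=> xo; apply: (@xgetPex _ x [set p | e x p /\ lev x = (lev p).+1]).
exact: gdist_next.
Qed.

Lemma parent_unique x y : x != o -> e x y -> (lev y <= lev x)%N -> y = parent x.
Proof.
move=> xo exy yx; have [h1 h2] := parentP xo.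
by apply: (lower_neighbor_unique exy h1 yx); rewrite h2.
Qed.

Lemma child_lev x y : e x y -> (x = o \/ y <> parent x) -> lev y = (lev x).+1.
Proof.
move=> exy hx; have eyx : e y x by rewrite sym.
apply/eqP; rewrite eqn_leq (gdist_step conn o eyx) /= ltnNge; apply/negP => yx.
case: hx => [xo|]; last first.
  have [xo _|xo] := eqVneq x o; last by apply; exact: parent_unique.
  move: yx; rewrite xo (gdist_refl e) leqn0 => /eqP /(gdist_eq0 conn) yo.
  by rewrite yo xo irr in exy.
move: yx; rewrite xo (gdist_refl e) leqn0 => /eqP /(gdist_eq0 conn) yo.
by rewrite yo xo irr in exy.
Qed.

Lemma child_parent x y : e x y -> lev y = (lev x).+1 -> parent y = x.
Proof.
move=> exy h; have yo : y != o by apply/eqP => yo; rewrite yo (gdist_refl e) in h.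
by apply/esym/parent_unique => //; rewrite ?h // sym.
Qed.

Section Subtree.
Variable S : set V.
Hypothesis So : S o.
Hypothesis connS : connected_in e S.

Lemma linked_in_subtree x y z : ~ S x -> S y -> S z -> linked_off x y z.
Proof.
move=> Sx Sy Sz; have [p [p1 p2 p3]] := connS Sy Sz; exists p; split=> //.
rewrite inE negb_or; apply/andP; split; first by apply/eqP => xy; rewrite xy in Sx.
by apply/negP => /p3.
Qed.

(** The first step of a path inside [S] from [x] to the root reaches a neighbour linked to the root
    off [x], and the parent is the only such neighbour. *)
Lemma subtree_parent x : S x -> x != o -> S (parent x).
Proof.
move=> Sx xo; have [p [p1 p2 p3]] := connS Sx So.
have [h1 h2] := parentP xo.
move: p2 p3; case/shortenP: p1 => -[|z q] /=; first by move=> _ _ _ xo'; rewrite xo' eqxx in xo.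
move=> /andP[exz pz] /andP[xz _] sub p2 p3.
suff <- : z = parent x by apply/p3/sub; exact: mem_head.
apply: (neighbors_linked_off exz h1); apply: (@linked_off_trans _ _ o).
  by exists q.
apply/linked_off_sym/linked_off_root; last by rewrite h2.
by apply/eqP => xp; rewrite -xp irr in h1.
Qed.

(** [S] is connected, contains the root and misses [x], so it lies in the root's component of the
    tree without [x]. Every simple path from [x] into [S] therefore starts through the parent. *)
Lemma gdist_off_subtree x y : ~ S x -> S y ->
  gdist e x y = (gdist e (parent x) y).+1.
Proof.
move=> Sx Sy; have xo : x != o by apply/eqP => xo; rewrite xo in Sx.
have [h1 h2] := parentP xo.
have xp : x != parent x by apply/eqP => xp; rewrite -xp irr in h1.
apply/eqP; rewrite eqn_leq (gdist_step conn y h1) /=.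
have [p [p1 p2 <-]] := gdist_path conn x y; move: p1 p2 => /shortenP.
case=> -[|z q] /=; first by move=> _ _ _ xy; rewrite xy in Sx.
move=> /andP[exz pz] /andP[xz uq] sub p2.
have zp : z = parent x.
  apply: (neighbors_linked_off exz h1); apply: (@linked_off_trans _ _ y).
    by exists q.
  apply: (linked_off_trans (linked_in_subtree Sx Sy So)).
  by apply/linked_off_sym/linked_off_root => //; rewrite h2.
rewrite -zp; apply: (@leq_trans (size (z :: q))).
  by rewrite ltnS; apply: gdist_le.
by apply: uniq_leq_size => /=; rewrite ?uq ?andbT //; move: xz uq; case/andP: uq.
Qed.

Lemma setdist_le x y : S y -> (setdist e x S <= gdist e x y)%N.
Proof.
move=> Sy; have [|_ h] := @leastP [set gdist e x y | y in S]; first by exists (lev x), o.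
by apply: h; exists y.
Qed.

Lemma setdist_ex x : exists2 y, S y & gdist e x y = setdist e x S.
Proof.
by have [|[y Sy h] _] := @leastP [set gdist e x y | y in S]; [exists (lev x), o|exists y].
Qed.

Lemma setdist_in x : S x -> setdist e x S = 0%N.
Proof. by move=> Sx; have := setdist_le x Sx; rewrite (gdist_refl e) leqn0 => /eqP. Qed.

Lemma setdist_off x : ~ S x -> setdist e x S = (setdist e (parent x) S).+1.
Proof.
move=> Sx; apply/eqP; rewrite eqn_leq; apply/andP; split.
  have [y Sy <-] := setdist_ex (parent x); rewrite -gdist_off_subtree //.
  exact: setdist_le.
by have [y Sy <-] := setdist_ex x; rewrite gdist_off_subtree // ltnS; exact: setdist_le.
Qed.

Lemma nearest_in x : S x -> nearest e S o x = x.
Proof.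
move=> Sx; apply: xget_unique; first by split=> //=; rewrite (gdist_refl e) setdist_in.
by move=> y /= [_]; rewrite setdist_in // => /(gdist_eq0 conn).
Qed.

Lemma nearest_off x : ~ S x -> nearest e S o x = nearest e S o (parent x).
Proof.
move=> Sx; rewrite /nearest; congr (xget _ _); apply/funext => y /=.
apply/propext; split=> -[Sy]; rewrite (setdist_off Sx) (gdist_off_subtree Sx Sy).
  by move=> [->].
by move=> ->.
Qed.

End Subtree.
End RootedTree.

(** * Symmetric kernels and the Schur test *)

Section Kernels.
Context (R : realType) (V : choiceType).
Variables (a : V -> V -> R) (nb : V -> {fset V}).
Implicit Types (u v : vec R V) (x y : V) (X : {fset V}).
Local Notation toC := (@toC R).
Hypothesis a_ge0 : forall x y, 0 <= a x y.
Hypothesis a_sym : forall x y, a x y = a y x.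
Hypothesis a_nb : forall x y, y \notin nb x -> a x y = 0.

Definition kernel_op : op R V := fun u x => \sum_(y <- nb x) toC (a x y) * u y.

Lemma kernel_row x (f : V -> R) X : (nb x `<=` X)%fset ->
  \sum_(y <- nb x) a x y * f y = \sum_(y <- X) a x y * f y.
Proof.
by move=> h; apply: big_fset_incl => // y _ /a_nb ->; rewrite mul0r.
Qed.

Lemma schur_test (w : V -> R) (lam : R) u : (forall x, 0 < w x) ->
  (forall x, \sum_(y <- nb x) a x y * w y <= lam * w x) -> l2 u ->
  l2 (kernel_op u) /\ l2norm (kernel_op u) <= lam * l2norm u.
Proof.
move=> w0 hw lu.
have lam0 x : 0 <= lam.
  rewrite -(pmulr_lge0 _ (w0 x)); apply: le_trans (hw x).
  by apply: sumr_ge0 => y _; rewrite mulr_ge0 // ltW.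
(* On an empty [V] the row condition says nothing about the sign of [lam]; both norms are then 0. *)
have [x0|noV] := pselect (exists x : V, True); last first.
  have e v : v = (fun=> 0) by apply/funext => x; case: noV; exists x.
  have [l0 n0] := l2_0 R V.
  rewrite (e (kernel_op u)) (e u); split=> //.
  by have -> : l2norm (fun _ : V => 0 : Cplx R) = 0;
    [apply/eqP; rewrite eq_le n0 l2norm_ge0|rewrite mulr0].
have {x0} lam0 : 0 <= lam by have [x _] := x0; exact: lam0 x.
apply: l2_bound => [|X]; first by rewrite mulr_ge0 // l2norm_ge0.
(* A finite set containing every row that starts in [X], so that the exchanged sums run over fixed
   finite sets. *)
pose X' := (X `|` \bigcup_(x <- X) nb x)%fset.
have nbX x : x \in X -> (nb x `<=` X')%fset.
  by move=> xX; apply: fsubset_trans (fsubsetUr _ _); exact: bigfcup_sup.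
have row x : x \in X -> cabs (kernel_op u x) ^+ 2 <=
    lam * (w x * \sum_(y <- X') a x y * (cabs (u y) ^+ 2 / w y)).
  move=> xX.
  have h1 : cabs (kernel_op u x) <= \sum_(y <- nb x) a x y * cabs (u y).
    apply: le_trans (cabs_sum _ _ _) _; apply: ler_sum => y _.
    by rewrite cabsM cabs_toC ger0_norm.
  have h2 : (\sum_(y <- nb x) a x y * cabs (u y)) ^+ 2 <=
     (\sum_(y <- nb x) a x y * w y) * (\sum_(y <- nb x) a x y * (cabs (u y) ^+ 2 / w y)).
    have := @cauchy_schwarz_sum _ _ (nb x) (fun y => Num.sqrt (a x y * w y))
      (fun y => Num.sqrt (a x y * (cabs (u y) ^+ 2 / w y))).
    have p1 y : 0 <= a x y * w y by rewrite mulr_ge0 // ltW.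
    have p2 y : 0 <= a x y * (cabs (u y) ^+ 2 / w y).
      by rewrite mulr_ge0 // divr_ge0 ?sqr_ge0 // ltW.
    under eq_bigr do rewrite -sqrtrM //.
    under [X in _ <= X * _ -> _]eq_bigr do rewrite sqr_sqrtr //.
    under [X in _ <= _ * X -> _]eq_bigr do rewrite sqr_sqrtr //.
    congr (_ ^+ 2 <= _); apply: eq_bigr => y _.
    have -> : a x y * w y * (a x y * (cabs (u y) ^+ 2 / w y)) = (a x y * cabs (u y)) ^+ 2.
      by field; rewrite gt_eqF.
    by rewrite sqrtr_sqr ger0_norm // mulr_ge0 // cabs_ge0.
  apply: le_trans (_ : (\sum_(y <- nb x) a x y * cabs (u y)) ^+ 2 <= _).
    rewrite lerXn2r ?nnegrE ?cabs_ge0 //.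
    by apply: sumr_ge0 => y _; rewrite mulr_ge0 // cabs_ge0.
  apply: le_trans h2 _.
  rewrite mulrA (kernel_row (fun y => cabs (u y) ^+ 2 / w y) (nbX x xX)).
  apply: ler_wpM2r (hw x); apply: sumr_ge0 => y _.
  by rewrite mulr_ge0 // divr_ge0 ?sqr_ge0 // ltW.
have h : \sum_(x <- X) cabs (kernel_op u x) ^+ 2 <=
    \sum_(x <- X) lam * (w x * \sum_(y <- X') a x y * (cabs (u y) ^+ 2 / w y)).
  by rewrite big_seq [leRHS]big_seq; apply: ler_sum.
apply: le_trans h _; rewrite -mulr_sumr exprMn expr2 -mulrA ler_wpM2l //.
under eq_bigr do rewrite mulr_sumr.
rewrite exchange_big /=.
apply: (@le_trans _ _ (\sum_(y <- X') lam * cabs (u y) ^+ 2)).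
  apply: ler_sum => y _.
  have -> : \sum_(x <- X) w x * (a x y * (cabs (u y) ^+ 2 / w y)) =
      (cabs (u y) ^+ 2 / w y) * \sum_(x <- X) a y x * w x.
    by rewrite mulr_sumr; apply: eq_bigr => x _; rewrite a_sym; ring.
  apply: (@le_trans _ _ ((cabs (u y) ^+ 2 / w y) * (lam * w y))); last first.
    by rewrite mulrCA divfK ?gt_eqF // mulrC.
  apply: ler_wpM2l; first by rewrite divr_ge0 ?sqr_ge0 // ltW.
  apply: le_trans (hw y); rewrite (kernel_row w (fsubsetUl (nb y) X)).
  apply: fset_sum_mono; last exact: fsubsetUr.
  by move=> x; rewrite mulr_ge0 // ltW.
by rewrite -mulr_sumr ler_wpM2l // l2norm_fset.
Qed.

Lemma kernel_op_lin (c : Cplx R) u v :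
  kernel_op (fun x => c * u x + v x) = fun x => c * kernel_op u x + kernel_op v x.
Proof.
apply/funext => x; rewrite /kernel_op mulr_sumr -big_split /=.
by apply: eq_bigr => y _; ring.
Qed.

Lemma kernel_op_sym X u v : (forall x, x \notin X -> u x = 0) ->
  (forall x, x \notin X -> v x = 0) -> inner (kernel_op u) v = inner u (kernel_op v).
Proof.
move=> hu hv; rewrite (inner_finr _ hv) (inner_finl _ hu).
have row (f : vec R V) x : (forall y, y \notin X -> f y = 0) ->
    kernel_op f x = \sum_(y <- X) toC (a x y) * f y.
  move=> hf.
  rewrite /kernel_op (big_fset_incl _ (fsubsetUl (nb x) X)); last first.
    by move=> y _ /a_nb ->; rewrite rmorph0 mul0r.
  rewrite (big_fset_incl _ (fsubsetUr (nb x) X)) // => y _ /hf ->.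
  by rewrite mulr0.
under eq_bigr do rewrite row // mulr_suml.
under [RHS]eq_bigr do rewrite row // rmorph_sum mulr_sumr.
rewrite exchange_big; apply: eq_bigr => y _; apply: eq_bigr => x _ /=.
by rewrite rmorphM /= conj_toC a_sym; ring.
Qed.

End Kernels.

(** * Children, spheres and regular subtrees *)

Section HomogeneousTree.
Local Open Scope card_scope.
Context (V : choiceType) (e : rel V) (o : V) (Q : nat).
Implicit Types (x y z : V).
Hypothesis hG : homogeneous_tree e setT Q.
Local Notation lev x := (gdist e x o).
Local Notation parent := (parent e o).

Let sym : symmetric e. Proof. by case: hG => -[]. Qed.
Let irr : irreflexive e. Proof. by case: hG => -[]. Qed.
Let conn : connected_in e setT. Proof. by case: hG. Qed.
Let acyc : acyclic_in e setT. Proof. by case: hG. Qed.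

Definition nbr x : {fset V} := fset_set [set y | e x y].

Lemma nbr_finite x : finite_set [set y | e x y].
Proof.
have [_ _ _ /(_ x I) h] := hG; exists Q; move: h.
by congr (_ #= _); apply/seteqP; split=> y //= -[].
Qed.

Lemma in_nbr x y : (y \in nbr x) = e x y.
Proof.
rewrite /nbr in_fset_set; last exact: nbr_finite.
by apply/idP/idP => [/set_mem //|h]; exact/mem_set.
Qed.

Definition ch x : {fset V} := [fset y in nbr x | lev y == (lev x).+1]%fset.

Lemma in_ch x y : (y \in ch x) = e x y && (lev y == (lev x).+1).
Proof. by rewrite !inE /= in_nbr. Qed.

Lemma nbr_root : ch o = nbr o.
Proof.
apply/fsetP => y; rewrite in_ch in_nbr andb_idr // => h.
by apply/eqP/(child_lev sym irr conn acyc) => //; left.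
Qed.

Lemma nbr_nonroot x : x != o ->
  nbr x = (parent x |` ch x)%fset /\ parent x \notin ch x.
Proof.
move=> xo; have [h1 h2] := parentP conn xo; split; last first.
  by rewrite in_ch h1 h2 /= -[X in X == _]addn0 -addn2 eqn_add2l.
apply/fsetP => y; rewrite in_nbr in_fsetU in_fset1 in_ch.
apply/idP/orP => [exy|[/eqP ->//|/andP[]//]].
have [->|yp] := eqVneq y (parent x); [by left|right].
by rewrite exy; apply/eqP/(child_lev sym irr conn acyc) => //; right; exact/eqP.
Qed.

Lemma sum_nbr (T : nmodType) (f : V -> T) x : x != o ->
  \sum_(y <- nbr x) f y = f (parent x) + \sum_(y <- ch x) f y.
Proof. by move=> /nbr_nonroot [-> h]; rewrite big_fsetU1. Qed.

Lemma card_nbr x : #|` nbr x| = Q.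
Proof.
have [_ _ _ /(_ x I)] := hG.
rewrite (_ : [set y | [set: V] y /\ e x y] = [set y | e x y]); last first.
  by apply/seteqP; split=> y //= -[].
by move=> h; apply/card_fset_set; exact: h.
Qed.

Lemma card_ch_root : #|` ch o| = Q.
Proof. by rewrite nbr_root card_nbr. Qed.

Lemma card_ch x : x != o -> #|` ch x| = Q.-1.
Proof.
move=> xo; have [h1 h2] := nbr_nonroot xo.
by rewrite -(card_nbr x) h1 cardfsU1 h2.
Qed.

Lemma ch_parent x y : y \in ch x -> [/\ parent y = x, e y x, y != o & lev y = (lev x).+1].
Proof.
rewrite in_ch => /andP[exy /eqP h]; split=> //; last first.
- by apply/eqP => yo; rewrite yo (gdist_refl e) in h.
- by rewrite sym.
- exact: (child_parent sym irr conn acyc).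
Qed.

Lemma in_ch_parent y : y != o -> y \in ch (parent y).
Proof.
by move=> yo; have [h1 h2] := parentP conn yo; rewrite in_ch sym h1 h2 eqxx.
Qed.

Lemma ball_finite n : finite_set (gball e o n).
Proof.
elim: n => [|n IH].
  apply: (sub_finite_set _ (finite_set1 o)) => x /=.
  by rewrite /gball /= leqn0 => /eqP /(gdist_eq0 conn).
apply: (@sub_finite_set _ _ (gball e o n `|` \bigcup_(x in gball e o n) [set y | e x y])).
  move=> x; rewrite /gball /= => hx.
  have [->|xo] := eqVneq x o; first by left; rewrite /= (gdist_refl e).
  have [h1 h2] := parentP conn xo; right; exists (parent x) => /=.
    by rewrite -ltnS -h2.
  by rewrite sym.
rewrite finite_setU; split=> //; apply: bigcup_finite => // x _; exact: nbr_finite.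
Qed.

Section Subtree.
Variables (S : set V) (d0 b : nat).
Hypothesis So : S o.
Hypothesis connS : connected_in e S.

Definition chS x : {fset V} := [fset y in ch x | y \in S]%fset.
Definition chN x : {fset V} := [fset y in ch x | y \notin S]%fset.

(** The common description of both families: d0 = b = 1 for the half-line, and d0 = q, b = q - 1 for
    the q-regular subtree. The estimates below see [S] only through these two numbers. *)
Definition regular_subtree : Prop :=
  #|` chS o| = d0 /\ forall x, S x -> x != o -> #|` chS x| = b.

Hypothesis regS : regular_subtree.

Lemma in_chS x y : (y \in chS x) = (y \in ch x) && (y \in S).
Proof. by rewrite !inE. Qed.

Lemma in_chN x y : (y \in chN x) = (y \in ch x) && (y \notin S).
Proof. by rewrite !inE. Qed.

Lemma sum_ch (T : nmodType) (f : V -> T) x :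
  \sum_(y <- ch x) f y = \sum_(y <- chS x) f y + \sum_(y <- chN x) f y.
Proof. exact: big_fsetID. Qed.

Lemma card_chSN x : (#|` chS x| + #|` chN x|)%N = #|` ch x|.
Proof.
rewrite -cardfsUI (_ : (chS x `|` chN x)%fset = ch x); last first.
  by apply/fsetP => y; rewrite in_fsetU in_chS in_chN -andb_orr orbN andbT.
rewrite (_ : (chS x `&` chN x)%fset = fset0) ?cardfs0 ?addn0 //.
by apply/fsetP => y; rewrite in_fsetI in_chS in_chN !inE; case: (y \in S); rewrite ?andbF.
Qed.

Lemma chS_off x : ~ S x -> chS x = fset0.
Proof.
move=> Sx; apply/fsetP => y; rewrite in_chS in_fset0; apply/negP => /andP[yx /set_mem Sy].
have [h1 _ h2 _] := ch_parent yx.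
by apply: Sx; rewrite -h1; exact: (subtree_parent sym irr conn acyc).
Qed.

Lemma chN_off x : ~ S x -> chN x = ch x.
Proof.
move=> Sx; apply/fsetP => y; rewrite in_chN andb_idr // => yx.
by have := in_chS x y; rewrite chS_off // in_fset0 yx => /esym /= ->.
Qed.

Definition sphere n : {fset V} := fset_set [set x | S x /\ lev x = n].

Lemma in_sphere n x : (x \in sphere n) = (x \in S) && (lev x == n).
Proof.
rewrite /sphere in_fset_set; last first.
  by apply: (sub_finite_set _ (ball_finite n)) => y [_ <-]; rewrite /gball /=.
apply/idP/andP => [/set_mem /= [h1 h2]|[/set_mem h1 /eqP h2]].
  by split; [exact/mem_set|exact/eqP].
by apply/mem_set.
Qed.

Lemma sphere0 : sphere 0 = [fset o]%fset.
Proof.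
apply/fsetP => x; rewrite in_sphere inE; apply/andP/eqP => [[_ /eqP]|->].
  exact: (gdist_eq0 conn).
by rewrite (gdist_refl e); split=> //; exact/mem_set.
Qed.

Lemma sum_sphereS (T : nmodType) (f : V -> T) n :
  \sum_(y <- sphere n.+1) f y = \sum_(x <- sphere n) \sum_(y <- chS x) f y.
Proof.
have ps y : y \in sphere n.+1 -> [/\ y != o, S y & parent y \in sphere n].
  rewrite in_sphere => /andP[/set_mem Sy /eqP hy].
  have yo : y != o by apply/eqP => yo; rewrite yo (gdist_refl e) in hy.
  have [h1 h2] := parentP conn yo; split=> //.
  rewrite in_sphere -eqSS -h2 hy eqxx andbT; apply/mem_set.
  exact: (subtree_parent sym irr conn acyc).
transitivity (\sum_(y <- sphere n.+1) \sum_(x <- sphere n | parent y == x) f y).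
  rewrite big_seq [RHS]big_seq; apply: eq_bigr => y /ps [yo _ py].
  rewrite big_mkcond (big_fsetD1 _ py) /= eqxx big1_fset ?addr0 // => x.
  by rewrite !inE => /andP[xy _] _; rewrite eq_sym (negPf xy).
under eq_bigr do rewrite big_mkcond.
rewrite exchange_big /= big_seq [RHS]big_seq; apply: eq_bigr => x.
rewrite in_sphere => /andP[/set_mem Sx /eqP hx].
rewrite -big_mkcond big_fset_condE; apply: eq_fbigl => y.
have -> : (y \in [fset i in sphere n.+1 | parent i == x]%fset) =
    (y \in sphere n.+1) && (parent y == x) by rewrite !inE.
rewrite in_chS; apply/andP/andP => [[/ps [yo Sy _] /eqP <-]|[yx Sy]].
  by rewrite in_ch_parent //; split=> //; exact/mem_set.
by have [h1 h2 h3 h4] := ch_parent yx; rewrite in_sphere Sy h4 hx h1 !eqxx.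
Qed.

Lemma sphere_neq0 n : (0 < d0)%N -> (0 < b)%N -> exists x, x \in sphere n.
Proof.
move=> hd hb; elim: n => [|n [x xn]]; first by exists o; rewrite sphere0 inE.
have : (0 < #|` chS x|)%N.
  have [h1 h2] := regS; have [->|xo] := eqVneq x o; first by rewrite h1.
  by rewrite h2 //; move: xn; rewrite in_sphere => /andP[/set_mem].
rewrite cardfs_gt0 => /fset0Pn [y yx]; exists y.
have := yx; rewrite in_chS => /andP[/ch_parent [_ _ _ h4] Sy].
by move: xn; rewrite !in_sphere Sy h4 => /andP[_ /eqP ->] /=.
Qed.

End Subtree.

Definition sub_d0 (Y : pgraph) : nat := if Y is GQq q then q else 1.
Definition sub_b (Y : pgraph) : nat := if Y is GQq q then q.-1 else 1.

(** Away from the root, one of the [k] neighbours in [S] is the parent, which lies in [S] by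
    [subtree_parent]. *)
Lemma subtree_card_ch (S : set V) k x : S o -> connected_in e S -> S x ->
  [set y | S y /\ e x y] #= `I_k -> #|` chS S x| = if x == o then k else k.-1.
Proof.
move=> So connS Sx h.
have fin : finite_set [set y | S y /\ e x y] by exists k.
have hk : #|` fset_set [set y | S y /\ e x y]| = k by apply/card_fset_set.
have mem y : (y \in fset_set [set y | S y /\ e x y]) = (y \in S) && e x y.
  rewrite in_fset_set //; apply/idP/andP => [/set_mem /= [h1 h2]|[/set_mem h1 h2]].
    by split=> //; exact/mem_set.
  exact/mem_set.
have [xo|xo] := eqVneq x o.
  rewrite -hk; congr (#|` _|); apply/fsetP => y.
  by rewrite mem in_chS xo nbr_root in_nbr andbC.
have [h1 h2] := parentP conn xo.
have pS : parent x \notin chS S x by rewrite in_chS in_ch h1 h2 /= -addn2 -[X in X == _]addn0 eqn_add2l.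
rewrite -hk (_ : fset_set _ = parent x |` chS S x)%fset ?cardfsU1 ?pS //.
apply/fsetP => y; rewrite mem in_fsetU in_fset1 in_chS.
have [->|yp] := eqVneq y (parent x).
  by rewrite h1 andbT; apply/mem_set; exact: (subtree_parent sym irr conn acyc).
rewrite andbC; congr (_ && _); rewrite in_ch; apply/idP/andP => [exy|[] //].
by split=> //; apply/eqP/(child_lev sym irr conn acyc) => //; right; exact/eqP.
Qed.

Lemma half_line_connected (S : set V) : half_line e S o -> connected_in e S.
Proof.
move=> [phi [_ _ rng adj]].
have Sphi i : S (phi i) by rewrite -rng; exists i.
have up d i : exists p, [/\ path e (phi i) p, last (phi i) p = phi (i + d)%N
    & forall z, z \in p -> S z].
  elim: d i => [|d IH] i; first by exists [::]; rewrite addn0.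
  have [p [p1 p2 p3]] := IH i.+1; exists (phi i.+1 :: p); split=> /=.
  - by rewrite p1 adj eqxx.
  - by rewrite p2 addSnnS.
  - by move=> z; rewrite inE => /orP[/eqP ->|/p3].
have down d i : exists p, [/\ path e (phi (i + d)%N) p, last (phi (i + d)%N) p = phi i
    & forall z, z \in p -> S z].
  elim: d => [|d [p [p1 p2 p3]]]; first by exists [::]; rewrite addn0.
  exists (phi (i + d)%N :: p); split=> /=.
  - by rewrite p1 addnS adj eqxx orbT.
  - by rewrite p2.
  - by move=> z; rewrite inE => /orP[/eqP ->|/p3].
move=> x y; rewrite -rng => -[i _ <-] [j _ <-].
by rewrite rng; have [/subnKC <-|/ltnW /subnKC <-] := leqP i j; [exact: up|exact: down].
Qed.

Lemma half_line_regular (S : set V) : half_line e S o -> regular_subtree S 1 1.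
Proof.
move=> [phi [inj phi0 rng adj]].
have adjS k : e (phi k) (phi k.+1) by rewrite adj eqxx.
have levphi k : lev (phi k) = k.
  (* Two consecutive levels are carried: phi (k+2) is a child of phi (k+1) because phi k is already
     known to be its parent. *)
  suff [] : lev (phi k) = k /\ lev (phi k.+1) = k.+1 by [].
  elim: k => [|k [h1 h2]].
    split; first by rewrite phi0 (gdist_refl e).
    have := child_lev (o := o) sym irr conn acyc (adjS 0%N).
    by rewrite phi0 (gdist_refl e); apply; left.
  split=> //; rewrite -{2}h2; apply: (child_lev (o := o) sym irr conn acyc (adjS k.+1)).
  right; rewrite (child_parent sym irr conn acyc (adjS k)) ?h1 // => /inj.
  by move/eqP; rewrite -addn2 -[X in _ == X]addn0 eqn_add2l.
have chE k : chS S (phi k) = [fset phi k.+1]%fset.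
  apply/fsetP => y; rewrite in_chS in_ch inE.
  apply/idP/eqP => [/andP[/andP[h1 /eqP h2] /set_mem]|->].
    rewrite -rng => -[j _ yj]; rewrite -yj adj !levphi in h1 h2.
    by rewrite -yj h2.
  by rewrite adjS !levphi eqxx /=; apply/mem_set; rewrite -rng; exists k.+1.
have all1 x : S x -> #|` chS S x| = 1%N.
  by rewrite -rng => -[k _ <-]; rewrite rng chE cardfs1.
by split=> [|x Sx _]; apply: all1 => //; rewrite -rng; exists 0%N.
Qed.

Lemma perturbed_subtree (Y : pgraph) (S : set V) : perturbed_set e Y S o ->
  [/\ S o, connected_in e S & regular_subtree S (sub_d0 Y) (sub_b Y)].
Proof.
case: Y => [hS|q [hS So]] /=.
  have So : S o by have [phi [_ <- <- _]] := hS; exists 0%N.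
  split=> //; [exact: half_line_connected|exact: half_line_regular].
have [_ connS _ deg] := hS; split=> //; split=> [|x Sx xo].
  by rewrite (subtree_card_ch So connS So (deg _ So)) eqxx.
by rewrite (subtree_card_ch So connS Sx (deg _ Sx)) (negPf xo).
Qed.

End HomogeneousTree.

Section OperatorNorm.
Context (R : realType) (V : choiceType).
Implicit Types (T : op R V) (u : vec R V).
Local Notation toC := (@toC R).

Lemma opnorm_le T (C : R) : 0 <= C ->
  (forall u, l2 u -> l2norm (T u) <= C * l2norm u) -> opnorm T <= C.
Proof.
move=> C0 hT; apply: ge_sup.
  exists (l2norm (T (fun=> 0))), (fun=> 0) => //=.
  by have [l0 n0] := l2_0 R V; split=> //; exact: le_trans n0 ler01.
move=> _ [u /= [lu u1] <-]; apply: le_trans (hT u lu) _.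
by rewrite -[leRHS]mulr1 ler_wpM2l.
Qed.

Lemma le_opnorm T (C : R) u : 0 <= C ->
  (forall u, l2 u -> l2 (T u) /\ l2norm (T u) <= C * l2norm u) ->
  (forall c u, T (fun x => c * u x) = fun x => c * T u x) -> l2 u ->
  l2norm (T u) <= opnorm T * l2norm u.
Proof.
move=> C0 hT homT lu.
have ub : has_ubound [set l2norm (T u) | u in [set u | l2 u /\ l2norm u <= 1]].
  exists C => _ [w /= [lw w1] <-]; apply: le_trans (proj2 (hT w lw)) _.
  by rewrite -[leRHS]mulr1 ler_wpM2l.
have [u0|un] := eqVneq (l2norm u) 0.
  by apply: le_trans (proj2 (hT u lu)) _; rewrite u0 !mulr0.
have up : 0 < l2norm u by rewrite lt_def un l2norm_ge0.
rewrite -ler_pdivrMr //; apply: ub_le_sup => //.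
exists (fun x => toC (l2norm u)^-1 * u x) => /=.
  split; first exact: l2Z.
  by rewrite l2normZ // cabs_toC ger0_norm ?invr_ge0 ?l2norm_ge0 // mulVf.
have [lT _] := hT u lu.
by rewrite homT l2normZ // cabs_toC ger0_norm ?invr_ge0 ?l2norm_ge0 // mulrC.
Qed.

Lemma opnorm_ge0 T : 0 <= opnorm T.
Proof.
rewrite /opnorm; set A := [set _ | _ in _].
(* Without a supremum, [sup] takes its default value 0. *)
have [hA|hA] := pselect (has_sup A); last by rewrite sup_out.
have [r [u hu hr]] := proj1 hA.
apply: (@le_trans _ _ r); first by rewrite -hr l2norm_ge0.
by apply: ub_le_sup; [exact: (proj2 hA)|exists u].
Qed.

End OperatorNorm.

(** * Adjacency operators and functions of the level *)

Section AdjacencyOperators.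
Context (R : realType) (V : choiceType) (e : rel V) (o : V) (Q : nat).
Hypothesis hG : homogeneous_tree e setT Q.
Implicit Types (u v : vec R V) (E S : set V) (x y : V).
Local Notation toC := (@toC R).
Local Notation nbr := (nbr e).
Local Notation nb x := (x |` nbr x)%fset.

(** One family for all the operators in play: an empty [S] gives the adjacency operator of the tree,
    and [E] is either a ball or the whole vertex set. *)
Definition tree_op E S : op R V := compress E (addop (@adjG R V e) (l2proj S)).

Definition tree_kernel E S x y : R :=
  if (x \in E) && (y \in E) then (e x y)%:R + ((x == y) && (x \in S))%:R else 0.

Lemma adjG_fset u x : adjG e u x = \sum_(y <- nbr x) u y.
Proof. by rewrite /adjG fsbig_finite //; exact: (nbr_finite hG). Qed.

Lemma addop_set0 : addop (@adjG R V e) (l2proj set0) = @adjG R V e.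
Proof.
apply/funext => u; apply/funext => x; rewrite /addop /l2proj.
by rewrite ifF ?addr0 //; apply/negP => /set_mem.
Qed.

Lemma compress_setT (T : op R V) : compress setT T = T.
Proof.
have pT (u : vec R V) : l2proj setT u = u.
  by apply/funext => x; rewrite /l2proj ifT //; exact/mem_set.
by apply/funext => u; rewrite /compress !pT.
Qed.

Lemma nbr_irr x : x \notin nbr x.
Proof. by rewrite (in_nbr hG); have [[_ ->]] := hG. Qed.

Lemma tree_kernel_ge0 E S x y : 0 <= tree_kernel E S x y.
Proof. by rewrite /tree_kernel; case: ifP => // _; rewrite addr_ge0. Qed.

Lemma tree_kernel_sym E S x y : tree_kernel E S x y = tree_kernel E S y x.
Proof.
rewrite /tree_kernel andbC; case: ifP => // _; have [[sym _] _ _ _] := hG.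
by rewrite sym eq_sym; case: eqP => // ->.
Qed.

Lemma tree_kernel_nb E S x y : y \notin nb x -> tree_kernel E S x y = 0.
Proof.
rewrite in_fsetU in_fset1 negb_or (in_nbr hG) => /andP[yx /negPf exy].
by rewrite /tree_kernel exy eq_sym (negPf yx) addr0 if_same.
Qed.

Lemma sum_nb (T : nmodType) (f : V -> T) x :
  \sum_(y <- nb x) f y = f x + \sum_(y <- nbr x) f y.
Proof. by rewrite big_fsetU1 // nbr_irr. Qed.

Lemma tree_opE E S : tree_op E S = kernel_op (tree_kernel E S) (fun x => nb x).
Proof.
apply/funext => u; apply/funext => x.
rewrite /tree_op /compress /kernel_op sum_nb {1}/l2proj /addop adjG_fset.
rewrite /tree_kernel; have [[_ irr] _ _ _] := hG.
case: ifP => [xE|xE] /=; last first.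
  by rewrite rmorph0 mul0r add0r big1 // => y _; rewrite mul0r.
rewrite irr eqxx /= add0r addrC; congr (_ + _); last first.
  by rewrite /l2proj xE; case: ifP => _; rewrite ?rmorph1 ?mul1r ?rmorph0 ?mul0r.
rewrite big_seq [RHS]big_seq; apply: eq_bigr => y; rewrite (in_nbr hG) => exy.
have xy : (x == y) = false by apply/eqP => xy; rewrite -xy irr in exy.
by rewrite exy xy /= addr0 /l2proj; case: ifP => _; rewrite ?rmorph1 ?mul1r ?rmorph0 ?mul0r.
Qed.

Lemma tree_op_schur E S (w : V -> R) (lam : R) u : (forall x, 0 < w x) -> 0 <= lam ->
  (forall x, E x -> \sum_(y <- nbr x) (if y \in E then w y else 0) +
     (if x \in S then w x else 0) <= lam * w x) -> l2 u ->
  l2 (tree_op E S u) /\ l2norm (tree_op E S u) <= lam * l2norm u.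
Proof.
move=> w0 lam0 hw lu; rewrite tree_opE.
apply: (schur_test (@tree_kernel_ge0 E S) (@tree_kernel_sym E S) (@tree_kernel_nb E S) w0 _ lu).
move=> x; rewrite sum_nb /tree_kernel; have [[_ irr] _ _ _] := hG.
have [xE|xE] := boolP (x \in E); last first.
  rewrite /= mul0r add0r big1 ?mulr_ge0 ?(ltW (w0 x)) //.
  by move=> y _; rewrite mul0r.
rewrite /= irr eqxx add0r addrC; apply: le_trans (hw x (set_mem xE)).
apply: lerD; last by case: ifP; rewrite ?mul1r ?mul0r.
rewrite le_eqVlt; apply/orP; left; apply/eqP.
rewrite big_seq [RHS]big_seq; apply: eq_bigr => y; rewrite (in_nbr hG) => exy.
have xy : (x == y) = false by apply/eqP => xy; rewrite -xy irr in exy.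
by rewrite exy xy /= addr0; case: ifP; rewrite ?mul1r ?mul0r.
Qed.

Lemma tree_op_lin E S (c : Cplx R) u v :
  tree_op E S (fun x => c * u x + v x) = fun x => c * tree_op E S u x + tree_op E S v x.
Proof. by rewrite tree_opE kernel_op_lin. Qed.

Lemma tree_op_scale E S (c : Cplx R) u :
  tree_op E S (fun x => c * u x) = fun x => c * tree_op E S u x.
Proof.
have z : tree_op E S (fun=> 0) = fun=> 0.
  by rewrite tree_opE; apply/funext => x; rewrite /kernel_op big1 // => y _; rewrite mulr0.
have := tree_op_lin E S c u (fun=> 0); rewrite z => h.
transitivity (tree_op E S (fun x => c * u x + 0)).
  by congr (tree_op E S _); apply/funext => x; rewrite addr0.
by rewrite h; apply/funext => x; rewrite addr0.
Qed.

Lemma tree_op_sym E S (X : {fset V}) u v : (forall x, x \notin X -> u x = 0) ->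
  (forall x, x \notin X -> v x = 0) -> inner (tree_op E S u) v = inner u (tree_op E S v).
Proof.
move=> hu hv; rewrite tree_opE.
exact: (kernel_op_sym (@tree_kernel_sym E S) (@tree_kernel_nb E S) hu hv).
Qed.

Local Notation lev x := (gdist e x o).

(** The weight s^(-lev) has neighbour sum s w + (Q - 1) w / s = 2 s w away from the root, and Q w /
    s <= 2 s w at the root because Q <= 2 (Q - 1). *)
Lemma adjG_schur (u : vec R V) E : (3 <= Q)%N -> l2 u ->
  let s : R := Num.sqrt (Q%:R - 1) in
  l2 (tree_op E set0 u) /\ l2norm (tree_op E set0 u) <= 2 * s * l2norm u.
Proof.
move=> Q3 lu s.
have s2 : s ^+ 2 = Q%:R - 1 by rewrite sqr_sqrtr // subr_ge0 ler1n (leq_trans _ Q3).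
have Q3' : 3 <= Q%:R :> R by rewrite (ler_nat _ 3).
have s1 : 1 <= s by rewrite -sqrtr1 ler_wsqrtr //; lra.
have s0 : 0 < s by lra.
pose w x : R := (s^-1) ^+ lev x.
have w0 x : 0 < w x by rewrite exprn_gt0 // invr_gt0.
apply: (tree_op_schur (w := w)) => // [|x _]; first by rewrite mulr_ge0 // ltW.
rewrite ifF ?addr0; last by apply/negP => /set_mem.
apply: (@le_trans _ _ (\sum_(y <- nbr x) w y)).
  by apply: ler_sum => y _; case: ifP => // _; rewrite ltW.
have wch y : y \in ch e o x -> w y = s^-1 * w x.
  by move=> /(ch_parent hG) [_ _ _ h]; rewrite /w h exprS.
have sum_ch : \sum_(y <- ch e o x) w y = #|` ch e o x|%:R * (s^-1 * w x).
  rewrite big_seq (eq_bigr (fun=> s^-1 * w x)); last by move=> y /wch.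
  by rewrite -big_seq big_const_seq count_predT iter_addr_0 mulr_natl.
have [xo|xo] := eqVneq x o.
  move: sum_ch; rewrite xo (nbr_root o hG) => ->.
  rewrite -(nbr_root o hG) (card_ch_root o hG) mulrA ler_wpM2r ?(ltW (w0 _)) //.
  by rewrite ler_pdivrMr // -mulrA -expr2 s2; lra.
rewrite (sum_nbr (o := o) hG) // sum_ch (card_ch hG xo).
have [_ conn _ _] := hG; have [_ h] := parentP conn xo.
have -> : w (parent e o x) = s * w x by rewrite /w h exprS mulrA divff ?gt_eqF // mul1r.
have -> : (Q.-1)%:R = s ^+ 2 by rewrite s2 -subn1 natrB // (leq_trans _ Q3).
have -> : s ^+ 2 * (s^-1 * w x) = s * w x by field; rewrite gt_eqF.
by lra.

Qed.

End AdjacencyOperators.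

Section TreeFunctions.
Context (R : realType) (V : choiceType) (e : rel V) (o : V) (Q : nat).
Context (S : set V) (d0 b : nat).
Hypothesis hG : homogeneous_tree e setT Q.
Hypothesis So : S o.
Hypothesis connS : connected_in e S.
Hypothesis regS : regular_subtree e o S d0 b.
Implicit Types (x y : V) (W beta : nat -> R).
Local Notation lev x := (gdist e x o).
Local Notation nbr := (nbr e).
Local Notation ch := (ch e o).
Local Notation parent := (parent e o).
Local Notation near x := (nearest e S o x).

Let sym : symmetric e. Proof. by case: hG => -[]. Qed.
Let irr : irreflexive e. Proof. by case: hG => -[]. Qed.
Let conn : connected_in e setT. Proof. by case: hG. Qed.
Let acyc : acyclic_in e setT. Proof. by case: hG. Qed.

Lemma off_neq_root x : ~ S x -> x != o.
Proof. by move=> Sx; apply/eqP => xo; rewrite xo in Sx. Qed.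

Lemma tree_ind (P : V -> Prop) : P o -> (forall x, x != o -> P (parent x) -> P x) ->
  forall x, P x.
Proof.
move=> P0 PS x; move: {2}(lev x) (erefl (lev x)) => n; elim: n x => [|n IH] x hx.
  by rewrite (gdist_eq0 conn hx).
have xo : x != o by apply/eqP => xo; rewrite xo (gdist_refl e) in hx.
apply: PS => //; apply: IH; have [_ h] := parentP conn xo.
by move: hx; rewrite h => -[].
Qed.

Lemma lev_nearest x : (lev x = lev (near x) + setdist e x S)%N.
Proof.
elim/tree_ind: x => [|x xo IH].
  by rewrite (nearest_in conn So So) (setdist_in e So So) (gdist_refl e).
have [Sx|Sx] := pselect (S x).
  by rewrite (nearest_in conn So Sx) (setdist_in e So Sx) addn0.
have [_ h] := parentP conn xo.
rewrite (nearest_off sym irr conn acyc So connS Sx).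
by rewrite (setdist_off sym irr conn acyc So connS Sx) addnS -IH.
Qed.

(** [W] gives the values on the levels of [S], and each step away from [S] from level i to i + 1
    multiplies by [beta i]. The eigenvector of A_Y (constant [beta]) and those of the balls both
    have this form. *)
Definition tree_fun W beta x : R :=
  W (lev (near x)) * \prod_(lev (near x) <= i < lev x) beta i.

Lemma tree_fun_in W beta x : S x -> tree_fun W beta x = W (lev x).
Proof. by move=> Sx; rewrite /tree_fun (nearest_in conn So Sx) big_geq ?mulr1. Qed.

Lemma tree_fun_off W beta x : ~ S x ->
  tree_fun W beta x = tree_fun W beta (parent x) * beta (lev (parent x)).
Proof.
move=> Sx; have xo := off_neq_root Sx; have [_ h] := parentP conn xo.
rewrite /tree_fun (nearest_off sym irr conn acyc So connS Sx) h big_nat_recr ?mulrA //=.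
by rewrite (lev_nearest (parent x)) leq_addr.
Qed.

Lemma tree_fun_cst W (a : R) x :
  tree_fun W (fun=> a) x = W (lev (near x)) * a ^+ setdist e x S.
Proof.
by rewrite /tree_fun prodr_const_nat [X in (X - _)%N]lev_nearest addKn.
Qed.

Lemma sum_const_fset (A : {fset V}) (f : V -> R) (c : R) : (forall y, y \in A -> f y = c) ->
  \sum_(y <- A) f y = #|` A|%:R * c.
Proof.
move=> h; rewrite big_seq (eq_bigr (fun=> c)); last by move=> y /h.
by rewrite -big_seq big_const_seq count_predT iter_addr_0 mulr_natl.
Qed.

Lemma sum_chS_tree_fun W beta x : \sum_(y <- chS e o S x) tree_fun W beta y =
  #|` chS e o S x|%:R * W (lev x).+1.
Proof.
apply: sum_const_fset => y; rewrite in_chS => /andP[/(ch_parent hG) [_ _ _ <-] /set_mem Sy].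
exact: tree_fun_in.
Qed.

Lemma sum_chN_tree_fun W beta x : \sum_(y <- chN e o S x) tree_fun W beta y =
  #|` chN e o S x|%:R * (beta (lev x) * tree_fun W beta x).
Proof.
apply: sum_const_fset => y; rewrite in_chN => /andP[/(ch_parent hG) [h _ _ _]].
by rewrite notin_setE => Sy; rewrite (tree_fun_off W beta Sy) h mulrC.
Qed.

Lemma sum_nbr_off W beta x : ~ S x ->
  \sum_(y <- nbr x) tree_fun W beta y =
  tree_fun W beta (parent x) + (Q%:R - 1) * (beta (lev x) * tree_fun W beta x).
Proof.
move=> Sx; have xo := off_neq_root Sx; rewrite (sum_nbr hG _ xo) (sum_ch e o S).
rewrite (chS_off hG So connS Sx) big_seq_fset0 add0r sum_chN_tree_fun.
rewrite (chN_off hG So connS Sx) (card_ch hG xo).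
have Q0 : (0 < Q)%N.
  have := card_ch hG xo; have [h1 h2] := nbr_nonroot hG xo.
  by rewrite -(card_nbr hG x) h1 cardfsU1 h2.
by rewrite -subn1 natrB.
Qed.

Lemma card_chN_root : (d0 <= Q)%N /\ #|` chN e o S o|%:R = Q%:R - d0%:R :> R.
Proof.
have := card_chSN e o S o; rewrite (proj1 regS) (card_ch_root o hG) => <-.
by rewrite leq_addr natrD addrC addKr.
Qed.

Lemma card_chN_nonroot x : S x -> x != o -> #|` chN e o S x|%:R = Q%:R - 1 - b%:R :> R.
Proof.
move=> Sx xo; have := card_chSN e o S x; rewrite (proj2 regS _ Sx xo) (card_ch hG xo) => h.
have Q0 : (0 < Q)%N.
  have [h1 h2] := nbr_nonroot hG xo.
  by rewrite -(card_nbr hG x) h1 cardfsU1 h2.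
have : b%:R + #|` chN e o S x|%:R = Q%:R - 1 :> R by rewrite -natrD h -subn1 natrB.
by move=> <-; rewrite addrC addKr.
Qed.

Lemma sum_nbr_root W beta :
  \sum_(y <- nbr o) tree_fun W beta y =
  d0%:R * W 1%N + (Q%:R - d0%:R) * (beta 0%N * W 0%N).
Proof.
rewrite -(nbr_root o hG) (sum_ch e o S) sum_chS_tree_fun sum_chN_tree_fun.
rewrite (proj1 regS) (proj2 card_chN_root) (gdist_refl e) tree_fun_in //.
by rewrite (gdist_refl e).
Qed.

(** On such functions the eigenvalue equation becomes a three-term recurrence for [W]; the branches
    leaving [S] only modify its diagonal coefficient. *)
Lemma sum_nbr_in W beta x k : S x -> lev x = k.+1 ->
  \sum_(y <- nbr x) tree_fun W beta y =
  W k + b%:R * W k.+2 + (Q%:R - 1 - b%:R) * (beta k.+1 * W k.+1).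
Proof.
move=> Sx hx; have xo : x != o by apply/eqP => xo; rewrite xo (gdist_refl e) in hx.
have [_ h] := parentP conn xo.
have Sp := subtree_parent sym irr conn acyc So connS Sx xo.
rewrite (sum_nbr hG _ xo) (sum_ch e o S) sum_chS_tree_fun sum_chN_tree_fun.
rewrite (proj2 regS _ Sx xo) (card_chN_nonroot Sx xo) !tree_fun_in // hx addrA.
by move: hx; rewrite h => -[->].
Qed.

End TreeFunctions.

(** * The Perron-Frobenius eigenvector of A_Y *)

Section CriticalConstants.
Context (R : realType).
Implicit Types (b Q : nat).

(* The larger root of [t^2 - (2 sqrt b + 1) t + b]. *)
Definition tcrit b : R :=
  let r : R := Num.sqrt b%:R in (2 * r + 1 + Num.sqrt (4 * r + 1)) / 2.

Definition acrit b : R := (tcrit b)^-1.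

(** Two conditions at a = 1/t. Off [S] the ratio a must solve lam = (Q - 1) a + 1/a. On [S], lam - 1
    - (Q - 1 - b) a must equal 2 sqrt b, the norm of the (b+1)-regular tree. Eliminating lam gives
    the quadratic equation for t. *)
Definition lamcrit b Q : R := (Q%:R - 1) * acrit b + tcrit b.

Lemma tcrit_gt b : Num.sqrt b%:R < tcrit b.
Proof.
have := sqrtr_ge0 (b%:R : R); have := sqrtr_ge0 (4 * Num.sqrt (b%:R : R) + 1).
by rewrite /tcrit; lra.
Qed.

Lemma tcrit_gt0 b : 0 < tcrit b.
Proof. exact: le_lt_trans (sqrtr_ge0 _) (tcrit_gt b). Qed.

Lemma acrit_gt0 b : 0 < acrit b.
Proof. by rewrite invr_gt0 tcrit_gt0. Qed.

Lemma tcrit_eq b : tcrit b + b%:R * acrit b = 2 * Num.sqrt b%:R + 1.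
Proof.
have t0 := tcrit_gt0 b; have r0 := sqrtr_ge0 (b%:R : R).
have r2 : Num.sqrt (b%:R : R) ^+ 2 = b%:R by rewrite sqr_sqrtr.
have q2 : Num.sqrt (4 * Num.sqrt (b%:R : R) + 1) ^+ 2 = 4 * Num.sqrt b%:R + 1.
  by rewrite sqr_sqrtr //; lra.
have e : tcrit b ^+ 2 = (2 * Num.sqrt b%:R + 1) * tcrit b - b%:R.
  by rewrite /tcrit -[X in _ - X]r2; move: q2; set q := Num.sqrt (_ + _); set r := Num.sqrt _; lra.
rewrite /acrit; apply: (mulIf (lt0r_neq0 t0)).
by rewrite mulrDl divfK ?gt_eqF // -expr2 e; ring.
Qed.

Lemma lamcrit_gt b Q : (3 <= Q)%N -> Num.sqrt (Q%:R - 1) < tcrit b ->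
  2 * Num.sqrt (Q%:R - 1) < lamcrit b Q.
Proof.
move=> Q3; set s : R := Num.sqrt _ => st; have t0 := tcrit_gt0 b.
have s2 : s ^+ 2 = Q%:R - 1 by rewrite sqr_sqrtr // subr_ge0 ler1n (leq_trans _ Q3).
rewrite /lamcrit -s2 /acrit -subr_gt0.
have -> : s ^+ 2 / tcrit b + tcrit b - 2 * s = (tcrit b - s) ^+ 2 / tcrit b.
  by field; rewrite gt_eqF.
by rewrite divr_gt0 // exprn_gt0 // subr_gt0.
Qed.

(** With d = (Q - 1) / t, the quantity under the root is ((t - d) / (t + d))^2, and Q - 1 < t^2
    fixes the sign of its root. *)
Lemma acoef_lamcrit b Q : (3 <= Q)%N -> Num.sqrt (Q%:R - 1) < tcrit b ->
  acoef Q (lamcrit b Q) = acrit b.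
Proof.
move=> Q3 st; have t0 := tcrit_gt0 b.
have Q1 : 0 < (Q%:R : R) - 1 by rewrite subr_gt0 ltr1n (leq_trans _ Q3).
move: st; rewrite /acoef /lamcrit /acrit.
set c := (Q%:R : R) - 1 in Q1 *; set t := tcrit b in t0 * => st.
have s2 : Num.sqrt c ^+ 2 = c by rewrite sqr_sqrtr // ltW.
have ct : c < t ^+ 2.
  by rewrite -s2 ltr_pXn2r // ?nnegrE ?sqrtr_ge0 // ltW.
have l0 : 0 < c / t + t by rewrite addr_gt0 // divr_gt0.
set d := c / t in l0 *; have ec : c = d * t by rewrite divfK // gt_eqF.
have d0 : 0 < d by rewrite divr_gt0.
have -> : 1 - 4 * c / (d + t) ^+ 2 = ((t - d) / (d + t)) ^+ 2.
  by rewrite ec; field; rewrite gt_eqF.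
rewrite sqrtr_sqr ger0_norm; last first.
  by rewrite divr_ge0 ?(ltW l0) // subr_ge0 ler_pdivrMr // -expr2 ltW.
by rewrite ec; field; rewrite !gt_eqF.
Qed.

Lemma amgm (q z : R) : 0 < z -> 2 * q <= z + q ^+ 2 / z.
Proof.
move=> z0; rewrite -subr_ge0.
have -> : z + q ^+ 2 / z - 2 * q = (z - q) ^+ 2 / z by field; rewrite gt_eqF.
by rewrite divr_ge0 ?sqr_ge0 // ltW.
Qed.

(** The function z + q^2 / z increases for z > q and equals 2 q + 1 at t. *)
Lemma root_gap (t q z : R) : 0 < t -> 0 < q -> t + q ^+ 2 / t = 2 * q + 1 ->
  q < z -> z < t -> z + q ^+ 2 / z - 1 < 2 * q.
Proof.
move=> t0 q0 ct qz zt; have z0 : 0 < z by exact: lt_trans qz.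
have -> : 2 * q = t + q ^+ 2 / t - 1 by rewrite ct; ring.
rewrite ltrD2r -subr_gt0.
have -> : t + q ^+ 2 / t - (z + q ^+ 2 / z) = (t - z) * (t * z - q ^+ 2) / (t * z).
  by field; rewrite !gt_eqF.
rewrite divr_gt0 ?mulr_gt0 ?subr_gt0 // expr2.
by apply: ltr_pM; rewrite ?(ltW q0) //; exact: lt_trans zt.
Qed.

End CriticalConstants.

Section ExplicitEigenfunction.
Context (R : realType) (V : choiceType) (e : rel V) (o : V) (Q : nat).
Context (S : set V) (d0 b : nat).
Hypothesis hG : homogeneous_tree e setT Q.
Hypothesis So : S o.
Hypothesis connS : connected_in e S.
Hypothesis regS : regular_subtree e o S d0 b.
Hypothesis Q3 : (3 <= Q)%N.
Hypothesis b0 : (0 < b)%N.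
Hypothesis hdb : d0 = b \/ d0 = b.+1.
Implicit Types (x y : V).
Local Notation toC := (@toC R).
Local Notation lev x := (gdist e x o).
Local Notation nbr := (nbr e).
Local Notation parent := (parent e o).
Local Notation a := (acrit R b).
Local Notation lam := (lamcrit R b Q).
Local Notation rb := (Num.sqrt (b%:R : R)).

(** The value that the equation at the root forces on d0 W(1): the root has d0 children in [S] and
    no parent. *)
Definition kap0 : R := 2 * rb + (d0%:R - 1 - b%:R) * a.
Definition cslope : R := rb * kap0 / d0%:R - 1.
(** The characteristic equation b z^2 - 2 sqrt b z + 1 = 0 has the double root 1 / sqrt b, hence the
    affine factor. Its slope [cslope] is fixed by the condition d0 W(1) = [kap0]. *)
Definition wcrit (k : nat) : R := (1 + cslope * k%:R) * rb ^- k.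
Definition pfr x : R := tree_fun e o S wcrit (fun=> a) x.

Let rb2 : rb ^+ 2 = b%:R. Proof. by rewrite sqr_sqrtr. Qed.
Let rb1 : 1 <= rb. Proof. by rewrite -[X in X <= _]sqrtr1 ler_wsqrtr // ler1n. Qed.
Let rb0 : 0 < rb. Proof. exact: lt_le_trans ltr01 rb1. Qed.
Let a0 : 0 < a. Proof. exact: acrit_gt0. Qed.
Let d00 : 0 < (d0%:R : R). Proof. by rewrite ltr0n; case: hdb => ->. Qed.

Lemma arb : a * rb < 1.
Proof. by rewrite mulrC ltr_pdivrMr ?tcrit_gt0 // mul1r tcrit_gt. Qed.

(** For d0 = b it amounts to 2 b - a sqrt b >= b, which holds by [arb]; for d0 = b + 1, to 2 b >= b
    + 1. *)
Lemma cslope_ge0 : 0 <= cslope.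
Proof.
rewrite /cslope subr_ge0 ler_pdivlMr // mul1r /kap0.
have := arb; have := rb2; have := rb1.
case: hdb => ->; rewrite -?natr1; move: a0; set r := rb; set B := (b%:R : R); nra.
Qed.

Lemma wcrit0 : wcrit 0 = 1.
Proof. by rewrite /wcrit mulr0 addr0 expr0 invr1 mulr1. Qed.

Lemma wcrit1 : d0%:R * wcrit 1 = kap0.
Proof. by rewrite /wcrit /cslope mulr1 expr1; field; rewrite !gt_eqF. Qed.

Lemma wcritS k : wcrit k + b%:R * wcrit k.+2 = 2 * rb * wcrit k.+1.
Proof.
rewrite -[X in X * wcrit k.+2]rb2 /wcrit !exprSr expr0 mul1r -!natr1; set z := rb ^+ k.
have z0 : z != 0 by rewrite gt_eqF // exprn_gt0.
by field; rewrite z0 gt_eqF.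
Qed.

Lemma wcrit_gt0 k : 0 < wcrit k.
Proof.
by rewrite mulr_gt0 ?invr_gt0 ?exprn_gt0 // ltr_pwDl // mulr_ge0 // cslope_ge0.
Qed.

Lemma pfr_gt0 x : 0 < pfr x.
Proof. by rewrite /pfr (tree_fun_cst hG So connS) mulr_gt0 ?wcrit_gt0 ?exprn_gt0. Qed.

Lemma pfr_eigen x : \sum_(y <- nbr x) pfr y + (if x \in S then pfr x else 0) = lam * pfr x.
Proof.
have ea := tcrit_eq R b; rewrite -/(acrit R b) in ea.
have ta : tcrit R b * a = 1 by rewrite mulfV // gt_eqF // tcrit_gt0.
have [Sx|Sx] := boolP (x \in S); last first.
  move: Sx; rewrite notin_setE => Sx; rewrite addr0 (sum_nbr_off hG So connS _ _ Sx).
  have h := tree_fun_off hG So connS wcrit (fun=> a) Sx.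
  rewrite /pfr h /lamcrit; set p := tree_fun _ _ _ _ _ (parent x).
  have -> : ((Q%:R - 1) * a + tcrit R b) * (p * a) =
     (Q%:R - 1) * (a * (p * a)) + p * (tcrit R b * a) by ring.
  by rewrite ta mulr1 addrC.
move: Sx => /set_mem Sx.
have [xo|xo] := eqVneq x o.
  rewrite xo (sum_nbr_root hG So connS regS) wcrit0 wcrit1 /pfr (tree_fun_in hG So) //.
  rewrite (gdist_refl e) wcrit0 /kap0 /lamcrit; move: ea; lra.
have [k hk] : exists k, lev x = k.+1.
  by have [_ conn _ _] := hG; have [_ ->] := parentP conn xo; eexists.
rewrite (sum_nbr_in hG So connS regS _ _ Sx hk) /pfr (tree_fun_in hG So) // hk wcritS /lamcrit.
have -> : tcrit R b = 2 * rb + 1 - b%:R * a by rewrite -ea addrK.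
ring.
Qed.

Lemma adjY_tree_op : @adjY R V e S = tree_op e setT S.
Proof. by rewrite /tree_op compress_setT. Qed.

Lemma lam_ge0 : 0 <= lam.
Proof.
rewrite addr_ge0 ?(ltW (tcrit_gt0 _ _)) // mulr_ge0 ?(ltW (acrit_gt0 _ _)) //.
by rewrite subr_ge0 ler1n (leq_trans _ Q3).
Qed.

(** Schur test with the positive eigenfunction [pfr] as weight, whether or not it is
    square-summable. *)
Lemma adjY_bound (u : vec R V) : l2 u -> l2 (adjY e S u) /\
  l2norm (adjY e S u) <= lam * l2norm u.
Proof.
move=> lu; rewrite adjY_tree_op.
apply: (tree_op_schur hG (w := pfr)) => //; [exact: pfr_gt0|exact: lam_ge0|].
move=> x _; rewrite -pfr_eigen lerD2r le_eqVlt; apply/orP; left; apply/eqP.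
by apply: eq_bigr => y _; rewrite ifT //; exact/mem_set.
Qed.

Lemma normY_le : normY R e S <= lam.
Proof.
by apply: opnorm_le; [exact: lam_ge0|move=> u lu; exact: (proj2 (adjY_bound lu))].
Qed.

Lemma adjY_le_normY (u : vec R V) : l2 u -> l2norm (adjY e S u) <= normY R e S * l2norm u.
Proof.
apply: (le_opnorm lam_ge0) => [w|c w]; first exact: adjY_bound.
by rewrite adjY_tree_op (tree_op_scale hG).
Qed.

End ExplicitEigenfunction.

(** * Eigenvectors of finite balls *)

Section BranchRatios.
Context (R : realType) (c : R).
Implicit Types (lam a : R).

(* Ratio of the Dirichlet solution between consecutive levels of a branch with
   [m] levels left. *)
Fixpoint branch_ratio lam m : R :=
  if m is k.+1 then (lam - c * branch_ratio lam k)^-1 else 0.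

Hypothesis c0 : 0 < c.
Let s : R := Num.sqrt c.
Let s0 : 0 < s. Proof. by rewrite sqrtr_gt0. Qed.
Let s2 : s ^+ 2 = c. Proof. by rewrite sqr_sqrtr // ltW. Qed.

(** For lam >= 2 s, the map z -> 1 / (lam - c z) sends [0, 1/s] into itself. *)
Lemma branch_ratio_bounds lam m : 2 * s <= lam ->
  [/\ 0 <= branch_ratio lam m, branch_ratio lam m <= s^-1
    & s <= lam - c * branch_ratio lam m].
Proof.
move=> hl.
have step z : z <= s^-1 -> s <= lam - c * z.
  move=> zs; have : c * z <= s.
    apply: le_trans (ler_wpM2l (ltW c0) zs) _.
    by rewrite -s2 expr2 -mulrA divff ?gt_eqF // mulr1.
  by lra.
have i0 : 0 <= s^-1 by rewrite invr_ge0 ltW.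
suff [h1 h2] : 0 <= branch_ratio lam m /\ branch_ratio lam m <= s^-1.
  by split=> //; exact: step.
elim: m => [|m [h1 h2]] //=; have h3 := step _ h2.
have h4 := lt_le_trans s0 h3.
by rewrite invr_ge0 (ltW h4) lef_pV2 ?posrE.
Qed.

(** The iteration contracts towards [a] by the factor s a, since the ratios are at most 1/s. The
    last term accounts for [a] being a fixed point at c a + 1/a rather than at [lam]. *)
Lemma branch_ratio_dist lam a m : 2 * s <= lam -> 0 < a -> s * a < 1 ->
  `|branch_ratio lam m - a| <=
  (s * a) ^+ m * a + `|c * a + a^-1 - lam| / c / (1 - s * a).
Proof.
move=> hl a0 sa; have d0 : 0 < 1 - s * a by lra.
have e0 : 0 <= `|c * a + a^-1 - lam| / c / (1 - s * a).
  by rewrite !divr_ge0 // ltW.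
have sa0 : 0 <= s * a by rewrite mulr_ge0 // ltW.
elim: m => [|m IH]; first by rewrite sub0r normrN ger0_norm ?(ltW a0) // expr0 mul1r lerDl.
have [h1 h2 h3] := branch_ratio_bounds m hl.
have [g1 g2 _] := branch_ratio_bounds m.+1 hl.
have h4 := lt_le_trans s0 h3.
have eq1 : branch_ratio lam m.+1 - a = branch_ratio lam m.+1 * a *
   ((c * a + a^-1 - lam) + c * (branch_ratio lam m - a)).
  by rewrite /=; field; rewrite !gt_eqF.
rewrite eq1 normrM normrM ger0_norm // (ger0_norm (ltW a0)).
apply: (@le_trans _ _ (s^-1 * a * (`|c * a + a^-1 - lam| + c * `|branch_ratio lam m - a|))).
  apply: ler_pM => //; first by rewrite mulr_ge0 // ltW.
    by rewrite ler_wpM2r // ltW.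
  by apply: le_trans (ler_normD _ _) _; rewrite normrM (ger0_norm (ltW c0)).
have sa1 : s^-1 * a <= c^-1.
  by rewrite -s2 expr2 invfM ler_pM2l ?invr_gt0 // -[s^-1]mul1r ler_pdivlMr // mulrC ltW.
have e1 : s^-1 * a * c = s * a by rewrite -s2; field; rewrite gt_eqF.
rewrite mulrDr [X in _ + X]mulrA e1 exprS.
apply: (@le_trans _ _ (`|c * a + a^-1 - lam| / c + s * a *
  ((s * a) ^+ m * a + `|c * a + a^-1 - lam| / c / (1 - s * a)))).
  apply: lerD; last by rewrite ler_wpM2l.
  by rewrite mulrC ler_wpM2l.
rewrite le_eqVlt; apply/orP; left; apply/eqP; field.
by rewrite !gt_eqF.
Qed.

End BranchRatios.

Lemma fset_argmax (R : realType) (V : choiceType) (X : {fset V}) (f : V -> R) x1 :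
  x1 \in X -> exists2 x0, x0 \in X & forall x, x \in X -> f x <= f x0.
Proof.
move=> x1X; have [s sX] : exists s : seq V, s = enum_fset X by eexists.
suff : forall s : seq V, {subset s <= X} -> exists2 x0, x0 \in X & forall x, x \in s -> f x <= f x0.
  by move=> /(_ (enum_fset X)) [] // x0 x0X h; exists x0.
elim=> [|y t IH] sub; first by exists x1.
have [|x0 x0X h] := IH; first by move=> z zt; apply: sub; rewrite inE zt orbT.
have yX : y \in X by apply: sub; exact: mem_head.
have [le|/ltW le] := leP (f y) (f x0).
  by exists x0 => // z; rewrite inE => /orP[/eqP ->|/h].
exists y => // z; rewrite inE => /orP[/eqP -> //|/h zx]; exact: le_trans le.
Qed.

Section FiniteVolume.
Context (R : realType) (V : choiceType) (e : rel V) (o : V) (Q : nat).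
Context (S : set V) (d0 b : nat).
Hypothesis hG : homogeneous_tree e setT Q.
Hypothesis So : S o.
Hypothesis connS : connected_in e S.
Hypothesis regS : regular_subtree e o S d0 b.
Hypothesis Q3 : (3 <= Q)%N.
Hypothesis b0 : (0 < b)%N.
Hypothesis hdb : d0 = b \/ d0 = b.+1.
Hypothesis bQ : (b < Q)%N.
Implicit Types (x y : V) (r : V -> R).
Local Notation lev x := (gdist e x o).
Local Notation nbr := (nbr e).
Local Notation ch := (ch e o).
Local Notation chS := (chS e o S).
Local Notation chN := (chN e o S).
Local Notation sphere := (sphere e o S).
Local Notation parent := (parent e o).
Local Notation c := ((Q%:R : R) - 1).
Local Notation s := (Num.sqrt c).
Local Notation al := (branch_ratio c).
Local Notation rb := (Num.sqrt (b%:R : R)).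

Let conn : connected_in e setT. Proof. by case: hG. Qed.
Let c0 : 0 < c. Proof. by rewrite subr_gt0 ltr1n (leq_trans _ Q3). Qed.
Let s0 : 0 < s. Proof. by rewrite sqrtr_gt0. Qed.

Let eQ : (Q.-1)%:R = c.
Proof. by rewrite -subn1 natrB // (leq_trans _ Q3). Qed.

(** A positive eigenfunction of the ball with Dirichlet condition: it vanishes from level n + 1
    on. *)
Definition ball_eigen n lam r : Prop :=
  [/\ forall x, (lev x <= n)%N -> 0 < r x,
      forall x, (n < lev x)%N -> r x = 0
    & forall x, (lev x <= n)%N ->
        \sum_(y <- nbr x) r y + (if x \in S then r x else 0) = lam * r x].

Let r_ge0 n lam r : ball_eigen n lam r -> forall x, 0 <= r x.
Proof.
by move=> [h1 h2 _] x; have [/h1 /ltW|/h2 ->] := leqP (lev x) n.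
Qed.

(** Induction from the boundary inwards: bounding the children from below in the equation at [x]
    gives r (parent x) <= (lam1 - c al) r x. A larger [lam1] only weakens the bound. *)
Lemma ball_eigen_branch n lam lam1 r x : ball_eigen n lam r -> lam <= lam1 ->
  2 * s <= lam1 -> ~ S x -> (lev x <= n.+1)%N ->
  al lam1 (n.+1 - lev x)%N * r (parent x) <= r x.
Proof.
move=> hr ll l1 Sx; move: {2}(n.+1 - lev x)%N (erefl (n.+1 - lev x)%N) => k.
elim: k x Sx => [|k IH] x Sx hk lx.
  by rewrite hk /= mul0r; exact: r_ge0 hr x.
have lxn : (lev x <= n)%N by rewrite -ltnS -subn_gt0 hk.
have [hpos _ heq] := hr.
have xo : x != o by apply/eqP => xo; rewrite xo in Sx.
have := heq x lxn; rewrite ifF; last by apply/negP => /set_mem.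
rewrite addr0 (sum_nbr hG _ xo) => h.
have [g1 g2 g3] := branch_ratio_bounds c0 k l1.
have dpos := lt_le_trans s0 g3.
have hch : \sum_(y <- ch x) al lam1 k * r x <= \sum_(y <- ch x) r y.
  rewrite big_seq [leRHS]big_seq; apply: ler_sum => y yx.
  have [py _ _ ly] := ch_parent hG yx.
  have Sy : ~ S y.
    move=> Sy; have := chS_off hG So connS Sx; move/fsetP/(_ y).
    by rewrite in_chS yx in_fset0 /= => /negP; apply; exact/mem_set.
  have hyk : (n.+1 - lev y)%N = k by rewrite ly subnS hk.
  by have := IH y Sy hyk; rewrite hyk py ly; apply.
rewrite (@sum_const_fset R V (ch x) (fun=> al lam1 k * r x) _ (fun _ _ => erefl)) (card_ch hG xo) eQ in hch.
rewrite hk /= mulrC ler_pdivrMr //.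
have : lam * r x <= lam1 * r x by rewrite ler_wpM2r // ltW // hpos.
by move: h hch; rewrite mulrA; lra.
Qed.

(** The equation is summed over a sphere of [S]. Every vertex of [S] has at least b children in [S],
    and the branches leaving [S] are bounded below by [ball_eigen_branch]. *)
Lemma sphere_sum_le n lam lam1 r k : ball_eigen n lam r -> lam <= lam1 ->
  2 * s <= lam1 -> (k.+1 <= n)%N ->
  b%:R * \sum_(x <- sphere k) r x + \sum_(x <- sphere k.+2) r x <=
  (lam1 - 1 - (c - b%:R) * al lam1 (n - k.+1)%N) * \sum_(x <- sphere k.+1) r x.
Proof.
move=> hr ll l1 kn; have [hpos _ heq] := hr.
have hb : b%:R * \sum_(x <- sphere k) r x <= \sum_(x <- sphere k.+1) r (parent x).
  rewrite (sum_sphereS hG So connS) mulr_sumr big_seq [leRHS]big_seq.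
  apply: ler_sum => x xk.
  have -> : \sum_(y <- chS x) r (parent y) = #|` chS x|%:R * r x.
    apply: sum_const_fset => y; rewrite in_chS => /andP[/(ch_parent hG) [-> _ _ _] _] //.
  rewrite ler_wpM2r ?(r_ge0 hr) // ler_nat.
  have [h1 h2] := regS; have [->|xo] := eqVneq x o.
    by rewrite h1; case: hdb => ->.
  by rewrite h2 //; move: xk; rewrite (in_sphere o hG) => /andP[/set_mem].
have [g1 _ _] := branch_ratio_bounds c0 (n - k.+1)%N l1.
rewrite [leRHS]mulr_sumr (sum_sphereS hG So connS r k.+1).
apply: le_trans (lerD hb (lexx _)) _.
rewrite -big_split /= big_seq [leRHS]big_seq; apply: ler_sum => x.
rewrite (in_sphere o hG) => /andP[/set_mem Sx /eqP hx].
have xo : x != o by apply/eqP => xo; rewrite xo (gdist_refl e) in hx.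
have lx : (lev x <= n)%N by rewrite hx.
have := heq x lx; rewrite ifT ?mem_set // (sum_nbr hG _ xo) (sum_ch e o S).
have hN : \sum_(y <- chN x) al lam1 (n - k.+1)%N * r x <= \sum_(y <- chN x) r y.
  rewrite big_seq [leRHS]big_seq; apply: ler_sum => y.
  rewrite in_chN => /andP[/(ch_parent hG) [py _ _ ly]]; rewrite notin_setE => Sy.
  have := ball_eigen_branch hr ll l1 Sy; rewrite ly py hx subSS.
  by rewrite ltnS; apply.
rewrite (@sum_const_fset R V (chN x) (fun=> al lam1 (n - k.+1)%N * r x) _ (fun _ _ => erefl)) (card_chN_nonroot R hG regS Sx xo) in hN.
have : lam * r x <= lam1 * r x by rewrite ler_wpM2r // ltW // hpos.
by move: hN; rewrite mulrA => hN h1 h2; rewrite mulrBl; lra.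
Qed.

(* Otherwise the sums over the spheres of [S] would have a ratio decreasing by a
   fixed amount at each level, and would turn negative. *)
Lemma ball_eigen_lower a1 : acrit R b < a1 -> s * a1 < 1 ->
  exists n0, forall n lam r, (n0 <= n)%N -> ball_eigen n lam r -> c * a1 + a1^-1 < lam.
Proof.
move=> aa sa; pose lam1 := c * a1 + a1^-1.
have a0 : 0 < a1 by apply: lt_trans aa; exact: acrit_gt0.
have s2 : s ^+ 2 = c by rewrite sqr_sqrtr // ltW.
have l1 : 2 * s <= lam1.
  rewrite -subr_ge0 /lam1 -[X in X * a1]s2.
  have -> : s ^+ 2 * a1 + a1^-1 - 2 * s = (s * a1 - 1) ^+ 2 / a1 by field; rewrite gt_eqF.
  by rewrite divr_ge0 ?sqr_ge0 // ltW.
have rb2 : rb ^+ 2 = b%:R by rewrite sqr_sqrtr.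
have rbpos : 0 < rb by rewrite sqrtr_gt0 ltr0n.
have bc : (b%:R : R) <= c by rewrite lerBrDr natr1 ler_nat.
have rbs : rb <= s by rewrite ler_wsqrtr.
(* a1 lies strictly between the two roots of [1 + b a^2 = (2 sqrt b + 1) a] *)
have gap : a1^-1 + b%:R * a1 - 1 < 2 * rb.
  have ct := tcrit_eq R b.
  have h1 : a1^-1 < tcrit R b.
    by rewrite -[tcrit R b]invrK ltf_pV2 // posrE // invr_gt0 tcrit_gt0.
  have h2 : rb < a1^-1.
    by apply: le_lt_trans rbs _; rewrite -[a1^-1]mul1r ltr_pdivlMr.
  have -> : b%:R * a1 = rb ^+ 2 / a1^-1 by rewrite invrK rb2.
  by apply: (root_gap (tcrit_gt0 R b) rbpos _ h2 h1); rewrite rb2.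
pose eta := (2 * rb - (a1^-1 + b%:R * a1 - 1)) / 2.
have eta0 : 0 < eta by rewrite divr_gt0 // subr_gt0.
(* At [lam1] the branch ratios converge to the fixed point [a1], so far from the boundary the
   coefficient in [sphere_sum_le] is close to a1^-1 + b a1 - 1 and stays eta below 2 sqrt b. *)
have [m0 hm0] : exists m0, forall m, (m0 <= m)%N ->
    lam1 - 1 - (c - b%:R) * al lam1 m <= 2 * rb - eta.
  have [m0 hm0] : exists m0, forall m, (m0 <= m)%N -> (s * a1) ^+ m * a1 <= eta / c.
    have h : (fun m => (s * a1) ^+ m * a1) @ \oo --> (0 : R).
      rewrite -(mul0r a1); apply: cvgM; last exact: cvg_cst.
      apply: cvg_expr; rewrite ger0_norm // mulr_ge0 // ltW //.
    have ec : 0 < eta / c by rewrite divr_gt0.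
    have [m0 _ hm] := (cvgr0Pnorm_le _).1 h _ ec.
    by exists m0 => m hm1; apply: le_trans (ler_norm _) (hm m hm1).
  exists m0 => m /hm0 hm.
  have := branch_ratio_dist c0 m l1 a0 sa; rewrite subrr normr0 !mul0r addr0 => hd.
  have hd2 := le_trans hd hm.
  have : `|(c - b%:R) * (al lam1 m - a1)| <= c * (eta / c).
    rewrite normrM; apply: ler_pM => //; rewrite ger0_norm ?subr_ge0 //.
    by rewrite gerBl.
  rewrite mulrCA divff ?gt_eqF // mulr1 ler_norml => /andP[hd3 _].
  have -> : 2 * rb - eta = a1^-1 + b%:R * a1 - 1 + eta by rewrite /eta; field; rewrite gt_eqF.
  by move: hd3; rewrite /lam1 mulrBr; lra.
(* The number of levels after which the bound on the ratio of sphere sums is negative. *)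
have [K hK] : exists K : nat, lam1 < K%:R * eta.
  exists (Num.truncn (lam1 / eta)).+1.
  by rewrite -ltr_pdivrMr // truncnS_gt.
exists (K + m0).+1 => n lam r hn hr; rewrite ltNge; apply/negP => ll.
pose sig k := \sum_(x <- sphere k) r x.
have sig0 k : (k <= n)%N -> 0 < sig k.
  move=> kn; have d00 : (0 < d0)%N by case: hdb => ->.
  have [x xk] := sphere_neq0 hG So regS k d00 b0.
  have [hpos _ _] := hr.
  rewrite /sig (big_fsetD1 _ xk) /= ltr_pwDl //.
    by apply: hpos; move: xk; rewrite (in_sphere o hG) => /andP[_ /eqP ->].
  by apply: sumr_ge0 => y _; exact: r_ge0 hr y.
(* If sig (k+1) <= rho sig k, then b sig k + sig (k+2) <= (2 sqrt b - eta) sig (k+1) and 2 sqrt b <=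
   rho + b / rho give sig (k+2) <= (rho - eta) sig (k+1). *)
have key k : (k <= K)%N -> sig k.+1 <= (lam1 - k%:R * eta) * sig k.
  elim: k => [|k IH] kK.
    rewrite mul0r subr0 /sig (sum_sphereS hG So connS) (sphere0 hG So) !big_seq_fset1.
    have [hpos _ heq] := hr; have lo : (lev o <= n)%N by rewrite (gdist_refl e).
    have h := heq o lo.
    have : lam * r o <= lam1 * r o by rewrite ler_wpM2r // ltW // hpos.
    rewrite -h ifT ?mem_set // -(nbr_root o hG) (sum_ch e o S).
    have : 0 <= \sum_(y <- chN o) r y by apply: sumr_ge0 => y _; exact: r_ge0 hr y.
    by have := hpos o lo; lra.
  have kn : (k.+1 <= n)%N := leq_trans kK (leq_trans (leq_addr m0 K) (ltnW hn)).
  have := sphere_sum_le hr ll l1 kn; rewrite -/(sig k) -/(sig k.+1) -/(sig k.+2).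
  have hm : (m0 <= n - k.+1)%N.
    by rewrite leq_subRL //; apply: leq_trans (ltnW hn); rewrite leq_add2r.
  have h1 := hm0 _ hm; have h2 := IH (ltnW kK).
  have p1 := sig0 _ kn; have p0 := sig0 _ (ltnW kn).
  have h3 : (lam1 - 1 - (c - b%:R) * al lam1 (n - k.+1)%N) * sig k.+1 <=
     (2 * rb - eta) * sig k.+1 by rewrite ler_wpM2r // ltW.
  move=> h4.
  have h5 : b%:R * sig k + sig k.+2 <= (2 * rb - eta) * sig k.+1 by exact: le_trans h3.
  set rho := lam1 - k%:R * eta in h2.
  have rho0 : 0 < rho by rewrite -(pmulr_lgt0 _ p0); exact: lt_le_trans h2.
  have -> : lam1 - k.+1%:R * eta = rho - eta by rewrite /rho -natr1; ring.
  have h6 : b%:R / rho * sig k.+1 <= b%:R * sig k.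
    by rewrite -mulrA ler_wpM2l // mulrC ler_pdivrMr // [sig k * _]mulrC.
  have h7 : 2 * rb <= rho + b%:R / rho.
    by rewrite -[X in _ + X / _]rb2; exact: amgm.
  have h8 : (2 * rb - b%:R / rho) * sig k.+1 <= rho * sig k.+1.
    by rewrite ler_wpM2r ?(ltW p1) //; lra.
  by rewrite mulrBl in h8; rewrite mulrBl in h5; rewrite mulrBl; lra.
have Kn1 : (K.+1 <= n)%N := leq_ltn_trans (leq_addr m0 K) hn.
have Kn := ltnW Kn1.
have := key K (leqnn K); have := sig0 _ Kn; have := sig0 _ Kn1.
have : lam1 - K%:R * eta < 0 by lra.
by move=> n1 p1 p2 h; have := nmulr_rlt0 (sig K) n1; rewrite p2 => hh; lra.
Qed.

End FiniteVolume.

Section PerronFrobenius.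
Context (R : realType) (V : choiceType) (e : rel V) (o : V) (Q : nat).
Context (S : set V) (d0 b : nat).
Hypothesis hG : homogeneous_tree e setT Q.
Hypothesis So : S o.
Hypothesis connS : connected_in e S.
Hypothesis regS : regular_subtree e o S d0 b.
Hypothesis Q3 : (3 <= Q)%N.
Hypothesis b0 : (0 < b)%N.
Hypothesis hdb : d0 = b \/ d0 = b.+1.
Implicit Types (x y : V) (r : V -> R).
Local Notation lev x := (gdist e x o).
Local Notation nbr := (nbr e).
Local Notation parent := (parent e o).
Local Notation c := ((Q%:R : R) - 1).
Local Notation s := (Num.sqrt c).
Local Notation al := (branch_ratio c).

Let sym : symmetric e. Proof. by case: hG => -[]. Qed.
Let conn : connected_in e setT. Proof. by case: hG. Qed.
Let c0 : 0 < c. Proof. by rewrite subr_gt0 ltr1n (leq_trans _ Q3). Qed.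
Let d00 : (0 < d0)%N. Proof. by case: hdb => ->. Qed.

Lemma sumr_le0_eq0 (A : {fset V}) (g : V -> R) : (forall y, 0 <= g y) ->
  \sum_(y <- A) g y <= 0 -> forall y, y \in A -> g y = 0.
Proof.
move=> g0 le y yA; apply/eqP; rewrite eq_le g0 andbT; apply: le_trans le.
by rewrite (big_fsetD1 _ yA) /= lerDl sumr_ge0.
Qed.

(* Maximum principle for the ratio [v / r]. *)
Lemma ball_eigen_unique n lam r v : ball_eigen e o S n lam r -> r o = 1 ->
  (forall x, (lev x <= n)%N -> lam * v x <=
     \sum_(y <- nbr x) (if (lev y <= n)%N then v y else 0) + (if x \in S then v x else 0)) ->
  forall x, (lev x <= n)%N -> v x = v o * r x.
Proof.
move=> [hpos h0 heq] ro hv.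
have lo : (lev o <= n)%N by rewrite (gdist_refl e).
have inX x : (x \in fset_set (gball e o n)) = (lev x <= n)%N.
  rewrite in_fset_set; last exact: (ball_finite o hG).
  by apply/idP/idP => [/set_mem //|?]; exact/mem_set.
have [x0 x0X hmax] := fset_argmax (fun x => v x / r x) (etrans (inX o) lo).
set M := v x0 / r x0 in hmax.
have vM x : (lev x <= n)%N -> v x <= M * r x.
  by move=> lx; rewrite -ler_pdivrMr ?hpos // hmax // inX.
have x0n : (lev x0 <= n)%N by rewrite -inX.
have P0 : v x0 = M * r x0 by rewrite divfK // gt_eqF // hpos.
pose g y := M * r y - (if (lev y <= n)%N then v y else 0).
have g0 y : 0 <= g y.
  rewrite /g; case: leqP => ly; first by rewrite subr_ge0 vM.
  by rewrite h0 // mulr0 subr0.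
have prop x y : (lev x <= n)%N -> v x = M * r x -> e x y -> (lev y <= n)%N -> v y = M * r y.
  move=> lx Px exy ly.
  suff : g y = 0 by rewrite /g ly => /eqP; rewrite subr_eq0 => /eqP.
  apply: (sumr_le0_eq0 (A := nbr x)) => //; last by rewrite (in_nbr hG).
  rewrite /g big_split /= sumrN -mulr_sumr.
  have := hv x lx; have := heq x lx; rewrite Px; case: ifP => _ h1 h2.
    have -> : \sum_(i <- nbr x) r i = lam * r x - r x by rewrite -h1 addrK.
    by move: h2; rewrite mulrBr [M * (lam * _)]mulrCA; lra.
  rewrite addr0 in h1; rewrite h1; move: h2; rewrite addr0 mulrCA; lra.
have Po : v o = M * r o.
  suff : forall x, (lev x <= n)%N -> v x = M * r x -> v o = M * r o by move/(_ x0); apply.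
  apply: (tree_ind (o := o) hG) => // x xo IH lx Px; have [h1 h2] := parentP conn xo.
  have lp : (lev (parent x) <= n)%N by move: lx; rewrite h2; exact: ltnW.
  by apply: IH => //; exact: prop Px h1 lp.
rewrite Po ro mulr1; apply: (tree_ind (o := o) hG) => [_|x xo IH lx] //.
have [h1 h2] := parentP conn xo.
have lp : (lev (parent x) <= n)%N by move: lx; rewrite h2; exact: ltnW.
by apply: (prop (parent x)) => //; [exact: IH|rewrite sym].
Qed.

(** The three-term recurrence along [S], started by the equation at the root; a pair of consecutive
    values is carried. It may be run past level n. *)
Fixpoint ball_weights n lam k : R * R :=
  if k is j.+1 then
    let: (p, q) := ball_weights n lam j in
    (q, ((lam - 1 - (c - b%:R) * al lam (n - j.+1)) * q - p) / b%:R)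
  else (1, (lam - 1 - (Q%:R - d0%:R) * al lam n) / d0%:R).

Definition ball_weight n lam k := (ball_weights n lam k).1.

Lemma ball_weight0 n lam : ball_weight n lam 0 = 1.
Proof. by []. Qed.

Lemma ball_weight1 n lam :
  ball_weight n lam 1 = (lam - 1 - (Q%:R - d0%:R) * al lam n) / d0%:R.
Proof. by []. Qed.

Lemma ball_weightSS n lam k : ball_weight n lam k.+2 =
  ((lam - 1 - (c - b%:R) * al lam (n - k.+1)) * ball_weight n lam k.+1 - ball_weight n lam k)
    / b%:R.
Proof. by rewrite /ball_weight /=; case: ball_weights. Qed.

(** The tree function solves the equation in the ball, but its value W (n+1) just outside need not
    be known to vanish. According to its sign, the function or its opposite is a subsolution with
    Dirichlet condition, and [ball_eigen_unique] identifies it with a multiple of [r]. *)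
Lemma ball_eigenE n lam r : ball_eigen e o S n lam r -> r o = 1 -> 2 * s <= lam ->
  forall x, (lev x <= n)%N ->
  r x = tree_fun e o S (ball_weight n lam) (fun i => al lam (n - i)) x.
Proof.
move=> hr ro l1; set W := ball_weight n lam; set beta := fun i : nat => _.
set u := tree_fun e o S W beta.
have ueq x : (lev x <= n)%N ->
    \sum_(y <- nbr x) u y + (if x \in S then u x else 0) = lam * u x.
  move=> lx; have [Sx|Sx] := boolP (x \in S); last first.
    move: Sx; rewrite notin_setE => Sx; rewrite addr0 (sum_nbr_off hG So connS _ _ Sx).
    have := tree_fun_off hG So connS W beta Sx; rewrite -/u => ->.
    have [_ h2] := parentP conn (off_neq_root So Sx); rewrite h2 /beta.
    have -> : (n - lev (parent x) = (n - (lev (parent x)).+1).+1)%N.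
      by rewrite subnSK // -h2.
    have [_ _ g] := branch_ratio_bounds c0 (n - (lev (parent x)).+1) l1.
    have gp : 0 < lam - c * al lam (n - (lev (parent x)).+1).
      by apply: lt_le_trans g; rewrite sqrtr_gt0.
    by rewrite /= ; field; rewrite gt_eqF.
  move: Sx => /set_mem Sx; have [xo|xo] := eqVneq x o.
    rewrite xo (sum_nbr_root hG So connS regS) /u (tree_fun_in hG So) //.
    rewrite (gdist_refl e) /W ball_weight0 ball_weight1 /beta subn0.
    by field; rewrite pnatr_eq0 -lt0n.
  have [k hk] : exists k, lev x = k.+1 by have [_ ->] := parentP conn xo; eexists.
  rewrite (sum_nbr_in hG So connS regS _ _ Sx hk) /u (tree_fun_in hG So) // hk /W ball_weightSS.
  by rewrite /beta; field; rewrite pnatr_eq0 -lt0n.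
have uo : u o = 1 by rewrite /u (tree_fun_in hG So) // (gdist_refl e).
have uout y : (n < lev y)%N -> (exists2 x, e x y & (lev x <= n)%N) -> u y = if y \in S then W n.+1 else 0.
  move=> ly [x exy lx].
  have hy : lev y = n.+1.
    apply/eqP; rewrite eqn_leq ly andbT.
    have eyx : e y x by rewrite sym.
    by apply: (leq_trans (gdist_step conn o eyx)); rewrite ltnS.
  case: ifPn => [/set_mem Sy|]; first by rewrite /u (tree_fun_in hG So) // hy.
  rewrite notin_setE => Sy; have [_ h2] := parentP conn (off_neq_root So Sy).
  have := tree_fun_off hG So connS W beta Sy; rewrite -/u => ->.
  by move: h2; rewrite hy => -[<-]; rewrite /beta subnn /= mulr0.
suff [key|key] : (forall x, (lev x <= n)%N -> u x = u o * r x) \/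
    (forall x, (lev x <= n)%N -> - u x = - u o * r x).
- by move=> x lx; rewrite (key x lx) uo mul1r.
- by move=> x lx; apply: oppr_inj; rewrite (key x lx) uo mulN1r.
have [w0|w0] := leP (W n.+1) 0; [left|right].
  apply: (ball_eigen_unique hr ro) => x lx; rewrite -ueq // lerD2r big_seq [leRHS]big_seq.
  apply: ler_sum => y; rewrite (in_nbr hG) => exy; case: leqP => // ly.
  by rewrite uout //; [case: ifP|exists x].
apply: (ball_eigen_unique (v := fun x => - u x) hr ro) => x lx; rewrite mulrN -ueq // opprD -sumrN.
apply: lerD; last by case: ifP; rewrite ?oppr0.
rewrite big_seq [leRHS]big_seq.
apply: ler_sum => y; rewrite (in_nbr hG) => exy; case: leqP => // ly.
by rewrite uout //; [case: ifP => _; rewrite ?oppr0 // oppr_le0 ltW|exists x].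
Qed.

End PerronFrobenius.

Section FiniteVolumeLimits.
Context (R : realType) (V : choiceType) (e : rel V) (o : V) (Q : nat).
Context (S : set V) (d0 b : nat).
Hypothesis hG : homogeneous_tree e setT Q.
Hypothesis So : S o.
Hypothesis connS : connected_in e S.
Hypothesis regS : regular_subtree e o S d0 b.
Hypothesis Q3 : (3 <= Q)%N.
Hypothesis b0 : (0 < b)%N.
Hypothesis hdb : d0 = b \/ d0 = b.+1.
Hypothesis bQ : (b < Q)%N.
Implicit Types (x y : V) (w : vec R V).
Local Notation toC := (@toC R).
Local Notation lev x := (gdist e x o).
Local Notation nbr := (nbr e).
Local Notation parent := (parent e o).
Local Notation c := ((Q%:R : R) - 1).
Local Notation s := (Num.sqrt c).
Local Notation al := (branch_ratio c).
Local Notation a := (acrit R b).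
Local Notation lam := (lamcrit R b Q).
Local Notation rb := (Num.sqrt (b%:R : R)).

Let c0 : 0 < c. Proof. by rewrite subr_gt0 ltr1n (leq_trans _ Q3). Qed.
Let s0 : 0 < s. Proof. by rewrite sqrtr_gt0. Qed.
Let a0 : 0 < a. Proof. exact: acrit_gt0. Qed.

Lemma l2proj_le (E : set V) w : l2 w -> l2 (l2proj E w) /\ l2norm (l2proj E w) <= l2norm w.
Proof.
move=> lw; apply: l2_bound; first exact: l2norm_ge0.
move=> X; apply: le_trans (l2norm_fset X lw); apply: ler_sum => x _.
by rewrite /l2proj; case: ifP => _ //; rewrite cabs0 expr0n /= sqr_ge0.
Qed.

Lemma pfn_toC n w : is_pfn e S o n w -> w = (fun x => toC (cabs (w x))).
Proof.
move=> [h1 h2 _ _]; apply/funext => x; apply: cabs_real.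
by have [/h1 /ltW //|/h2 ->] := pselect (gball e o n x).
Qed.

Lemma pfn_out n w : is_pfn e S o n w -> l2proj (gball e o n) w = w.
Proof.
move=> [_ h2 _ _]; apply/funext => x; rewrite /l2proj; case: ifPn => //.
by rewrite notin_setE => /h2 ->.
Qed.

Lemma pfn_l2 n w : is_pfn e S o n w -> l2 w.
Proof.
move=> [_ h2 _ _]; apply: (proj1 (l2_fin (X := fset_set (gball e o n)) _)) => x.
by rewrite in_fset_set ?notin_setE; [exact: h2|exact: (ball_finite o hG)].
Qed.

Lemma pfn_norm n w : is_pfn e S o n w -> 1 <= l2norm w.
Proof.
move=> hw; have lw := pfn_l2 hw; case: hw => [_ _ _ wo].
by apply: le_trans (cabs_le_l2norm o lw); rewrite wo -(rmorph1 toC) cabs_toC normr1.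
Qed.

Lemma pfn_ball_eigen n w : is_pfn e S o n w ->
  ball_eigen e o S n (normL R e S o n) (fun x => cabs (w x)).
Proof.
move=> hw; have out := pfn_out hw; have wE := pfn_toC hw; case: hw => [h1 h2 h3 h4]; split.
- by move=> x /h1; rewrite {1}wE -[X in X < _](rmorph0 toC) ltr_toC.
- by move=> x lx; rewrite h2 ?cabs0 // /gball /= leqNgt lx.
move=> x lx; apply: toC_inj; rewrite rmorphM rmorphD raddf_sum.
rewrite /= (_ : toC (cabs (w x)) = w x); last by rewrite [in RHS]wE.
have := congr1 (@^~ x) h3; rewrite /adjL /compress out {1}/l2proj ifT; last exact/mem_set.
rewrite /scaleop /adjY /addop (adjG_fset hG) => <-; congr (_ + _).
  by apply: eq_bigr => y _; rewrite [in RHS]wE.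
by rewrite /l2proj; case: ifP => _; rewrite ?rmorph0 // [in RHS]wE.
Qed.

Lemma normL_le n w : is_pfn e S o n w -> normL R e S o n <= normY R e S.
Proof.
move=> hw; have lw := pfn_l2 hw; have w1 := pfn_norm hw; have out := pfn_out hw.
case: hw => [_ _ h3 _].
have [l1 _] := adjY_bound hG So connS regS Q3 b0 hdb lw.
have h4 := adjY_le_normY hG So connS regS Q3 b0 hdb lw.
have wpos := lt_le_trans ltr01 w1.
rewrite -(ler_pM2r wpos) -[normL _ _ _ _ _]ger0_norm ?opnorm_ge0 // -cabs_toC.
rewrite -l2normZ //; apply: le_trans h4.
have -> : (fun x => toC (normL R e S o n) * w x) = adjL e S o n w by rewrite h3.
by rewrite /adjL /compress out; exact: (proj2 (l2proj_le _ l1)).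
Qed.

Hypothesis st : s < tcrit R b.
Context (wn : nat -> vec R V).
Hypothesis hwn : forall n, is_pfn e S o n (wn n).
Local Notation ln n := (normL R e S o n).

Let sa : s * a < 1.
Proof. by rewrite ltr_pdivrMr ?tcrit_gt0 // mul1r. Qed.

Lemma normL_near eps : 0 < eps -> \forall n \near \oo, lam - eps < ln n.
Proof.
(* The first bound keeps the loss d / (a (a + d)) in the eigenvalue below eps; the second keeps s (a
   + d) < 1. *)
move=> e0; pose d := Num.min (eps * a ^+ 2) ((s^-1 - a) / 2).
have g0 : 0 < s^-1 - a by rewrite subr_gt0 -[s^-1]mul1r ltr_pdivlMr // mulrC.
have dpos : 0 < d by rewrite lt_min mulr_gt0 ?exprn_gt0 // divr_gt0.
have d1 : d <= eps * a ^+ 2 by rewrite ge_min lexx.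
have d2 : d <= (s^-1 - a) / 2 by rewrite ge_min lexx orbT.
have aa : a < a + d by rewrite ltrDl.
have sa1 : s * (a + d) < 1 by rewrite mulrC -ltr_pdivlMr // div1r; lra.
have [n0 h] := ball_eigen_lower hG So connS regS Q3 b0 hdb bQ aa sa1.
exists n0 => // n /= hn; apply: le_lt_trans (h n _ _ hn (pfn_ball_eigen (hwn n))).
have ap : 0 < a + d by rewrite addr_gt0.
rewrite lerBlDr -lerBlDl /lamcrit -[tcrit R b]invrK -/(acrit R b).
have -> : c * a + a^-1 - (c * (a + d) + (a + d)^-1) = d / (a * (a + d)) - c * d.
  by field; rewrite !gt_eqF.
have : d / (a * (a + d)) <= eps.
  rewrite ler_pdivrMr ?mulr_gt0 //; apply: le_trans d1 _.
  by rewrite ler_wpM2l ?(ltW e0) // expr2 ler_wpM2l ?(ltW a0) // ltW.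
have : 0 <= c * d by rewrite mulr_ge0 // ltW.
by lra.
Qed.

Lemma normY_lamcrit : normY R e S = lam.
Proof.
apply/eqP; rewrite eq_le (normY_le R hG So connS regS Q3 b0 hdb) /=.
apply/ler_addgt0Pr => eps e0; have [n0 _ /(_ n0 (leqnn n0))] := normL_near e0.
by have := normL_le (hwn n0); lra.
Qed.

Lemma normL_cvg : (fun n => ln n) @ \oo --> lam.
Proof.
apply/cvgrPdist_le => eps e0; near=> n.
have h : lam - eps < ln n by near: n; exact: normL_near.
have := normL_le (hwn n); rewrite normY_lamcrit => h2.
by rewrite ger0_norm ?subr_ge0 //; lra.
Unshelve. all: by end_near.
Qed.

Lemma normL_gt : \forall n \near \oo, 2 * s < ln n.
Proof.
have h := lamcrit_gt Q3 st; have e0 : 0 < lam - 2 * s by rewrite subr_gt0.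
by near=> n; have : lam - (lam - 2 * s) < ln n by [near: n; exact: normL_near]; rewrite opprB addrC subrK.
Unshelve. all: by end_near.
Qed.

Lemma cvg_sub0 (f : nat -> R) (l : R) :
  (fun n => `|f n - l|) @ \oo --> (0 : R) -> f @ \oo --> l.
Proof.
move=> h; rewrite -(addrK l l) (_ : f = fun n => l + (f n - l)); last first.
  by apply/funext => n; rewrite addrC subrK.
rewrite -addrA subrr; apply: cvgD; [exact: cvg_cst|exact/norm_cvg0P].
Qed.

(** The eigenvalue moves with n as well; the second term of [branch_ratio_dist] absorbs its distance
    to the limit. *)
Lemma branch_ratio_cvg i : (fun n => al (ln n) (n - i)) @ \oo --> a.
Proof.
apply: cvg_sub0.
apply: (@cvg0_le _ _ (fun n => (s * a) ^+ (n - i) * a + `|lam - ln n| * (c^-1 / (1 - s * a)))).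
- by move=> n; exact: normr_ge0.
- near=> n; have l1 : 2 * s <= ln n by apply: ltW; near: n; exact: normL_gt.
  have := branch_ratio_dist c0 (n - i) l1 a0 sa.
  by rewrite invrK -/(lamcrit R b Q) mulrA.
apply: cvg0_add.
  apply: (cvg0_mul (l := a)); last exact: cvg_cst.
  have h : (fun n => (s * a) ^+ n) @ \oo --> (0 : R).
    by apply: cvg_expr; rewrite ger0_norm // mulr_ge0 // ltW.
  by rewrite -(cvg_shiftn i); under eq_fun do rewrite addnK.
apply: (cvg0_mul (l := c^-1 / (1 - s * a))); last exact: cvg_cst.
rewrite -[X in _ --> X](normr0 R) -[X in `|X|](subrr lam); apply: cvg_norm.
by apply: cvgB; [exact: cvg_cst|exact: normL_cvg].
Unshelve. all: by end_near.
Qed.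

Lemma ball_weight_cvg k :
  (fun n => ball_weight Q d0 b n (ln n) k) @ \oo --> wcrit R d0 b k.
Proof.
suff [] : (fun n => ball_weight Q d0 b n (ln n) k) @ \oo --> wcrit R d0 b k /\
  (fun n => ball_weight Q d0 b n (ln n) k.+1) @ \oo --> wcrit R d0 b k.+1 by [].
have d00 : (d0%:R : R) != 0 by rewrite pnatr_eq0 -lt0n; case: hdb => ->.
have b00 : (b%:R : R) != 0 by rewrite pnatr_eq0 -lt0n.
have ea := tcrit_eq R b; rewrite -/(acrit R b) in ea.
elim: k => [|k [IH1 IH2]]; split=> //.
- by under eq_fun do rewrite ball_weight0; rewrite wcrit0; exact: cvg_cst.
- under eq_fun do rewrite ball_weight1.
  have -> : wcrit R d0 b 1 = (lam - 1 - (Q%:R - d0%:R) * a) / d0%:R.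
    apply: (mulfI d00); rewrite (wcrit1 _ b0 hdb) /kap0 /lamcrit mulrCA divff // mulr1.
    by move: ea; lra.
  apply: cvgM; last exact: cvg_cst.
  apply: cvgB; first by apply: cvgB; [exact: normL_cvg|exact: cvg_cst].
  apply: cvgM; first exact: cvg_cst.
  by have := branch_ratio_cvg 0; under eq_fun do rewrite subn0.
under eq_fun do rewrite ball_weightSS.
have -> : wcrit R d0 b k.+2 =
    ((lam - 1 - (c - b%:R) * a) * wcrit R d0 b k.+1 - wcrit R d0 b k) / b%:R.
  apply: (mulfI b00); rewrite [RHS]mulrCA divff // mulr1.
  have -> : lam - 1 - (c - b%:R) * a = 2 * rb by rewrite /lamcrit; move: ea; lra.
  by rewrite -(wcritS R d0 b0) [X in _ = X - _]addrC addrK.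
apply: cvgM; last exact: cvg_cst; apply: cvgB => //; apply: cvgM => //.
apply: cvgB; first by apply: cvgB; [exact: normL_cvg|exact: cvg_cst].
by apply: cvgM; [exact: cvg_cst|exact: branch_ratio_cvg].
Qed.

Lemma pfn_cvg x : (fun n => cabs (wn n x)) @ \oo --> pfr R e o S d0 b x.
Proof.
have h : (fun n => tree_fun e o S (ball_weight Q d0 b n (ln n)) (fun i => al (ln n) (n - i)) x)
    @ \oo --> pfr R e o S d0 b x.
  rewrite /pfr; apply: (tree_ind (o := o) hG (P := fun x => (fun n =>
    tree_fun e o S (ball_weight Q d0 b n (ln n)) (fun i => al (ln n) (n - i)) x)
    @ \oo --> tree_fun e o S (wcrit R d0 b) (fun=> a) x)) => [|y yo IH].
    rewrite (tree_fun_in hG So) //; under eq_fun do rewrite (tree_fun_in hG So) //.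
    exact: ball_weight_cvg.
  have [Sy|Sy] := pselect (S y).
    rewrite (tree_fun_in hG So) //; under eq_fun do rewrite (tree_fun_in hG So) //.
    exact: ball_weight_cvg.
  rewrite (tree_fun_off hG So connS) //; under eq_fun do rewrite (tree_fun_off hG So connS) //.
  by apply: cvgM => //; exact: branch_ratio_cvg.
apply: cvg_trans h; apply: near_eq_cvg; near=> n.
have [_ _ _ wo] := hwn n.
symmetry; apply: (ball_eigenE hG So connS regS Q3 b0 hdb (pfn_ball_eigen (hwn n))).
- by rewrite wo -(rmorph1 toC) cabs_toC normr1.
- by apply: ltW; near: n; exact: normL_gt.
- by near: n; exists (lev x).
Unshelve. all: by end_near.
Qed.

End FiniteVolumeLimits.

(** * Comparison with the explicit formulas *)

Section Identification.
Context (R : realType) (V : choiceType) (e : rel V) (o : V) (Q : nat) (S : set V) (Y : pgraph).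
Hypothesis hG : homogeneous_tree e setT Q.
Hypothesis hQ : admissible R Y Q.
Hypothesis hS : perturbed_set e Y S o.
Local Notation b := (sub_b Y).
Local Notation d0 := (sub_d0 Y).

Lemma admissible_nat : [/\ (3 <= Q)%N, (0 < b)%N, d0 = b \/ d0 = b.+1 & (b < Q)%N].
Proof.
move: hQ; case: (Y) => [/= /andP[Q3 _]|q /= [q3 qQ _]].
  by split=> //; [left|exact: leq_trans Q3].
split; first exact: leq_trans (ltnW qQ).
- by case: q q3 {qQ} => [|[]].
- by right; rewrite prednK // (leq_trans _ q3).
- by apply: leq_ltn_trans qQ; exact: leq_pred.
Qed.

(** The bound Q <= Q(q), which is the integer part of t^2 plus 1, or Q <= 7, gives Q - 1 <= t^2.
    Equality is impossible: for the half-line t^2 > 6, and for the subtree it would make the bound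
    [lamcrit] on the norm equal to 2 s, against the assumed gap. *)
Lemma admissible_le : (forall q, Y = GQq q -> 2 * Num.sqrt (Q%:R - 1) < normY R e S) ->
  Num.sqrt ((Q%:R : R) - 1) < tcrit R b.
Proof.
move=> hgap; have [Q3 b0 hdb bQ] := admissible_nat.
have [So connS regS] := perturbed_subtree hG hS.
have normle := normY_le R hG So connS regS Q3 b0 hdb.
have t0 := tcrit_gt0 R b.
have c0 : 0 <= (Q%:R : R) - 1 by rewrite subr_ge0 ler1n (leq_trans _ Q3).
suff key : Num.sqrt ((Q%:R : R) - 1) <= tcrit R b.
  rewrite lt_neqAle key andbT; apply/eqP => st.
  have hc : (Q%:R : R) - 1 = tcrit R b ^+ 2 by rewrite -st sqr_sqrtr.
  have hl : lamcrit R b Q = 2 * tcrit R b.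
    rewrite /lamcrit hc /acrit expr2 mulfK ?gt_eqF //; ring.
  move: hQ hgap normle hc; rewrite hl st; case: (Y) => [/= /andP[_ Q7] _ _ hc|q _ /(_ q erefl)].
    have : tcrit R 1 ^+ 2 <= 6.
      by rewrite -hc lerBlDr natr1 ler_nat.
    rewrite /tcrit sqrtr1; have : 2 < Num.sqrt (4 * 1 + 1 : R).
      by rewrite -[X in X < _]ger0_norm // -sqrtr_sqr ltr_sqrt; lra.
    by nra.
  by move=> h1 h2 _; have := lt_le_trans h1 h2; rewrite ltxx.
have sq (x : R) : 0 <= x -> (Q%:R : R) - 1 <= x ^+ 2 -> Num.sqrt ((Q%:R : R) - 1) <= x.
  by move=> x0 /ler_wsqrtr; rewrite sqrtr_sqr ger0_norm.
apply: sq; first exact: ltW.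
move: hQ; case: (Y) => [/= /andP[_ Q7]|q /= [q3 _ Qm]].
  have : (Q%:R : R) - 1 <= 6 by rewrite lerBlDr natr1 ler_nat.
  rewrite /tcrit sqrtr1; have : 2 < Num.sqrt (4 * 1 + 1 : R).
    by rewrite -[X in X < _]ger0_norm // -sqrtr_sqr ltr_sqrt; lra.
  by nra.
rewrite lerBlDr; apply: (@le_trans _ _ (Qmax R q)%:R); first by rewrite ler_nat.
rewrite /Qmax -natr1 lerD2r.
have eq1 : (q.-1)%:R = (q%:R : R) - 1 by rewrite -subn1 natrB // (leq_trans _ q3).
rewrite /tcrit eq1 expr_div_n (_ : 2 ^+ 2 = 4 :> R); last by ring.
set X : R := _ / 4.
by have /truncn_itv /andP[] : 0 <= X := divr_ge0 (sqr_ge0 _) (ler0n _ 4).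
Qed.

Lemma sqrt_powR (x : R) k : 0 <= x -> x `^ (- k%:R / 2) = Num.sqrt x ^- k.
Proof.
move=> x0; rewrite mulNr powRN; congr (_^-1).
by rewrite mulrC powRrM powR12_sqrt // powR_mulrn ?sqrtr_ge0.
Qed.

Lemma wcoef_wcrit x : normY R e S = lamcrit R b Q -> Num.sqrt ((Q%:R : R) - 1) < tcrit R b ->
  wcoef R e S o Y Q x = wcrit R d0 b (gdist e x o).
Proof.
move=> nY st; have [Q3 _ _ _] := admissible_nat.
rewrite /wcoef nY (acoef_lamcrit Q3 st) /wcrit /cslope /kap0.
move: hQ; case: (Y) => [_|q /= [q3 _ _]] /=.
  by rewrite sqrtr1 expr1n invr1; set a := acrit _ _; field.
have eq1 : (q.-1)%:R = (q%:R : R) - 1 by rewrite -subn1 natrB // (leq_trans _ q3).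
have q1 : 0 <= (q%:R : R) - 1 by rewrite subr_ge0 ler1n (leq_trans _ q3).
rewrite eq1 sqrt_powR //; congr ((1 + _ * _) * _).
rewrite (_ : (q%:R : R) - 1 - _ = 0); last by ring.
rewrite mul0r addr0 mulrCA -expr2 sqr_sqrtr //.
by field; rewrite pnatr_eq0 -lt0n (leq_trans _ q3).
Qed.

Lemma pf_pfr : normY R e S = lamcrit R b Q -> Num.sqrt ((Q%:R : R) - 1) < tcrit R b ->
  pf R e S o Y Q = fun x => toC (pfr R e o S d0 b x).
Proof.
move=> nY st; have [Q3 _ _ _] := admissible_nat; have [So connS _] := perturbed_subtree hG hS.
apply/funext => x; rewrite /pf wcoef_wcrit // nY (acoef_lamcrit Q3 st) /pfr.
by rewrite (tree_fun_cst hG So connS) mulrC.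
Qed.

End Identification.

(** * Cutoffs for the density of states *)

Section Cutoff.
Context (R : realType).
Implicit Types (t g : R).

Lemma pos_le0 t : t <= 0 -> pos t = 0.
Proof. by move=> t0; rewrite /pos ler0_norm // subrr mul0r. Qed.

Lemma pos_ge t : t <= pos t.
Proof. by rewrite /pos; have := ler_norm t; lra. Qed.

Lemma pos_le1 t : t <= 1 -> pos t <= 1.
Proof. by move=> t1; have [/posE ->|/ltW /pos_le0 ->] := leP 0 t. Qed.

(* [min 1 (max 0 (g - h))] *)
Definition low_energy g (h : R) : R := 1 - pos (1 - pos (g - h)).

(* [1 / (exp (max h (g / 2)) - 1)] *)
Definition bose_cutoff g (h : R) : R := bosef (g / 2) (h - g / 2).

Lemma rcont_affine (a b : R) : rcont (fun t : R => a * t + b).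
Proof. exact: (rcont_lin a (rcont_id R) (rcont_cst b)). Qed.

Lemma rcont_low_energy g : rcont (low_energy g).
Proof.
have h1 := rcont_comp (rcont_pos R) (rcont_affine (-1) g).
have h2 := rcont_comp (rcont_affine (-1) 1) h1.
have h3 := rcont_comp (rcont_affine (-1) 1) (rcont_comp (rcont_pos R) h2).
rewrite (_ : low_energy g = fun t => -1 * pos (-1 * pos (-1 * t + g) + 1) + 1) //.
by apply/funext => t; rewrite /low_energy !mulN1r ![- _ + _]addrC.
Qed.

Lemma rcont_bose_cutoff g : 0 < g -> rcont (bose_cutoff g).
Proof.
move=> g0; have g2 : 0 < g / 2 by rewrite divr_gt0.
have := rcont_comp (rcont_bosef g2) (rcont_affine 1 (- (g / 2))).
by rewrite (_ : (fun t => _) = bose_cutoff g) //; apply/funext => t; rewrite mul1r.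
Qed.

Lemma low_energy_itv g h : 0 <= low_energy g h <= 1.
Proof.
have h1 := pos_ge0 (g - h); have h2 := pos_ge0 (1 - pos (g - h)).
by have h3 : pos (1 - pos (g - h)) <= 1; [apply: pos_le1; lra|rewrite /low_energy; lra].
Qed.

Lemma low_energy_le g h : low_energy g h <= pos (g - h).
Proof. by have := pos_ge (1 - pos (g - h)); rewrite /low_energy; lra. Qed.

Lemma low_energy_eq0 g h : low_energy g h = 0 -> g <= h.
Proof.
rewrite /low_energy => h0; rewrite leNgt; apply/negP => gh.
have gh0 : 0 < g - h by rewrite subr_gt0.
move: h0; rewrite (posE (ltW gh0)).
by have [/posE ->|/ltW /pos_le0 ->] := leP 0 (1 - (g - h)); lra.
Qed.

Lemma bose_cutoff_ge0 g h : 0 < g -> 0 <= bose_cutoff g h.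
Proof.
move=> g0; rewrite invr_ge0 subr_ge0 -expR0 ler_expR addr_ge0 ?pos_ge0 //.
by rewrite divr_ge0 // ltW.
Qed.

Lemma bose_cutoff_le g h : 0 < g -> bose_cutoff g h <= (g / 2)^-1.
Proof.
move=> g0; have g2 : 0 < g / 2 by rewrite divr_gt0.
have h1 := pos_ge0 (h - g / 2); have h2 := expm1_ge (pos (h - g / 2) + g / 2).
rewrite /bose_cutoff /bosef lef_pV2 ?posrE //; first by apply: le_trans h2; lra.
by apply: lt_le_trans h2; lra.
Qed.

Lemma bose_cutoffE g h : g / 2 <= h -> bose_cutoff g h = (expR h - 1)^-1.
Proof. by move=> gh; rewrite /bose_cutoff /bosef posE ?subr_ge0 // subrK. Qed.

(** The derivative of 1/(e^t - 1) has modulus (1 + 1/(e^t - 1)) / (e^t - 1), at most (1 + 1/c) / c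
    for t >= c. *)
Lemma bose_lipschitz (c t t' : R) : 0 < c -> c <= t -> t <= t' ->
  0 <= (expR t - 1)^-1 - (expR t' - 1)^-1 <= (t' - t) * ((1 + c^-1) / c).
Proof.
move=> c0 ct tt; have h1 := expm1_ge t; have h2 := expm1_ge t'.
have a0 : 0 < expR t - 1 by lra.
have b0 : 0 < expR t' - 1 by lra.
have h3 := expR_diff tt; have h4 : expR t <= expR t' by rewrite ler_expR.
have -> : (expR t - 1)^-1 - (expR t' - 1)^-1 =
  (expR t' - expR t) * ((expR t - 1)^-1 * (expR t' - 1)^-1).
  by field; rewrite !gt_eqF.
have i0 : 0 < (expR t - 1)^-1 * (expR t' - 1)^-1 by rewrite mulr_gt0 ?invr_gt0.
apply/andP; split; first by rewrite mulr_ge0 ?subr_ge0 // ltW.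
apply: le_trans (ler_wpM2r (ltW i0) h3) _.
rewrite -mulrA ler_wpM2l ?subr_ge0 //.
have -> : expR t' * ((expR t - 1)^-1 * (expR t' - 1)^-1) =
  (1 + (expR t' - 1)^-1) * (expR t - 1)^-1 by field; rewrite !gt_eqF.
apply: ler_pM.
- by rewrite addr_ge0 // invr_ge0 ltW.
- by rewrite invr_ge0 ltW.
- by rewrite lerD2l lef_pV2 ?posrE //; lra.
- by rewrite lef_pV2 ?posrE //; lra.
Qed.

(** If h + m >= g/2 the cutoff is inactive and the Lipschitz bound on [g/4, +oo) applies. Otherwise
    the difference is at most 1/eps + 2/g, and the last factor, at least g/2, compensates for its
    prefactor 2/g. *)
Lemma bose_cutoff_dist g eps h m : 0 < g -> 0 < eps -> eps <= h -> `|m| <= g / 4 ->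
  `|(expR h - 1)^-1 - bose_cutoff g (h + m)| <=
  `|m| * ((1 + (g / 4)^-1) / (g / 4)) +
  (eps^-1 + (g / 2)^-1) * (g / 2)^-1 * pos (g - (h + m)).
Proof.
move=> g0 e0 eh hm; have h0 : 0 < h by exact: lt_le_trans eh.
have g4 : 0 < g / 4 by rewrite divr_gt0.
have g2 : 0 < g / 2 by rewrite divr_gt0.
have c1 : 0 < (1 + (g / 4)^-1) / (g / 4) by rewrite divr_gt0 // addr_gt0 // invr_gt0.
have c2 : 0 < eps^-1 + (g / 2)^-1 by rewrite addr_gt0 // invr_gt0.
have pp := pos_ge0 (g - (h + m)).
have [mg|mg] := leP (g / 2) (h + m); last first.
  apply: (@le_trans _ _ ((eps^-1 + (g / 2)^-1) * (g / 2)^-1 * pos (g - (h + m)))); last first.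
    by rewrite lerDr mulr_ge0 // ltW.
  apply: (@le_trans _ _ (eps^-1 + (g / 2)^-1)).
    have b1 := bose_cutoff_ge0 (h + m) g0; have b2 := bose_cutoff_le (h + m) g0.
    have b3 : 0 <= (expR h - 1)^-1 by rewrite invr_ge0; have := expm1_ge h; lra.
    have b4 : (expR h - 1)^-1 <= eps^-1.
      by rewrite lef_pV2 ?posrE //; have := expm1_ge h; lra.
    by rewrite ler_norml; apply/andP; split; lra.
  rewrite -mulrA -[leLHS]mulr1 ler_wpM2l ?(ltW c2) // mulrC ler_pdivlMr // mul1r.
  by rewrite posE; lra.
apply: (@le_trans _ _ (`|m| * ((1 + (g / 4)^-1) / (g / 4)))); last first.
  by rewrite lerDl mulr_ge0 // mulr_ge0 ?(ltW c2) // invr_ge0 ltW.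
rewrite bose_cutoffE //.
have hm2 := hm; rewrite ler_norml in hm2; case/andP: hm2 => m1 m2.
have [m0|m0] := leP 0 m.
  have l1 : g / 4 <= h by lra.
  have l2 : h <= h + m by lra.
  have /andP[q1 q2] := bose_lipschitz g4 l1 l2.
  by rewrite ger0_norm //; move: q2; rewrite addrAC subrr add0r (ger0_norm m0).
have l1 : g / 4 <= h + m by lra.
have l2 : h + m <= h by lra.
have /andP[q1 q2] := bose_lipschitz g4 l1 l2.
by rewrite distrC ger0_norm //; move: q2; rewrite opprD addrA subrr sub0r (ltr0_norm m0).
Qed.

End Cutoff.

Section CriticalDensity.
Context (R : realType) (N : probability (measurableTypeR R) R) (g : R).
Hypothesis g0 : 0 < g.

Lemma bounded_rcont_integrable (f : R -> R) C : rcont f -> (forall t, 0 <= f t <= C) ->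
  N.-integrable setT (EFin \o f).
Proof.
move=> cf fC; apply: measurable_bounded_integrable => //.
- exact: fin_num_fun_lty.
- by apply: continuous_measurable_fun; exact: rcontE.
exists C; split; first exact: num_real.
by move=> y Cy t _ /=; have /andP[h1 h2] := fC t; rewrite ger0_norm // (le_trans h2) // ltW.
Qed.

(** A vanishing integral of [low_energy g] means that [N] lives on [g, +oo), where the cutoff
    coincides with the integrand. *)
Lemma densityc_cutoff : \int[N]_h low_energy g h = 0 ->
  densityc N = (\int[N]_h bose_cutoff g h)%:E.
Proof.
move=> int0; have g2 : g / 2 <= g.
  by rewrite ler_pdivrMr // mulr_natr mulr2n lerDl ltW.
have i1 := bounded_rcont_integrable (rcont_low_energy g) (low_energy_itv g).
have b0 t : 0 <= bose_cutoff g t <= (g / 2)^-1 by rewrite bose_cutoff_ge0 // bose_cutoff_le.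
have cb := rcont_bose_cutoff g0; have i2 := bounded_rcont_integrable cb b0.
have e1 : (\int[N]_h `|(low_energy g h)%:E| = 0)%E.
  rewrite -[RHS]/(0%:E) -int0 /Rintegral fineK; last exact: integrable_fin_num.
  apply: eq_integral => h _; rewrite gee0_abs // lee_fin.
  by have /andP[] := low_energy_itv g h.
have m1 : measurable_fun setT (EFin \o low_energy g) by case/integrableP: i1.
have ae1 := (ae_eq_integral_abs N measurableT m1).1 e1.
rewrite /Rintegral fineK; last exact: integrable_fin_num.
rewrite /densityc; apply: ae_eq_integral => //.
- have ce : continuous (fun h : R => expR h - 1) by exact: (rcontE (rcont_expm1 R)).
  have me : measurable_fun setT (fun h : R => expR h - 1) by exact: continuous_measurable_fun.
  under eq_fun do rewrite inver.
  apply: measurable_fun_if => //.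
    by apply: measurable_fun_eqr => //; exact: measurable_cst.
  rewrite setTI; apply/measurable_EFinP; apply: open_continuous_measurable_fun.
    rewrite (_ : _ @^-1` _ = (fun h : R => expR h - 1) @^-1` [set t | t != 0]).
      by apply: open_comp => [t _|]; [exact: ce|exact: open_neq].
    by apply/seteqP; split=> t /=; case: eqP.
  by move=> t /set_mem /= /negbT t0; apply: cvgV => //; exact: ce.
- by case/integrableP: i2.
apply: filterS ae1 => h /= /(_ I) [] /low_energy_eq0 gh _.
have hpos : 0 < h by exact: lt_le_trans gh.
rewrite bose_cutoffE; last exact: le_trans gh.
by rewrite inver gt_eqF // subr_gt0 expR_gt1.
Qed.

End CriticalDensity.

(** * Resolvents and Krein's formula *)

Section InverseOperators.
Context (R : realType) (V : choiceType).
Implicit Types (v g : vec R V) (T : op R V).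

Lemma inner0l (w : vec R V) : inner (fun=> 0) w = 0.
Proof. by rewrite (@inner_finl R V _ w fset0) ?big_seq_fset0. Qed.

Lemma inner0r (w : vec R V) : inner w (fun=> 0) = 0.
Proof. by rewrite (@inner_finr R V w _ fset0) ?big_seq_fset0. Qed.

Lemma opinvP T (F : set V) v : inv_dom F T v ->
  l2on F (opinv F T v) /\ T (opinv F T v) = l2proj F v.
Proof.
move=> [g0 [h1 _]]; pose P := [set g | l2on F g /\ T g = l2proj F v].
by have : P (xget (fun=> 0) P) by apply: xgetPex; exists g0.
Qed.

Lemma inv_dom_unique T (F : set V) v g : inv_dom F T v -> l2on F g -> T g = l2proj F v ->
  opinv F T v = g.
Proof.
move=> dom l h; have [g0 [_ h2]] := dom.
by rewrite -(h2 g (conj l h)); apply/esym/h2; exact: opinvP.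
Qed.

End InverseOperators.

Section Eigenbasis.
Context (R : realType) (V : choiceType) (N : nat) (E : set V).
Variables (phi : 'I_N -> vec R V) (h : 'I_N -> R).
Implicit Types (u w : vec R V) (F : R -> R) (T : op R V).
Local Notation toC := (@toC R).

Definition eigenbasis T : Prop :=
  [/\ orthonormal_family phi, forall i, l2on E (phi i),
      forall i, T (phi i) = fun x => toC (h i) * phi i x
    & forall u, l2on E u -> u = lincomb phi (fun i => inner u (phi i))].

Lemma l2on_proj u : l2 u -> l2on E (l2proj E u).
Proof.
move=> lu; split; first exact: (proj1 (l2proj_le _ lu)).
by move=> x Ex; rewrite /l2proj ifF //; apply/negP => /set_mem.
Qed.

Lemma l2proj_id u : l2on E u -> l2proj E u = u.
Proof.
move=> [_ h0]; apply/funext => x; rewrite /l2proj; case: ifPn => //.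
by rewrite notin_setE => /h0 ->.
Qed.

Lemma inner_l2proj u w : l2on E w -> inner (l2proj E u) w = inner u w.
Proof.
move=> [_ h0]; congr usum; apply/funext => x; rewrite /l2proj; case: ifPn => //.
by rewrite notin_setE => /h0 ->; rewrite conjC0 !mulr0.
Qed.

Variable T : op R V.
Hypothesis basis : eigenbasis T.

Let on : orthonormal_family phi. Proof. by case: basis. Qed.
Let phiE i : l2on E (phi i). Proof. by case: basis. Qed.

Lemma l2on_lincomb c : l2on E (lincomb phi c).
Proof.
split; first exact: l2_lincomb.
by move=> x Ex; apply: big1 => i _; rewrite (proj2 (phiE i)) ?mulr0.
Qed.

Lemma diag_op_proj F u : diag_op phi h F (l2proj E u) = diag_op phi h F u.
Proof. by congr lincomb; apply/funext => i; rewrite inner_l2proj. Qed.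

Lemma diag_op1 u : l2 u -> diag_op phi h (fun=> 1) u = l2proj E u.
Proof.
move=> lu; have [_ _ _ comp] := basis.
rewrite [RHS](comp _ (l2on_proj lu)) -diag_op_proj /diag_op; congr lincomb.
by apply/funext => i; rewrite rmorph1 mul1r.
Qed.

Lemma eigenbasis_diag u : linear_on E T -> l2on E u -> T u = diag_op phi h id u.
Proof.
move=> linT Eu; have [_ _ eig comp] := basis.
rewrite {1}(comp _ Eu) /lincomb (proj2 (linear_on_sum _ _ linT phiE)).
apply/funext => x; apply: eq_bigr => i _; rewrite eig mulrA; congr (_ * _).
by rewrite mulrC.
Qed.

(** An eigenvector for [c] only has components along those [phi i] with h i = c, so multiplicities
    cause no ambiguity. *)
Lemma diag_op_eigen (c : R) u F : l2on E u ->
  diag_op phi h id u = (fun y => toC c * u y) ->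
  diag_op phi h F u = fun y => toC (F c) * u y.
Proof.
move=> uE hu; have lu := proj1 uE; have [_ _ _ comp] := basis.
have hi i : inner u (phi i) != 0 -> h i = c.
  move=> nz; apply/toC_inj/(mulIf nz).
  have := congr1 (fun w => inner w (phi i)) hu.
  rewrite /diag_op (inner_lincomb_phi on) => ->.
  have -> : (fun y => toC c * u y) = fun y => toC c * u y + (fun=> 0) y.
    by apply/funext => y; rewrite addr0.
  by rewrite inner_linl ?inner0l ?addr0 //; [exact: (proj1 (l2_0 R V))|case: (phiE i)].
apply/funext => y; rewrite {2}(comp _ uE) /diag_op /lincomb mulr_sumr.
apply: eq_bigr => i _; rewrite mulrA.
by have [->|/hi ->] := eqVneq (inner u (phi i)) 0; rewrite ?mulr0 ?mul0r.
Qed.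

Variables (F : R -> R) (L : op R V).
Hypothesis LF : forall u, l2on E u -> L u = diag_op phi h F u.
Hypothesis F0 : forall i, F (h i) != 0.

Lemma opinv_diag_spec u : l2 u ->
  let g := diag_op phi h (fun t => (F t)^-1) u in
  (l2on E g /\ L g = l2proj E u) /\
  forall g', l2on E g' /\ L g' = l2proj E u -> g' = g.
Proof.
move=> lu g; have gE : l2on E g by exact: l2on_lincomb.
split.
  split=> //; rewrite LF // /g diag_op_comp // -diag_op1 //.
  by apply: eq_diag_op => i; rewrite divff.
move=> g' [g'E]; rewrite LF // => hg'; have lg' := proj1 g'E.
rewrite /g -diag_op_proj -hg' diag_op_comp //.
rewrite -[LHS](l2proj_id g'E) -diag_op1 //.
by apply: eq_diag_op => i; rewrite mulVf.
Qed.

Lemma inv_dom_diag u : l2 u -> inv_dom E L u.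
Proof.
by move=> lu; have [h1 h2] := opinv_diag_spec lu; eexists; split; [exact: h1|move=> ? /h2].
Qed.

Lemma opinv_diag u : l2 u -> opinv E L u = diag_op phi h (fun t => (F t)^-1) u.
Proof.
move=> lu; have [h1 h2] := opinv_diag_spec lu.
by apply: h2; apply: opinvP; exact: inv_dom_diag.
Qed.

End Eigenbasis.

Section KreinIdentity.
Context (R : realType) (V : choiceType) (e : rel V) (S E : set V) (z : R) (u : vec R V).
Implicit Types (v w g : vec R V) (T : op R V).
Local Notation toC := (@toC R).
Local Notation A := (compress E (@adjG R V e)).
Local Notation AS := (compress E (addop (@adjG R V e) (l2proj S))).
Local Notation RA := (resolvent E A z).
Local Notation RS := (resolvent E AS z).

Hypothesis linG : forall (c : Cplx R) v w,
  adjG e (fun x => c * v x + w x) = fun x => c * adjG e v x + adjG e w x.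
Hypothesis solA : forall v, l2 v -> inv_dom E (subop (scaleop z id) A) v.
Hypothesis solS : forall v, l2 v -> inv_dom E (subop (scaleop z id) AS) v.
Hypothesis lu : l2 u.
Local Notation SE := (S `&` E).

Let TAS v : l2on E v -> subop (scaleop z id) A v =
  fun x => subop (scaleop z id) AS v x + l2proj SE v x.
Proof.
move=> vE; apply/funext => x; rewrite /subop /compress (l2proj_id vE) /l2proj.
have [xE|xE] := boolP (x \in E); last first.
  by rewrite !subr0 ifF ?addr0 //; apply/negP => /set_mem [_ /mem_set]; exact/negP.
rewrite /addop /l2proj.
have -> : (x \in SE) = (x \in S) by rewrite in_setI xE andbT.
by rewrite opprD addrA subrK.
Qed.

Let TAlin (c : Cplx R) v w : subop (scaleop z id) A (fun x => c * v x + w x) =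
  fun x => c * subop (scaleop z id) A v x + subop (scaleop z id) A w x.
Proof.
apply/funext => x; rewrite /subop /scaleop /compress /=.
have -> : l2proj E (fun x => c * v x + w x) = fun x => c * l2proj E v x + l2proj E w x.
  by apply/funext => y; rewrite /l2proj; case: ifP => _; rewrite ?mulr0 ?addr0.
rewrite linG /l2proj; case: ifP => _; last by rewrite !subr0 mulrDr mulrCA.
by rewrite mulrDr mulrBr opprD [c * (toC z * _)]mulrCA addrACA.
Qed.

Lemma resolvent_add v w : l2 v -> l2 w -> RA (fun x => v x + w x) = fun x => RA v x + RA w x.
Proof.
move=> lv lw; have [h1 h2] := opinvP (solA lv); have [g1 g2] := opinvP (solA lw).
have ee (f g : vec R V) : (fun x => f x + g x) = fun x => 1 * f x + g x.
  by apply/funext => x; rewrite mul1r.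
rewrite /resolvent; apply: inv_dom_unique; first exact/solA/l2D.
  by rewrite ee; exact: l2on_lin.
rewrite [X in subop _ _ X]ee TAlin h2 g2; apply/funext => x; rewrite mul1r /l2proj.
by case: ifP; rewrite ?addr0.
Qed.

Lemma l2on_sub (F G : set V) v : F `<=` G -> l2on F v -> l2on G v.
Proof. by move=> FG [h1 h2]; split=> // x Gx; apply: h2 => /FG. Qed.

(** By the second resolvent identity, R_Y u = R_A u + R_A P_S R_Y u. Hence P_S R_Y u solves the
    equation (1 - S(z)) g = P_S R_A u that defines the middle factor. *)
Lemma krein_resolvent : krein e S E z u = fun x => RS u x - RA u x.
Proof.
have [g1E g1eq] := opinvP (solS lu); rewrite -/(resolvent E AS z u) in g1E g1eq *.
set g1 := RS u in g1E g1eq *; have lg1 := proj1 g1E.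
have SEE : SE `<=` E by exact: subIsetr.
pose g := l2proj SE g1.
have gSE : l2on SE g by exact: l2on_proj.
have gE : l2on E g by exact: l2on_sub gSE.
have [f0E f0eq] := opinvP (solA lu); rewrite -/(RA u) in f0E f0eq.
have key : g1 = fun x => RA u x + RA g x.
  have lg := proj1 gE; rewrite -resolvent_add //; symmetry; rewrite /resolvent; apply: inv_dom_unique => //.
    by apply: solA; exact: l2D (proj1 gE).
  rewrite TAS // g1eq -/g; apply/funext => x; rewrite /l2proj; case: ifPn => //.
  by rewrite notin_setE add0r; exact: (proj2 gE).
suff hg : resolvent SE (compress SE RA) 1 (RA u) = g.
  by rewrite /krein hg {1}key; apply/funext => x; rewrite addrC addKr.
have gsol : l2on SE g /\ subop (scaleop 1 id) (compress SE RA) g = l2proj SE (RA u).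
  split=> //; apply/funext => x; rewrite /subop /scaleop rmorph1 mul1r /compress (l2proj_id gSE).
  rewrite {1}/g {1}key /l2proj; case: ifP => _; last by rewrite subr0.
  by rewrite addrK.
apply: inv_dom_unique => //; last by case: gsol.
(* Uniqueness: for another solution g', the vector R_A u + R_A g' solves the equation of R_Y u, and
   its restriction to S is g'. *)
exists g; split=> // g' [g'SE g'eq].
have g'E : l2on E g' by exact: l2on_sub g'SE.
have [f1E f1eq] := opinvP (solA (proj1 g'E)); rewrite -/(RA g') in f1E f1eq.
pose f x := RA u x + RA g' x.
have fE : l2on E f.
  rewrite /f (_ : (fun x => _) = fun x => 1 * RA u x + RA g' x); first exact: l2on_lin.
  by apply/funext => x; rewrite mul1r.
have pf' : l2proj SE f = g'.
  apply/funext => x; have := congr1 (@^~ x) g'eq.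
  rewrite /subop /scaleop rmorph1 mul1r /compress (l2proj_id g'SE) /l2proj /f /=.
  case: ifPn => [_ /eqP|]; first by rewrite subr_eq => /eqP ->.
  by rewrite notin_setE subr0 => _ ->.
rewrite -pf'; congr l2proj; symmetry; apply/esym/inv_dom_unique => //; first exact: solS.
have Tf : subop (scaleop z id) A f = fun x => l2proj E u x + g' x.
  rewrite /f (_ : (fun x => _) = fun x => 1 * RA u x + RA g' x); last first.
    by apply/funext => x; rewrite mul1r.
  by rewrite TAlin f0eq f1eq (l2proj_id g'E); apply/funext => x; rewrite mul1r.
apply/funext => x; have := congr1 (@^~ x) (TAS fE); rewrite /= Tf pf'.
by move/addIr => <-.
Qed.

End KreinIdentity.

(** * Compressions to balls and their strong limits *)

Section Exhaustion.
Context (R : realType) (V : choiceType) (E : nat -> set V) (T : op R V).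
Implicit Types (u w : vec R V).
Local Notation toC := (@toC R).
Hypothesis Efin : forall n, finite_set (E n).
Hypothesis Eexh : forall x, \forall n \near \oo, E n x.

Lemma fset_exhausted (X : {fset V}) : \forall n \near \oo, forall x, x \in X -> E n x.
Proof.
have [s sX] : exists s : seq V, s = enum_fset X by eexists.
suff : forall s : seq V, \forall n \near \oo, forall x, x \in s -> E n x by exact.
elim=> [|y t IH]; first by near=> n.
near=> n => x; rewrite inE => /orP[/eqP ->|xt].
  by near: n; exact: Eexh.
by move: x xt; near: n.
Unshelve. all: by end_near.
Qed.

Lemma l2proj_cvg u : l2 u -> l2cvg (fun n => l2proj (E n) u) u.
Proof.
move=> lu; split; apply: cvg0_eps => [n|eps e0]; first exact: l2norm_ge0.
have e2 : 0 < eps ^+ 2 by rewrite exprn_gt0.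
have [A hA] := inner_has_sum lu lu e2.
near=> n.
have An : forall x, x \in A -> E n x by near: n; exact: fset_exhausted.
apply: l2norm_le_fset; first exact: ltW.
move=> X; pose U := (A `|` X)%fset.
have hU := hA A (fsubset_refl A).
have eN Z : \sum_(i <- Z) u i * (u i)^* = toC (\sum_(i <- Z) cabs (u i) ^+ 2).
  by rewrite raddf_sum; apply: eq_bigr => i _ /=; rewrite -cabs_sqr.
rewrite eN inner_self // -rmorphB cabs_toC distrC in hU.
have hU2 := l2norm_fset U lu.
apply: (@le_trans _ _ (\sum_(x <- (U `\` A)%fset) cabs (u x) ^+ 2)).
  apply: (@le_trans _ _ (\sum_(x <- (X `\` A)%fset) cabs (u x) ^+ 2)).
    rewrite (big_fsetID _ (fun x => x \in A)) /=.
    rewrite big1_fset ?add0r => [|x]; last first.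
      rewrite !inE => /andP[_ xA] _; rewrite /l2proj ifT ?subrr ?cabs0 ?expr0n //.
      by apply/mem_set; exact: An.
    rewrite (_ : [fset x in X | x \notin A]%fset = (X `\` A)%fset); last first.
      by apply/fsetP => x; rewrite !inE andbC.
    apply: ler_sum => x _; rewrite /l2proj; case: ifP => _.
      by rewrite subrr cabs0 expr0n sqr_ge0.
    by rewrite sub0r cabsN.
  apply: fset_sum_mono => [x|]; first exact: sqr_ge0.
  by apply: fsetSD; exact: fsubsetUr.
have -> : \sum_(x <- (U `\` A)%fset) cabs (u x) ^+ 2 =
    \sum_(x <- U) cabs (u x) ^+ 2 - \sum_(x <- A) cabs (u x) ^+ 2.
  rewrite [in RHS](big_fsetID _ (fun x => x \in A)) /=.
  rewrite (_ : [fset x in U | x \in A]%fset = A); last first.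
    by apply/fsetP => x; rewrite !inE andbC; case: (x \in A).
  rewrite (_ : [fset x in U | x \notin A]%fset = (U `\` A)%fset); last first.
    by apply/fsetP => x; rewrite !inE andbC.
  by rewrite addrC addrK.
by have := ler_norm (l2norm u ^+ 2 - \sum_(i <- A) cabs (u i) ^+ 2); lra.
Unshelve. all: by end_near.
Qed.

Hypothesis linT : forall (c : Cplx R) u w,
  T (fun x => c * u x + w x) = fun x => c * T u x + T w x.
Variable C : R.
Hypothesis C0 : 0 <= C.
Hypothesis bndT : forall u, l2 u -> l2 (T u) /\ l2norm (T u) <= C * l2norm u.
Local Notation Tn n := (compress (E n) T).

Lemma compress_bound n u : l2 u -> l2 (Tn n u) /\ l2norm (Tn n u) <= C * l2norm u.
Proof.
move=> lu; have [l1 n1] := l2proj_le (E n) lu; have [l2' n2] := bndT l1.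
have [l3 n3] := l2proj_le (E n) l2'; split=> //; apply: le_trans n3 (le_trans n2 _).
by rewrite ler_wpM2l.
Qed.

Lemma compress_cvg u : l2 u -> l2cvg (fun n => Tn n u) (T u).
Proof.
move=> lu; have lT := proj1 (bndT lu).
have lp n : l2 (l2proj (E n) u) by exact: (proj1 (l2proj_le _ lu)).
have h1 := l2proj_cvg lu; have h2 := l2proj_cvg lT.
have lq n : l2 (l2proj (E n) (T u)) by exact: (proj1 (l2proj_le _ lT)).
apply: (l2cvg_dist lq _ lT h2) => [n|]; first exact: (proj1 (compress_bound n lu)).
have h3 := cvg0_scale C (l2cvgE h1).
apply: cvg0_le h3 => [n|]; first exact: l2norm_ge0.
near=> n; have ld := l2B (lp n) lu.
have [l1 n1] := bndT ld; have [l2' n2] := l2proj_le (E n) l1.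
apply: le_trans n1; apply: le_trans n2.
rewrite le_eqVlt; apply/orP; left; apply/eqP; congr l2norm; apply/funext => x.
have -> : (fun x => l2proj (E n) u x - u x) = fun x => (-1) * u x + l2proj (E n) u x.
  by apply/funext => y; rewrite mulN1r addrC.
rewrite linT /compress; set f := T (l2proj _ _); set f' := T u.
rewrite /l2proj; case: ifP => _; last by rewrite subrr.
by rewrite mulN1r addrC.
Unshelve. all: by end_near.
Qed.

Lemma compress_linear_on n : linear_on (E n) (Tn n).
Proof.
split=> [u [lu _]|c u w _ _].
  split; first exact: (proj1 (compress_bound n lu)).
  by move=> x Ex; rewrite /compress /l2proj ifF //; apply/negP => /set_mem.
apply/funext => x; rewrite /compress.
have -> : l2proj (E n) (fun x => c * u x + w x) =
    fun x => c * l2proj (E n) u x + l2proj (E n) w x.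
  by apply/funext => y; rewrite /l2proj; case: ifP => _; rewrite ?mulr0 ?addr0.
by rewrite linT /l2proj; case: ifP => _; rewrite ?mulr0 ?addr0.
Qed.

Hypothesis symT : forall n u w, l2on (E n) u -> l2on (E n) w ->
  inner (Tn n u) w = inner u (Tn n w).
Local Notation Hn z n := (subop (scaleop z id) (Tn n)).

Lemma shifted_linear_on (z : R) n : linear_on (E n) (Hn z n).
Proof.
have [h1 h2] := compress_linear_on n; split=> [u Eu|c u w Eu Ew].
  have [l1 o1] := Eu; have [l2' o2] := h1 _ Eu; split.
    apply: l2B => //; exact: l2Z.
  by move=> x Ex; rewrite /subop /scaleop /= o1 // o2 // mulr0 subr0.
apply/funext => x; rewrite /subop /scaleop h2 //= mulrDr mulrBr opprD [c * (_ * _)]mulrCA.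
by rewrite addrACA.
Qed.

Lemma compress_eigenbasis (z : R) n :
  exists p : ('I_(vcard (E n)) -> vec R V) * ('I_(vcard (E n)) -> R),
    eigenbasis (E n) p.1 p.2 (Hn z n).
Proof.
have [|phi [h [h1 h2 h3 h4]]] := finite_eigenbasis (Efin n) (shifted_linear_on z n).
  move=> u w Eu Ew; have [h1 _] := compress_linear_on n.
  have lTu := proj1 (h1 _ Eu); have lTw := proj1 (h1 _ Ew); have lu := proj1 Eu; have lw := proj1 Ew.
  have e1 v : subop (scaleop z id) (Tn n) v = fun x => (-1) * Tn n v x + toC z * v x.
    by apply/funext => x; rewrite /subop /scaleop mulN1r addrC.
  have lz (v : vec R V) : l2 v -> l2 (fun x => toC z * v x) by exact: l2Z.
  rewrite !e1 inner_linl ?inner_linr //; try exact: lz.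
  rewrite rmorphN1 symT //; congr (_ + _).
  have e0 (v : vec R V) : (fun x => toC z * v x) = fun x => toC z * v x + (fun=> 0) x.
    by apply/funext => x; rewrite addr0.
  have l0 := proj1 (l2_0 R V).
  by rewrite e0 inner_linl // inner0l [in RHS]e0 inner_linr // inner0r conj_toC.
by exists (phi, h); split.
Qed.

Lemma eigenvalue_bound (z C' : R) n N (phi : 'I_N -> vec R V) (h : 'I_N -> R) i :
  eigenbasis (E n) phi h (Hn z n) ->
  (forall u, l2 u -> l2norm (Tn n u) <= C' * l2norm u) -> `|z - h i| <= C'.
Proof.
move=> [[on1 on2] _ h3 _] bnd; have lphi := on1 i.
have n1 : l2norm (phi i) = 1.
  have := inner_self lphi; rewrite on2 eqxx -(rmorph1 toC) => /toC_inj /esym/eqP.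
  by rewrite sqrf_eq1 => /orP[/eqP //|/eqP hm]; have := l2norm_ge0 (phi i); rewrite hm oppr_ge0 ler10.
have e1 : Tn n (phi i) = fun x => toC (z - h i) * phi i x.
  apply/funext => x; have := congr1 (@^~ x) (h3 i); rewrite /subop /scaleop /= => e1.
  by rewrite rmorphB mulrBl -e1 opprB addrC subrK.
by have := bnd _ lphi; rewrite e1 l2normZ // cabs_toC n1 !mulr1.
Qed.

Variables (zn : nat -> R) (z : R).
Hypothesis zcvg : zn @ \oo --> z.
Variables (phi : forall n, 'I_(vcard (E n)) -> vec R V) (h : forall n, 'I_(vcard (E n)) -> R).
Arguments phi : clear implicits.
Arguments h : clear implicits.
Hypothesis basis : forall n, eigenbasis (E n) (phi n) (h n) (Hn (zn n) n).
Hypothesis h_ge0 : \forall n \near \oo, forall i, 0 <= h n i.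

(** [approximable] asks for nonnegative eigenvalues at every n. The truncation at 0 changes only
    finitely many n, so it does not affect the strong limit. *)
Lemma exhaustion_approximable : exists M,
  approximable phi (fun n i => Num.max 0 (h n i)) M (fun u x => toC z * u x - T u x).
Proof.
have [M0 hM0] : exists M0, forall n, `|zn n| <= M0.
  have := cvg_seq_bounded (cvgP _ zcvg) => /= -[M0 [_ hM]].
  by exists (M0 + 1) => n; apply: hM => //; rewrite ltrDl.
have M00 : 0 <= M0 by apply: le_trans (hM0 0%N).
have on n : orthonormal_family (phi n) by case: (basis n).
have hz n i : `|zn n - h n i| <= C.
  by apply: eigenvalue_bound (basis n) _ => u lu; exact: (proj2 (compress_bound n lu)).
exists (M0 + C); split=> //.
- exact: addr_ge0.
- move=> n i; rewrite le_max lexx /= ge_max addr_ge0 //=.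
  have := le_trans (ler_norm _) (hM0 n); have := hz n i; rewrite distrC => /(le_trans (ler_norm _)).
  by lra.
- move=> u lu; apply: (eq_l2cvg (un := fun n => l2proj (E n) u)); last exact: l2proj_cvg.
  move=> n; symmetry; have [b1 b2 b3 b4] := basis n.
  have <- := diag_op1 (basis n) lu.
  by congr lincomb; apply/funext.
move=> u lu; have [lT nT] := bndT lu.
have lK : l2 (fun x => toC z * u x - T u x) by apply: l2B => //; exact: l2Z.
split=> //.
have lp n : l2 (l2proj (E n) u) by exact: (proj1 (l2proj_le _ lu)).
have lTn n : l2 (Tn n u) by exact: (proj1 (compress_bound n lu)).
pose g n : vec R V := fun x => toC (zn n) * l2proj (E n) u x - Tn n u x.
have lg n : l2 (g n) by apply: l2B => //; exact: l2Z.
have hg : l2cvg g (fun x => toC z * u x - T u x).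
  have h1 := l2cvg_lin (toC z) lp lu lTn lT (l2proj_cvg lu) (compress_cvg lu).
  have h2 : l2cvg (fun n x => toC z * l2proj (E n) u x - Tn n u x)
                  (fun x => toC z * u x - T u x).
    have := l2cvg_lin (-1) lTn lT (fun n => l2Z (toC z) (lp n)) (l2Z (toC z) lu)
      (compress_cvg lu) _.
    have h3 := l2cvg_lin (toC z) lp lu (fun=> proj1 (l2_0 R V)) (proj1 (l2_0 R V))
      (l2proj_cvg lu) (l2cvg_cst (proj1 (l2_0 R V))).
    have e3 (v : vec R V) : (fun x => toC z * v x + 0) = fun x => toC z * v x.
      by apply/funext => x; rewrite addr0.
    rewrite e3 in h3; have h4 := eq_l2cvg (fun n => e3 (l2proj (E n) u)) h3.
    move=> /(_ h4) h5.
    have e5 (v w : vec R V) : (fun x => -1 * v x + w x) = fun x => w x - v x.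
      by apply/funext => x; rewrite mulN1r addrC.
    rewrite e5 in h5; exact: (eq_l2cvg (fun n => e5 _ _) h5).
  apply: (l2cvg_dist _ lg lK h2) => [n|]; first by apply: l2B => //; exact: l2Z.
  apply: (@cvg0_le _ _ (fun n => `|zn n - z| * l2norm u)) => [n||]; first exact: l2norm_ge0.
    near=> n; rewrite -cabs_toC.
    have -> : (fun x => g n x - (toC z * l2proj (E n) u x - Tn n u x)) =
        fun x => toC (zn n - z) * l2proj (E n) u x.
      by apply/funext => x; rewrite /g rmorphB mulrBl opprB addrA subrK.
    by rewrite l2normZ // ler_wpM2l ?cabs_ge0 // (proj2 (l2proj_le _ lu)).
  apply: (cvg0_mul (l := l2norm u)); last exact: cvg_cst.
  have := cvg_norm (cvgB zcvg (cvg_cst z)); rewrite subrr normr0; exact.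
have lD n : l2 (diag_op (phi n) (fun i => Num.max 0 (h n i)) id u) by exact: l2_diag_op.
apply: (l2cvg_dist lg lD lK hg).
apply: (@cvg0_le _ _ (fun=> 0)) => [n||]; first exact: l2norm_ge0; last exact: cvg_cst.
near=> n.
have hn : forall i, 0 <= h n i by near: n.
have -> : diag_op (phi n) (fun i => Num.max 0 (h n i)) id u = g n.
  transitivity (diag_op (phi n) (h n) id u).
    by congr lincomb; apply/funext => i; rewrite max_r.
  have lin := shifted_linear_on (zn n) n.
  rewrite -(diag_op_proj (basis n)) -(eigenbasis_diag (basis n) lin); last exact: l2on_proj.
  apply/funext => x; rewrite /subop /scaleop /g /=; congr (_ - _).
  rewrite /compress; congr (l2proj _ (T _) _); apply/funext => y.
  by rewrite /l2proj; case: (y \in E n).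
apply: le_trans (proj2 (l2_0 R V)).
by rewrite le_eqVlt; apply/orP; left; apply/eqP; congr l2norm; apply/funext => x; rewrite subrr.
Unshelve. all: by end_near.
Qed.

End Exhaustion.

Section FullResolvent.
Context (R : realType) (V : choiceType) (N : nat -> nat).
Variables (phi : forall n, 'I_(N n) -> vec R V) (h : forall n, 'I_(N n) -> R).
Variables (M : R) (T : op R V) (z : R).
Arguments phi : clear implicits.
Arguments h : clear implicits.
Implicit Types (u : vec R V).
Local Notation toC := (@toC R).
Local Notation K := (subop (scaleop z id) T).
Hypothesis app : approximable phi h M K.

Lemma resolvent_fc_spec (s : R) u : 0 < s -> l2 u ->
  let L := subop (scaleop (z + s) id) (compress setT T) in
  inv_dom setT L u /\ opinv setT L u = fc phi h (resf s) u.
Proof.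
move=> s0 lu L; have cr := rcont_resf s0.
have lT v : l2 v -> l2on setT v by move=> lv; split=> // x [].
have pT v : l2proj setT v = v.
  by apply/funext => x; rewrite /l2proj ifT //; exact/mem_set.
have cs : rcont (fun t : R => 1 * t + s) := rcont_lin 1 (rcont_id R) (rcont_cst s).
have LE v : l2 v -> L v = fc phi h (fun t => 1 * t + s) v.
  move=> lv; rewrite (fc_linF app _ (rcont_id R) (rcont_cst s) lv) (fc_id app lv).
  have -> : fc phi h (fun=> s) v = fun x => toC s * v x.
    have := fc_linF app s (rcont_cst 1) (rcont_cst 0) lv.
    rewrite (fc_1 app lv) (_ : (fun=> s * 1 + 0) = fun=> s); last first.
      by apply/funext => t; rewrite mulr1 addr0.
    move=> ->; apply/funext => x; rewrite (_ : fc phi h (fun=> 0) v x = 0) ?addr0 //.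
    have := fc_linF app (-1) (rcont_cst 1) (rcont_cst 1) lv.
    rewrite (_ : (fun=> -1 * 1 + 1) = fun=> 0) => [->|]; last first.
      by apply/funext => t; rewrite mulr1 addrC subrr.
    by rewrite rmorphN1 mulN1r addrC subrr.
  apply/funext => x; rewrite /L /subop /scaleop compress_setT rmorph1 mul1r rmorphD mulrDl.
  by rewrite addrAC.
have inv (F G : R -> R) v : rcont F -> rcont G -> l2 v ->
    (forall t, 0 <= t <= M -> F t * G t = 1) -> fc phi h F (fc phi h G v) = v.
  move=> cF cG lv FG; rewrite (fc_mul app cF cG lv) -[RHS](fc_1 app lv).
  exact: (fc_ext app).
have e1 t : 0 <= t <= M -> (1 * t + s) * resf s t = 1.
  move=> /andP[t0 _]; rewrite /resf posE // mul1r mulfV // gt_eqF //.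
  by rewrite ltr_wpDl.
have lf := l2_fc app cr lu.
have h1 : l2on setT (fc phi h (resf s) u) /\ L (fc phi h (resf s) u) = l2proj setT u.
  by split; [exact: lT|rewrite LE // pT; exact: inv].
have dom : inv_dom setT L u.
  exists (fc phi h (resf s) u); split=> // g [[lg _] hg].
  rewrite LE // pT in hg; rewrite -hg; apply: inv => // t tM.
  by rewrite mulrC e1.
by split=> //; case: h1 => h1 h2; exact: inv_dom_unique.
Qed.

Lemma ell_resf_le u (s s' : R) : 0 < s -> s <= s' -> l2 u ->
  ell phi h (resf s') u <= ell phi h (resf s) u.
Proof.
move=> s0 ss lu; apply: (ell_le app) => //.
- by apply: rcont_resf; exact: lt_le_trans ss.
- exact: rcont_resf.
move=> t /andP[t0 _]; rewrite /resf posE // lef_pV2 ?lerD2l ?posrE ?ltr_wpDl //.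
exact: lt_le_trans ss.
Qed.

(** Pointwise, 1/(t + c) - 1/(t + c + s) <= (s / c) / (t + c), and the bound is integrated. *)
Lemma ell_resf_cvg u (c : R) : 0 < c -> l2 u ->
  (fun s => ell phi h (resf (c + s)) u) @ 0^'+ --> ell phi h (resf c) u.
Proof.
move=> c0 lu; have cc := rcont_resf c0.
have C0 : 0 <= ell phi h (resf c) u.
  apply: (ell_ge0 app) => // t /andP[t0 _]; rewrite /resf posE // invr_ge0 addr_ge0 // ltW //.
apply/cvgrPdist_le => eps e0.
have d0 : 0 < c * eps / (ell phi h (resf c) u + 1) by rewrite divr_gt0 ?mulr_gt0 // ltr_wpDl.
near=> s.
have s0 : 0 < s by near: s; exact: nbhs_right_gt.
have hs : s / c * ell phi h (resf c) u <= eps.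
  have : s <= c * eps / (ell phi h (resf c) u + 1) by near: s; exact: (nbhs_right_le d0).
  rewrite ler_pdivlMr ?ltr_wpDl // => h2.
  rewrite mulrAC ler_pdivrMr // [eps * c]mulrC; apply: le_trans h2.
  by rewrite ler_wpM2l ?(ltW s0) // lerDl.
have cs : 0 < c + s by rewrite addr_gt0.
have mono := @ell_resf_le u c (c + s) c0 _ lu.
rewrite ger0_norm; last by rewrite subr_ge0 mono // lerDl ltW.
apply: le_trans hs; rewrite -(ell_scale app) //.
have := ell_lin app (-1) (rcont_resf cs) cc lu; rewrite mulN1r [- _ + _]addrC => <-.
apply: (ell_le app) => //.
- by apply: rcont_lin => //; exact: rcont_resf.
- by apply: rcont_mul => //; exact: rcont_cst.
move=> t /andP[t0 _]; rewrite /resf posE //.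
have tc : 0 < t + c by rewrite ltr_wpDl.
have tcs : 0 < t + (c + s) by rewrite ltr_wpDl.
have -> : -1 * (t + (c + s))^-1 + (t + c)^-1 = s / (t + (c + s)) * (t + c)^-1.
  by field; rewrite !gt_eqF.
rewrite ler_wpM2r ?invr_ge0 ?(ltW tc) // ler_wpM2l ?(ltW s0) // lef_pV2 ?posrE //.
by rewrite addrA [t + c]addrC -addrA lerDl addr_ge0 // ltW.
Unshelve. all: by end_near.
Qed.

End FullResolvent.

Section FiniteExponential.
Context (R : realType) (V : choiceType) (N : nat) (E : set V).
Variables (phi : 'I_N -> vec R V) (h : 'I_N -> R) (K : op R V).
Hypothesis basis : eigenbasis E phi h K.
Hypothesis linK : linear_on E K.
Hypothesis h0 : forall i, 0 <= h i.
Variable K' : op R V.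
Hypothesis KK' : forall u, l2on E u -> K' u = K u.
Local Notation toC := (@toC R).

Lemma has_sum_finite (I : choiceType) (J : Type) (r : seq J) (c : J -> Cplx R)
  (f : J -> I -> Cplx R) (l : J -> Cplx R) : (forall j, has_sum (f j) (l j)) ->
  has_sum (fun i => \sum_(j <- r) c j * f j i) (\sum_(j <- r) c j * l j).
Proof.
move=> hf; elim: r => [|j r IH].
  rewrite big_nil; under eq_fun do rewrite big_nil.
  have := @has_sum_fset R I fset0 (fun=> 0) (fun _ _ => erefl).
  by rewrite big_seq_fset0.
by rewrite big_cons; under eq_fun do rewrite big_cons; exact: has_sum_lin.
Qed.

(** [K'] stands for H_n - mu P_n, which agrees with the diagonalized operator on vectors supported
    in [E]; the iterates never leave that space. *)
Lemma opexp_diag u : l2on E u -> opexp K' u = diag_op phi h (@expR R) u.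
Proof.
move=> uE; have lu := proj1 uE.
have it k : iter k K' u = diag_op phi h (fun t => t ^+ k) u.
  elim: k => [|k IH] /=.
    rewrite (eq_diag_op phi u (G := fun=> 1)); last by move=> i; rewrite expr0.
    by rewrite (diag_op1 basis lu) l2proj_id.
  have gE : l2on E (diag_op phi h (fun t => t ^+ k) u) by exact: (l2on_lincomb basis).
  have [on _ _ _] := basis.
  rewrite IH KK' // (eigenbasis_diag basis linK gE) (diag_op_comp h on) //.
  by apply: eq_diag_op => i; rewrite exprS.
apply/funext => x; rewrite /opexp; apply: usumE.
have -> : (fun k : nat => iter k K' u x / k`!%:R) = fun k : nat =>
    \sum_i (inner u (phi i) * phi i x) * toC (h i ^+ k / k`!%:R).
  apply/funext => k; rewrite it /diag_op /lincomb mulr_suml; apply: eq_bigr => i _.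
  by rewrite rmorphM fmorphV rmorph_nat /=; ring.
have -> : diag_op phi h (@expR R) u x =
    \sum_i (inner u (phi i) * phi i x) * toC (expR (h i)).
  by apply: eq_bigr => i _; rewrite [RHS]mulrC mulrA.
by apply: has_sum_finite => i; exact: exp_has_sum.
Qed.

Lemma opexp_sub1_diag u : l2on E u ->
  subop (opexp K') (l2proj E) u = diag_op phi h (fun t => expR t - 1) u.
Proof.
move=> uE; rewrite /subop opexp_diag // -(diag_op1 basis (proj1 uE)).
apply/funext => x; rewrite /diag_op /lincomb -sumrB; apply: eq_bigr => i _.
by rewrite rmorphB rmorph1 mulrBl mulrBl.
Qed.

End FiniteExponential.

(** * The limit states and the critical density *)

Section GibbsStates.
Context (R : realType) (V : choiceType) (e : rel V) (S : set V) (o : V) (Q : nat) (Y : pgraph).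
Hypothesis hG : homogeneous_tree e setT Q.
Hypothesis hQ : admissible R Y Q.
Hypothesis hS : perturbed_set e Y S o.
Hypothesis hgap : forall q, Y = GQq q -> 2 * Num.sqrt (Q%:R - 1) < normY R e S.
Context (vn : nat -> vec R V).
Hypothesis hvn : forall n, is_pfn e S o n (vn n).
Context (D : R) (mu : nat -> R).
Hypothesis hmu_lt : forall n, mu n < normY R e S - normL R e S o n.
Hypothesis hmu0 : mu @ \oo --> (0 : R).
Hypothesis hmuD : (fun n => (l2norm (vn n) ^+ 2 *
             (normY R e S - normL R e S o n - mu n))^-1) @ \oo --> D.
Implicit Types (x y : V) (u w : vec R V) (n : nat).
Local Notation toC := (@toC R).
Local Notation Z := (normY R e S).
Local Notation lev x := (gdist e x o).
Local Notation B n := (gball e o n).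
Local Notation ln n := (normL R e S o n).
Local Notation s := (Num.sqrt ((Q%:R : R) - 1)).
Local Notation AG := (@adjG R V e).
Local Notation AY := (@adjY R V e S).

Let Q3 : (3 <= Q)%N. Proof. by case: (admissible_nat hQ). Qed.
Let b0 : (0 < sub_b Y)%N. Proof. by case: (admissible_nat hQ). Qed.
Let hdb : sub_d0 Y = sub_b Y \/ sub_d0 Y = (sub_b Y).+1. Proof. by case: (admissible_nat hQ). Qed.
Let bQ : (sub_b Y < Q)%N. Proof. by case: (admissible_nat hQ). Qed.
Let st : s < tcrit R (sub_b Y). Proof. exact: (admissible_le hG hQ hS hgap). Qed.
Let So : S o. Proof. by case: (perturbed_subtree hG hS). Qed.
Let connS : connected_in e S. Proof. by case: (perturbed_subtree hG hS). Qed.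
Let regS : regular_subtree e o S (sub_d0 Y) (sub_b Y).
Proof. by case: (perturbed_subtree hG hS). Qed.

Lemma normYE : Z = lamcrit R (sub_b Y) Q.
Proof. exact: (normY_lamcrit hG So connS regS Q3 b0 hdb bQ st hvn). Qed.

Lemma spectral_gap : 0 < Z - 2 * s.
Proof. by rewrite subr_gt0 normYE lamcrit_gt. Qed.

Definition chem_gap n : R := Z - ln n - mu n.

Lemma chem_gap_gt0 n : 0 < chem_gap n.
Proof. by rewrite subr_gt0. Qed.

Lemma normL_to : (fun n => ln n) @ \oo --> Z.
Proof. by rewrite normYE; exact: (normL_cvg hG So connS regS Q3 b0 hdb bQ st hvn). Qed.

Lemma chem_gap_cvg : chem_gap @ \oo --> (0 : R).
Proof.
rewrite [X in _ --> X](_ : 0 = Z - Z - 0); last by rewrite subrr subr0.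
by apply: cvgB => //; apply: cvgB; [exact: cvg_cst|exact: normL_to].
Qed.

Lemma shift_cvg : (fun n => Z - mu n) @ \oo --> Z.
Proof. by rewrite -[X in _ --> X](subr0 Z); apply: cvgB => //; exact: cvg_cst. Qed.

Lemma vn_norm_ge1 n : 1 <= l2norm (vn n). Proof. exact: (pfn_norm hG (hvn n)). Qed.
Lemma vn_l2 n : l2 (vn n). Proof. exact: (pfn_l2 hG (hvn n)). Qed.
Let vn_gt0 n : 0 < l2norm (vn n). Proof. exact: lt_le_trans (vn_norm_ge1 n). Qed.

(** The divergence of the norms of v_n is read off [hmuD]: |v_n|^-2 is the gap, which tends to 0,
    times a factor tending to D. *)
Lemma vn_norm_inv : (fun n => (l2norm (vn n) ^+ 2)^-1) @ \oo --> (0 : R).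
Proof.
rewrite (_ : (fun n => _) = fun n => chem_gap n *
   (l2norm (vn n) ^+ 2 * (Z - ln n - mu n))^-1).
  exact: (cvg0_mul chem_gap_cvg hmuD).
apply/funext => n; have := chem_gap_gt0 n; rewrite /chem_gap; set d := _ - mu n => d0.
by field; rewrite !gt_eqF.
Qed.

Lemma vn_pf x : (fun n => cabs (vn n x)) @ \oo --> pfr R e o S (sub_d0 Y) (sub_b Y) x.
Proof. exact: (pfn_cvg hG So connS regS Q3 b0 hdb bQ st hvn). Qed.

Lemma ball_exhaustion x : \forall n \near \oo, B n x.
Proof. by exists (lev x). Qed.

Let Bfin n : finite_set (B n). Proof. exact: (ball_finite o hG). Qed.

Lemma setT_tree (F : set V) : tree_op (R := R) e setT F = addop AG (l2proj F).
Proof. by rewrite /tree_op compress_setT. Qed.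

Lemma adjG_tree : AG = tree_op e setT set0.
Proof. by rewrite setT_tree addop_set0. Qed.

Lemma AY_lin (c : Cplx R) u w : AY (fun x => c * u x + w x) = fun x => c * AY u x + AY w x.
Proof. by rewrite adjY_tree_op (tree_op_lin hG). Qed.

Lemma AG_lin (c : Cplx R) u w : AG (fun x => c * u x + w x) = fun x => c * AG u x + AG w x.
Proof. by rewrite adjG_tree (tree_op_lin hG). Qed.

Let out n u : l2on (B n) u -> forall x, x \notin fset_set (B n) -> u x = 0.
Proof. by move=> [_ h] x; rewrite in_fset_set // notin_setE => /h. Qed.

Lemma AY_sym n u w : l2on (B n) u -> l2on (B n) w ->
  inner (compress (B n) AY u) w = inner u (compress (B n) AY w).
Proof. by move=> hu hw; apply: (tree_op_sym hG (B n) S (out hu) (out hw)). Qed.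

Lemma AG_sym n u w : l2on (B n) u -> l2on (B n) w ->
  inner (compress (B n) AG u) w = inner u (compress (B n) AG w).
Proof.
by move=> hu hw; have := tree_op_sym hG (B n) set0 (out hu) (out hw); rewrite /tree_op addop_set0.
Qed.

Lemma normY_ge0 : 0 <= Z. Proof. exact: opnorm_ge0. Qed.

Lemma AY_bound u : l2 u -> l2 (AY u) /\ l2norm (AY u) <= Z * l2norm u.
Proof.
move=> lu; split; first exact: (proj1 (adjY_bound hG So connS regS Q3 b0 hdb lu)).
exact: (adjY_le_normY hG So connS regS Q3 b0 hdb lu).
Qed.

Lemma AG_bound u : l2 u -> l2 (AG u) /\ l2norm (AG u) <= 2 * s * l2norm u.
Proof. by move=> lu; rewrite adjG_tree; exact: (adjG_schur o hG setT Q3). Qed.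

Let s20 : 0 <= 2 * s. Proof. by rewrite mulr_ge0 // sqrtr_ge0. Qed.

Lemma adjL_bound n u : l2 u -> l2norm (adjL e S o n u) <= ln n * l2norm u.
Proof.
move=> lu; apply: (le_opnorm normY_ge0) => // [w lw|c w].
  exact: (@compress_bound R V (gball e o) AY Z normY_ge0 AY_bound n w lw).
by have := tree_op_scale hG (B n) S c w.
Qed.

Let dataY n := cid (compress_eigenbasis Bfin AY_lin normY_ge0 AY_bound AY_sym (Z - mu n) n).
Definition phiY n := (sval (dataY n)).1.
Definition hY n := (sval (dataY n)).2.
Arguments phiY : clear implicits.
Arguments hY : clear implicits.

Lemma basisY n :
  eigenbasis (B n) (phiY n) (hY n) (subop (scaleop (Z - mu n) id) (adjL e S o n)).
Proof. exact: (svalP (dataY n)). Qed.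

Lemma hY_ge n i : chem_gap n <= hY n i.
Proof.
have := eigenvalue_bound i (basisY n) (@adjL_bound n).
by move=> /(le_trans (ler_norm _)); rewrite /chem_gap; lra.
Qed.

Lemma hY_gt0 n i : 0 < hY n i.
Proof. exact: lt_le_trans (chem_gap_gt0 n) (hY_ge i). Qed.

(** Half of the distance from Z to 2 s: one half is spent on the shift, and the other absorbs [mu n]
    in [kG_ge0]. *)
Definition gapG : R := (Z - 2 * s) / 2.

Lemma gapG_gt0 : 0 < gapG. Proof. by rewrite divr_gt0 // spectral_gap. Qed.

(* The eigenvalues of [Z - mu n - gapG - A_G] on [B n] are nonnegative only for
   large [n]; truncating them at 0 makes the family approximable, and turns the
   resolvent of [A_G] at [Z] into that of the shifted operator at [gapG > 0]. *)
Let dataG n := cid (compress_eigenbasis Bfin AG_lin s20 AG_bound AG_sym (Z - mu n - gapG) n).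
Definition phiG n := (sval (dataG n)).1.
Definition kG n := (sval (dataG n)).2.
Arguments phiG : clear implicits.
Arguments kG : clear implicits.
Definition kGp n i := Num.max 0 (kG n i).
Arguments kGp : clear implicits.

Lemma basisG n :
  eigenbasis (B n) (phiG n) (kG n) (subop (scaleop (Z - mu n - gapG) id) (compress (B n) AG)).
Proof. exact: (svalP (dataG n)). Qed.

Lemma kG_ge0 : \forall n \near \oo, forall i, 0 <= kG n i.
Proof.
near=> n => i.
have := eigenvalue_bound i (basisG n) 
  (fun u lu => proj2 (@compress_bound R V (gball e o) AG _ s20 AG_bound n u lu)).
move=> /(le_trans (ler_norm _)) h.
have : mu n <= gapG.
  near: n; have [n0 _ hn] := (cvgr0Pnorm_le _).1 hmu0 _ gapG_gt0.
  by exists n0 => // n /hn; exact: le_trans (ler_norm _).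
by move: h; rewrite /gapG; lra.
Unshelve. all: by end_near.
Qed.

Lemma approximable_Y : exists M, approximable phiY hY M (Ham e S).
Proof.
have h0 : \forall n \near \oo, forall i, 0 <= hY n i.
  by near=> n => i; exact/ltW/hY_gt0.
have [M hM] := exhaustion_approximable ball_exhaustion AY_lin normY_ge0 AY_bound
  shift_cvg basisY h0.
exists M; rewrite (_ : hY = fun n i => Num.max 0 (hY n i)); first exact: hM.
apply: functional_extensionality_dep => n; apply/funext => i.
by rewrite max_r // ltW // hY_gt0.
Unshelve. all: by end_near.
Qed.

Lemma approximable_G : exists M,
  approximable phiG kGp M (subop (scaleop (Z - gapG) id) AG).
Proof.
have h : (fun n => Z - mu n - gapG) @ \oo --> Z - gapG.
  by apply: cvgB; [exact: shift_cvg|exact: cvg_cst].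
have [M hM] := exhaustion_approximable ball_exhaustion AG_lin s20 AG_bound
  h basisG kG_ge0.
by exists M.
Qed.

Local Notation ellY := (ell phiY hY).
Local Notation ellG := (ell phiG kGp).

Lemma shiftedY_diag n u : l2on (B n) u ->
  subop (scaleop (Z - mu n) id) (adjL e S o n) u = diag_op (phiY n) (hY n) id u.
Proof.
apply: (eigenbasis_diag (basisY n)).
exact: (@shifted_linear_on R V (gball e o) AY AY_lin Z normY_ge0 AY_bound).
Qed.

Lemma shiftedG_diag n u : l2on (B n) u ->
  subop (scaleop (Z - mu n) id) (compress (B n) AG) u =
  diag_op (phiG n) (kG n) (fun t => t + gapG) u.
Proof.
move=> uE.
have lin := @shifted_linear_on R V (gball e o) AG AG_lin _ s20 AG_bound (Z - mu n - gapG) n.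
have h1 := eigenbasis_diag (basisG n) lin uE.
have h2 := diag_op1 (basisG n) (proj1 uE); rewrite l2proj_id // in h2.
transitivity (fun x => subop (scaleop (Z - mu n - gapG) id) (compress (B n) AG) u x + toC gapG * u x).
  apply/funext => x; rewrite /subop /scaleop /= [toC (_ - gapG)]rmorphB mulrBl addrAC subrK //.
rewrite h1; apply/funext => x.
have h2x : diag_op (phiG n) (kG n) (fun=> 1) u x = u x by rewrite h2.
rewrite -[X in _ + _ * X]h2x /diag_op /lincomb mulr_sumr -big_split /=.
by apply: eq_bigr => i _; rewrite rmorphD rmorph1; ring.
Qed.

Lemma inner_diff u v w : l2 u -> l2 v -> l2 w ->
  inner (fun x => v x - w x) u = inner v u - inner w u.
Proof.
move=> lu lv lw; rewrite (_ : (fun x => v x - w x) = fun x => (-1) * w x + v x).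
  by rewrite inner_linl // mulN1r addrC.
by apply/funext => x; rewrite mulN1r addrC.
Qed.

Lemma krein_ball n u : l2 u -> (forall i, 0 <= kG n i) ->
  inner (krein e S (B n) (Z - mu n) u) u =
  toC (\sum_i (hY n i)^-1 * cabs (inner u (phiY n i)) ^+ 2 -
       \sum_i (kG n i + gapG)^-1 * cabs (inner u (phiG n i)) ^+ 2).
Proof.
move=> lu kG0; have onY : orthonormal_family (phiY n) by case: (basisY n).
have onG : orthonormal_family (phiG n) by case: (basisG n).
have nzY i : id (hY n i) != 0 by rewrite gt_eqF // hY_gt0.
have nzG i : kG n i + gapG != 0 by rewrite gt_eqF // ltr_wpDl // gapG_gt0.
have sY v : l2 v -> inv_dom (B n) (subop (scaleop (Z - mu n) id) (adjL e S o n)) v.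
  exact: (inv_dom_diag (basisY n) (@shiftedY_diag n) nzY).
have sG v : l2 v -> inv_dom (B n) (subop (scaleop (Z - mu n) id) (compress (B n) AG)) v.
  exact: (inv_dom_diag (basisG n) (@shiftedG_diag n) nzG).
rewrite (krein_resolvent AG_lin sG sY lu) /resolvent.
have eY := opinv_diag (basisY n) (@shiftedY_diag n) nzY lu.
have eG := opinv_diag (basisG n) (@shiftedG_diag n) nzG lu.
rewrite /adjL in eY; rewrite eY eG inner_diff //; try exact: l2_diag_op.
by rewrite !inner_diag_op_self // rmorphB.
Qed.

(** The resolvent of A_G at Z + r is the function [resf (gapG + r)] of the operator Z - gapG -
    A_G. *)
Lemma krein_full (r : R) u : 0 < r -> l2 u ->
  inner (krein e S setT (Z + r) u) u = toC (ellY (resf r) u - ellG (resf (gapG + r)) u).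
Proof.
move=> r0 lu; have [MY aY] := approximable_Y; have [MG aG] := approximable_G.
have g0 := gapG_gt0; have gr : 0 < gapG + r by rewrite addr_gt0.
have eZ : Z + r = Z - gapG + (gapG + r) by rewrite addrA subrK.
rewrite (krein_resolvent AG_lin) //; first last.
- by move=> v lv; have [] := resolvent_fc_spec aY r0 lv.
- by move=> v lv; rewrite eZ; have [] := resolvent_fc_spec aG gr lv.
have [_ eY] := resolvent_fc_spec aY r0 lu; have [_ eG] := resolvent_fc_spec aG gr lu.
rewrite -eZ in eG; rewrite /resolvent eG.
rewrite (_ : addop AG (l2proj S) = AY) // eY.
have cY := rcont_resf r0; have cG := rcont_resf gr.
rewrite inner_diff //; [|exact: (l2_fc aY)|exact: (l2_fc aG)].
by rewrite (inner_fc aY) // (inner_fc aG) // rmorphB.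
Qed.

Lemma at_right_shift (c : R) : (fun r => c + r) @ 0^'+ --> c^'+.
Proof.
move=> P [eps /= e0 he]; exists eps => //= r; rewrite /= sub0r normrN => hr r0.
by apply: he; rewrite /= ?ltrDl // opprD addrA subrr sub0r normrN.
Qed.

Section Vertex.
Variable x : V.
Local Notation dx := (delta R x).
Local Notation un n := (Qproj e o n (vn n) dx).
Hypothesis hk : exists L : Cplx R,
     (fun z : R => inner (krein e S setT z dx) dx) @ Z^'+ --> L /\
     (fun n : nat => let u := Qproj e o n (vn n) dx in
        inner (krein e S (B n) (Z - mu n) u) u) @ \oo --> L.

Let ldx : l2 dx. Proof. exact: l2_delta. Qed.

Lemma proj_delta n : (lev x <= n)%N -> l2proj (B n) dx = dx.
Proof.
move=> lx; apply: l2proj_id; split=> // y By; apply: delta_out; rewrite inE.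
by apply/eqP => yx; apply: By; rewrite yx.
Qed.

Lemma inner_delta_vn n : inner dx (vn n) = toC (cabs (vn n x)).
Proof. by rewrite inner_deltal {1}(pfn_toC (hvn n)) conj_toC. Qed.

Definition pf_coef n : R := cabs (vn n x) / l2norm (vn n) ^+ 2.

Lemma Qproj_delta n : (lev x <= n)%N -> un n = fun y => dx y - toC (pf_coef n) * vn n y.
Proof.
move=> lx; apply/funext => y; rewrite /Qproj proj_delta // inner_delta_vn.
by rewrite /pf_coef [in RHS]rmorphM [in RHS]fmorphV.
Qed.

Lemma l2_Qproj n : l2 (un n).
Proof.
apply: l2B; first exact: (proj1 (l2proj_le _ ldx)).
by apply: l2Z; exact: vn_l2.
Qed.

(** The removed component along v_n has norm v_n(x) / |v_n|, where the numerator converges and the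
    denominator diverges. *)
Lemma Qproj_cvg : l2cvg (fun n => un n) dx.
Proof.
have h1 : (fun n => cabs (vn n x) * ((l2norm (vn n) ^+ 2)^-1 * l2norm (vn n))) @ \oo --> (0 : R).
  have h2 : (fun n => (l2norm (vn n))^-1) @ \oo --> (0 : R).
    have h : (fun n => Num.sqrt ((l2norm (vn n) ^+ 2)^-1)) @ \oo --> (0 : R).
      rewrite -[X in _ --> X](sqrtr0 R).
      by apply: continuous_cvg; [exact: sqrt_continuous|exact: vn_norm_inv].
     apply: cvg_trans h; apply: near_eq_cvg; near=> n.
    by rewrite /= sqrtrV ?sqr_ge0 // sqrtr_sqr ger0_norm // ltW // vn_gt0.
  have h3 := cvg0_mul h2 (@vn_pf x).
  apply: cvg_trans h3; apply: near_eq_cvg; near=> n.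
  by rewrite mulrC; congr (_ * _); rewrite expr2 invfM mulfVK // gt_eqF // vn_gt0.
split; apply: cvg0_le h1 => [n|]; first exact: l2norm_ge0.
near=> n; have lx : (lev x <= n)%N by near: n; exists (lev x).
rewrite Qproj_delta //; have lv := vn_l2 n.
rewrite (_ : (fun y => _) = fun y => toC (- pf_coef n) * vn n y); last first.
  by apply/funext => y; rewrite addrAC subrr add0r rmorphN mulNr.
rewrite l2normZ // cabs_toC normrN /pf_coef ger0_norm ?mulrA //.
by rewrite divr_ge0 ?cabs_ge0 ?sqr_ge0.
Unshelve. all: by end_near.
Qed.

Lemma Re_cvg (T : Type) (F : set_system T) {FF : ProperFilter F} (f : T -> R) (L : Cplx R) :
  (fun t => toC (f t)) @ F --> L -> f @ F --> (complex.Re (L : R[i]) : R).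
Proof.
move=> h; apply/cvgrPdist_le => eps e0.
have e1 : 0 < toC eps by rewrite -(rmorph0 toC) ltr_toC.
move/cvgrPdist_le: h => /(_ _ e1); apply: filterS => t.
rewrite -cabsE ler_toC; apply: le_trans.
have := normr_Re_le (L - toC (f t)).
by rewrite (_ : complex.Re (L - toC (f t) : R[i]) = complex.Re (L : R[i]) - f t) //; case: (L).
Qed.

(* The difference of the two Krein quantities is the resolvent of [A_Y] minus that
   of [A_G], and the latter converges because of the spectral gap. *)
Lemma resolvent_limit : exists G, [/\ forall r, 0 < r -> ellY (resf r) dx <= G,
    forall eps, 0 < eps -> exists r, 0 < r <= 1 /\ G - eps <= ellY (resf r) dx
  & (fun n => \sum_i (hY n i)^-1 * cabs (inner (un n) (phiY n i)) ^+ 2) @ \oo --> G].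
Proof.
have [MY aY] := approximable_Y; have [MG aG] := approximable_G.
have [L [hL1 hL2]] := hk; have g0 := gapG_gt0.
have h1 : (fun r => ellY (resf r) dx - ellG (resf (gapG + r)) dx) @ 0^'+ -->
    (complex.Re (L : R[i]) : R).
  apply: Re_cvg.
  have h : (fun r : R => inner (krein e S setT (Z + r) dx) dx) @ 0^'+ --> L.
    exact: (cvg_comp _ _ (@at_right_shift Z) hL1).
  apply: cvg_trans h; apply: near_eq_cvg; near=> r; rewrite krein_full //.
pose G := complex.Re (L : R[i]) + ellG (resf gapG) dx.
have h2 : (fun r => ellY (resf r) dx) @ 0^'+ --> G.
  rewrite (_ : (fun r => _) = fun r => (ellY (resf r) dx - ellG (resf (gapG + r)) dx) +
     ellG (resf (gapG + r)) dx); last by apply/funext => r; rewrite subrK.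
  by apply: cvgD => //; exact: (ell_resf_cvg aG).
exists G; split.
(* The form increases as the shift decreases, so its limit at 0 from the right is an upper bound. *)
- move=> r r0; apply/ler_addgt0Pr => eps e0; move/cvgrPdist_le: (h2) => /(_ _ e0) h3.
  have : \forall t \near (0 : R)^'+, ellY (resf r) dx <= G + eps.
    near=> t; have t0 : 0 < t by near: t; exact: nbhs_right_gt.
    have tr : t <= r by near: t; exact: nbhs_right_le r0.
    have : `|G - ellY (resf t) dx| <= eps by near: t.
    have := ell_resf_le aY t0 tr ldx.
    by rewrite distrC => h4 /(le_trans (ler_norm _)); lra.
  by case/filter_ex.
- move=> eps e0; move/cvgrPdist_le: (h2) => /(_ _ e0) h3.
  have : \forall r \near (0 : R)^'+, 0 < r <= 1 /\ G - eps <= ellY (resf r) dx.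
    near=> r; split.
      by apply/andP; split; near: r; [exact: nbhs_right_gt|exact: (nbhs_right_le ltr01)].
    have : `|G - ellY (resf r) dx| <= eps by near: r.
    by move=> /(le_trans (ler_norm _)); lra.
  by move=> /filter_ex.
(* The ball side of the hypothesis has the same limit [L]; adding back the convergent part from A_G
   gives the same [G]. *)
have h3 : (fun n => \sum_i (hY n i)^-1 * cabs (inner (un n) (phiY n i)) ^+ 2 -
    \sum_i resf gapG (kGp n i) * cabs (inner (un n) (phiG n i)) ^+ 2) @ \oo -->
    (complex.Re (L : R[i]) : R).
  apply: Re_cvg; apply: cvg_trans hL2; apply: near_eq_cvg; near=> n.
  have hn : forall i, 0 <= kG n i by near: n; exact: kG_ge0.
  rewrite /= krein_ball //; last exact: l2_Qproj.
  congr (toC (_ - _)); apply: eq_bigr => i _; rewrite /kGp max_r // /resf posE //.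
have h4 := ell_cvg aG (rcont_resf g0) l2_Qproj ldx Qproj_cvg.
rewrite (_ : (fun n => _) = fun n => (\sum_i (hY n i)^-1 * cabs (inner (un n) (phiY n i)) ^+ 2 -
    \sum_i resf gapG (kGp n i) * cabs (inner (un n) (phiG n i)) ^+ 2) +
    \sum_i resf gapG (kGp n i) * cabs (inner (un n) (phiG n i)) ^+ 2); last first.
  by apply/funext => n; rewrite subrK.
exact: cvgD.
Unshelve. all: by end_near.
Qed.

Lemma Hamn_shift n u : l2on (B n) u ->
  subop (Hamn e S o n) (scaleop (mu n) (l2proj (B n))) u =
  subop (scaleop (Z - mu n) id) (adjL e S o n) u.
Proof.
move=> uE; have [_ u0] := uE; apply/funext => y.
rewrite /subop /Hamn /adjL /Ham /compress (l2proj_id uE) /scaleop (l2proj_id uE) /= /l2proj.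
case: ifPn => [_|]; first by rewrite /subop /scaleop /= rmorphB mulrBl addrAC.
by rewrite notin_setE => /u0 ->; rewrite !mulr0 subr0.
Qed.

Lemma bose_diag n u : l2 u -> bose e S o n (mu n) u =
  diag_op (phiY n) (hY n) (fun t => (expR t - 1)^-1) u.
Proof.
move=> lu; apply: (opinv_diag (basisY n) (F := fun t => expR t - 1)) => // [w wE|i].
  apply: (opexp_sub1_diag (basisY n)) => //; last exact: Hamn_shift.
    exact: (@shifted_linear_on R V (gball e o) AY AY_lin Z normY_ge0 AY_bound).
  by move=> i; exact/ltW/hY_gt0.
by rewrite gt_eqF // subr_gt0 expR_gt1 hY_gt0.
Qed.

Lemma vn_l2on n : l2on (B n) (vn n).
Proof. by split; [exact: vn_l2|case: (hvn n)]. Qed.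

Lemma diag_vn n (F : R -> R) :
  diag_op (phiY n) (hY n) F (vn n) = fun y => toC (F (chem_gap n)) * vn n y.
Proof.
apply: (diag_op_eigen (basisY n)); first exact: vn_l2on.
rewrite -shiftedY_diag; last exact: vn_l2on.
have [_ _ hv _] := hvn n; apply/funext => y; rewrite /subop hv /scaleop /= -mulrBl -rmorphB.
by rewrite /chem_gap addrAC.
Qed.

Lemma inner_delta_pf n : inner dx (vn n) = toC (pf_coef n) * inner (vn n) (vn n).
Proof.
have lv := vn_l2 n; rewrite inner_delta_vn inner_self // -rmorphM /pf_coef divfK //.
by rewrite gt_eqF // exprn_gt0 // vn_gt0.
Qed.

(** The cross terms vanish because v_n is an eigenvector orthogonal to Q_n delta_x. The second term
    is factored into a ratio tending to 1 and the quantity that tends to D. *)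
Lemma omegan_split n : (lev x <= n)%N -> omegan e S o n (mu n) dx dx =
  toC (\sum_i (expR (hY n i) - 1)^-1 * cabs (inner (un n) (phiY n i)) ^+ 2 +
       cabs (vn n x) ^+ 2 * ((chem_gap n / (expR (chem_gap n) - 1)) *
         (l2norm (vn n) ^+ 2 * chem_gap n)^-1)).
Proof.
move=> lx; rewrite /omegan bose_diag //.
pose F (t : R) := (expR t - 1)^-1; rewrite -/F.
have lv := vn_l2 n; have lu := l2_Qproj n; have on : orthonormal_family (phiY n) by case: (basisY n).
have lD w : l2 (diag_op (phiY n) (hY n) F w) by exact: l2_diag_op.
set c := toC (pf_coef n); have dE : dx = fun y => c * vn n y + un n y.
  by apply/funext => y; rewrite Qproj_delta // addrC subrK.
have uv : inner (un n) (vn n) = 0.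
  have := inner_delta_pf n; rewrite {1}dE inner_linl // -/c => /eqP.
  by rewrite -subr_eq0 addrAC subrr add0r => /eqP.
have vu : inner (vn n) (un n) = 0 by rewrite inner_conj // uv conjC0.
move: dE uv vu lu; set w := un n => dE uv vu lu.
rewrite dE (diag_op_lin _ on) // diag_vn.
rewrite inner_linl //; [|exact: l2Z|by rewrite -dE].
have e0 : (fun y => toC (F (chem_gap n)) * vn n y) =
    fun y => toC (F (chem_gap n)) * vn n y + (fun=> 0) y.
  by apply/funext => y; rewrite addr0.
have l0 := proj1 (l2_0 R V).
have lcu : l2 (fun x0 => c * vn n x0 + un n x0) by rewrite -dE.
rewrite {1}e0 (inner_linl _ lv l0 lcu) inner0l addr0 !inner_linr // vu addr0.
rewrite inner_diag_op_self //.
have -> : inner (diag_op (phiY n) (hY n) F (un n)) (vn n) = 0.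
  by rewrite diag_op_sym // diag_vn e0 inner_linr // uv mulr0 add0r inner0r.
rewrite mulr0 add0r addrC rmorphD; congr (_ + _).
rewrite inner_self // conj_toC -!rmorphM; congr toC.
have c0 := chem_gap_gt0 n.
have d0 : 0 < expR (chem_gap n) - 1 by rewrite subr_gt0 expR_gt1.
rewrite /pf_coef /F; field; rewrite !gt_eqF //; exact: vn_gt0.
Qed.

(** Squeezed by e^(-t) <= t / (e^t - 1) <= 1. *)
Lemma bose_ratio_cvg : (fun n => chem_gap n / (expR (chem_gap n) - 1)) @ \oo --> (1 : R).
Proof.
have h : (fun n => expR (- chem_gap n)) @ \oo --> (1 : R).
  rewrite -[X in _ --> X]expR0 -oppr0.
  apply: continuous_cvg; [exact: continuous_expR|by apply: cvgN; exact: chem_gap_cvg].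
apply: (squeeze_cvgr _ h (cvg_cst (1 : R))); near=> n.
have c0 := chem_gap_gt0 n; set t := chem_gap n in c0 *.
have d0 : 0 < expR t - 1 by rewrite subr_gt0 expR_gt1.
rewrite ler_pdivlMr // ler_pdivrMr // mul1r expm1_ge andbT.
have h1 := expR_diff (ltW c0); rewrite expR0 subr0 in h1.
rewrite expRN mulrC ler_pdivrMr ?expR_gt0 //.
Unshelve. all: by end_near.
Qed.

Lemma omegan_cvg : (fun n => omegan e S o n (mu n) dx dx) @ \oo -->
  toC (bose_value phiY hY dx + pfr R e o S (sub_d0 Y) (sub_b Y) x ^+ 2 * D).
Proof.
have [M app] := approximable_Y; have [G [r1 r2 r3]] := resolvent_limit.
have h1 := bose_quadratic_form app ldx r1 r2 l2_Qproj Qproj_cvg hY_gt0 r3.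
have h2 : (fun n => cabs (vn n x) ^+ 2 * ((chem_gap n / (expR (chem_gap n) - 1)) *
    (l2norm (vn n) ^+ 2 * chem_gap n)^-1)) @ \oo -->
    pfr R e o S (sub_d0 Y) (sub_b Y) x ^+ 2 * (1 * D).
  apply: cvgM; last by apply: cvgM; [exact: bose_ratio_cvg|exact: hmuD].
  by rewrite expr2; under eq_fun do rewrite expr2; apply: cvgM; exact: (@vn_pf x).
rewrite mul1r in h2; set c := bose_value _ _ _ + _.
have h3 : (fun n => `|(\sum_i (expR (hY n i) - 1)^-1 * cabs (inner (un n) (phiY n i)) ^+ 2 +
    cabs (vn n x) ^+ 2 * ((chem_gap n / (expR (chem_gap n) - 1)) *
    (l2norm (vn n) ^+ 2 * chem_gap n)^-1)) - c|) @ \oo --> (0 : R).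
  rewrite [X in _ --> X](_ : 0 = `|c - c|); last by rewrite subrr normr0.
  by apply: cvg_norm; apply: cvgB; [exact: cvgD|exact: cvg_cst].
apply: ccvg_cvg; split; apply: cvg_trans h3; apply: near_eq_cvg; near=> n.
rewrite omegan_split; last by near: n; exists (lev x).
by rewrite -rmorphB cabs_toC.
Unshelve. all: by end_near.
Qed.

Lemma vertex_bose_vector (Bs : op R V) : positive_op Bs ->
  (forall w, l2 w -> Bs (Bs w) = fun y => opexp (Ham e S) w y - w y) ->
  exists psi, [/\ l2 psi, Bs psi = dx & l2norm psi ^+ 2 = bose_value phiY hY dx].
Proof.
move=> posB sqB; have [M app] := approximable_Y; have [G [r1 _ _]] := resolvent_limit.
exact: (bose_vector app ldx r1 posB sqB).
Qed.

End Vertex.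

Hypothesis hkrein : forall x : V, exists L : Cplx R,
     (fun z : R => inner (krein e S setT z (delta R x)) (delta R x)) @ Z^'+ --> L /\
     (fun n : nat => let u := Qproj e o n (vn n) (delta R x) in
        inner (krein e S (B n) (Z - mu n) u) u) @ \oo --> L.

Lemma sqrt_boseHP : positive_op (sqrt_boseH (R := R) e S) /\
  forall w, l2 w -> sqrt_boseH e S (sqrt_boseH e S w) = fun y => opexp (Ham e S) w y - w y.
Proof.
have [M app] := approximable_Y.
pose P := [set Bs : op R V | positive_op Bs /\ forall u, l2 u ->
   Bs (Bs u) = subop (opexp (Ham e S)) id u].
have : P (xget (id : vec R V -> vec R V) P) by
  apply: xgetPex; exists (sqrt_bose phiY hY); split;
    [exact: (sqrt_bose_positive app)|exact: (sqrt_bose_sq app)].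
by [].
Qed.

(** For injectivity: if B w = 0, then w(y) = <w, delta_y> = <w, B psi_y> = <B w, psi_y> = 0 for
    every y, so all the vectors [delta y] are needed in the range at once. *)
Lemma sqrt_boseH_inv x : exists psi : vec R V, [/\ l2 psi,
  forall g, l2on setT g /\ sqrt_boseH e S g = l2proj setT (delta R x) <-> g = psi
  & l2norm psi ^+ 2 = bose_value phiY hY (delta R x)].
Proof.
have [posB sqB] := sqrt_boseHP.
have pre y := vertex_bose_vector (@hkrein y) posB sqB.
have pT v : l2proj setT v = v :> vec R V.
  by apply/funext => y; rewrite /l2proj ifT //; exact/mem_set.
have [psi [l1 h1 n1]] := pre x; exists psi; split=> // g; rewrite pT; split; last first.
  by move=> ->; split=> //; split=> // ? [].
move=> [[lg _] hg]; apply/funext => y; apply/eqP; rewrite -subr_eq0; apply/eqP.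
pose w y := g y - psi y; rewrite -/(w y).
have lw : l2 w by exact: l2B.
have wE : w = fun y => (-1) * psi y + g y by apply/funext => z; rewrite mulN1r addrC.
have Bw : sqrt_boseH e S w = fun=> 0.
  by rewrite wE (positive_op_lin posB) // hg h1; apply/funext => z; rewrite mulN1r addrC subrr.
have [psiy [ly hy _]] := pre y.
rewrite -(inner_delta w) -hy -(positive_op_sym posB lw ly) Bw.
exact: inner0l.
Qed.

Lemma gibbs_limit x : inv_dom setT (sqrt_boseH e S) (delta R x) /\
  (fun n => omegan e S o n (mu n) (delta R x) (delta R x)) @ \oo -->
    omegaD e S D (pf R e S o Y Q) (delta R x) (delta R x).
Proof.
have [psi [lpsi hpsi npsi]] := sqrt_boseH_inv x.
have dom : inv_dom setT (sqrt_boseH e S) (delta R x).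
  by exists psi; split=> [|g /hpsi //]; exact/hpsi.
split=> //.
have -> : omegaD e S D (pf R e S o Y Q) (delta R x) (delta R x) =
  toC (bose_value phiY hY (delta R x) + pfr R e o S (sub_d0 Y) (sub_b Y) x ^+ 2 * D).
  rewrite /omegaD; have /hpsi -> := opinvP dom.
  rewrite inner_self // npsi inner_deltal inner_delta.
  rewrite (pf_pfr hG hQ hS normYE st) conj_toC -!rmorphM -rmorphD; congr (toC (_ + _)).
  by ring.
exact: (omegan_cvg (@hkrein x)).
Qed.

(** * Traces, low eigenvalues and the density *)

Local Notation cardB n := ((vcard (B n))%:R : R).
Local Notation cardS n := ((vcard (S `&` B n))%:R : R).
Local Notation gam := (Z - 2 * s).

Lemma cardB_gt0 n : 0 < cardB n.
Proof.
rewrite ltr0n cardfs_gt0; apply/fset0Pn; exists o; rewrite in_fset_set //.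
by apply/mem_set; rewrite /gball /= (gdist_refl e).
Qed.

Lemma phiY_norm n i : \sum_(x <- fset_set (B n)) cabs (phiY n i x) ^+ 2 = 1.
Proof.
have [[_ on] phiE _ _] := basisY n.
have := inner_self (proj1 (phiE i)); rewrite on eqxx -(rmorph1 toC) => /toC_inj ->.
by rewrite (proj2 (l2_fin (out (phiE i)))).
Qed.

Lemma trace_diag n T F :
  (forall x, B n x -> T (delta R x) = diag_op (phiY n) (hY n) F (delta R x)) ->
  trace (B n) T = toC (\sum_i F (hY n i)).
Proof.
move=> hT; rewrite /trace fsbig_finite //=.
transitivity (\sum_(x <- fset_set (B n)) \sum_i toC (F (hY n i)) * toC (cabs (phiY n i x) ^+ 2)).
  rewrite big_seq [RHS]big_seq; apply: eq_bigr => x; rewrite in_fset_set // => /set_mem xB.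
  rewrite hT //; apply: eq_bigr => i _.
  by rewrite inner_deltal cabs_sqr -mulrA [(_)^* * _]mulrC.
rewrite exchange_big raddf_sum; apply: eq_bigr => i _.
by rewrite -mulr_sumr -raddf_sum phiY_norm /= rmorph1 mulr1.
Qed.

Lemma trace_bose n : density e S o n (mu n) = (\sum_i (expR (hY n i) - 1)^-1) / cardB n.
Proof.
rewrite /density; congr (_ / _).
have -> : trace (B n) (bose e S o n (mu n)) = toC (\sum_i (expR (hY n i) - 1)^-1).
  apply: (trace_diag (F := fun t => (expR t - 1)^-1)) => x _.
  exact: (bose_diag n (l2_delta R x)).
by [].
Qed.

Lemma Hamn_eigen n u : l2on (B n) u -> Hamn e S o n u =
  fun y => diag_op (phiY n) (hY n) id u y + toC (mu n) * u y.
Proof.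
move=> uE; rewrite -shiftedY_diag // -Hamn_shift //; apply/funext => y.
by rewrite /subop /scaleop (l2proj_id uE) subrK.
Qed.

(** The eigenbasis diagonalizes H_n - mu_n, hence the argument t + mu n. Any operator meeting the
    specification of [funcalc] is determined by its values on this basis. *)
Lemma funcalc_diag n f x : B n x -> funcalc (B n) (Hamn e S o n) f (delta R x) =
  diag_op (phiY n) (hY n) (fun t => f (t + mu n)) (delta R x).
Proof.
move=> xB; have [on phiE eig comp] := basisY n.
pose P := [set F : op R V | linear_on (B n) F /\ forall (h : R) u, l2on (B n) u ->
  Hamn e S o n u = scaleop h id u -> F u = scaleop (f h) id u].
have : P (xget (id : vec R V -> vec R V) P).
  apply: xgetPex; exists (diag_op (phiY n) (hY n) (fun t => f (t + mu n))); split.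
    split=> [u uE|c u w [lu _] [lw _]]; first exact: (l2on_lincomb (basisY n)).
    exact: (diag_op_lin _ on).
  move=> h u uE; rewrite Hamn_eigen // => hu.
  rewrite (@diag_op_eigen _ _ _ _ _ _ _ (basisY n) (h - mu n)) //.
    by apply/funext => y; rewrite subrK.
  apply/funext => y; have := congr1 (@^~ y) hu; rewrite /scaleop /= rmorphB mulrBl => <-.
  by rewrite addrK.
rewrite -/(funcalc (B n) (Hamn e S o n) f) => -[lin eigF].
have dE : l2on (B n) (delta R x).
  split; first exact: l2_delta.
  by move=> y By; apply: delta_out; rewrite inE; apply/eqP => yx; rewrite yx in By.
rewrite {1}(comp _ dE) /lincomb (proj2 (linear_on_sum _ _ lin phiE)).
apply/funext => y; apply: eq_bigr => i _.
rewrite (eigF (hY n i + mu n)) //; first by rewrite /scaleop /= mulrCA mulrA.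
by rewrite Hamn_eigen // (diag_op_phi _ on) /scaleop rmorphD; apply/funext => z; rewrite mulrDl.
Qed.

Lemma adjL_split n u : l2on (B n) u ->
  adjL e S o n u = fun y => 1 * compress (B n) AG u y + l2proj S u y.
Proof.
move=> uE; have [_ u0] := uE; apply/funext => y; rewrite mul1r.
rewrite /adjL /compress (l2proj_id uE) /l2proj; case: ifPn => //.
by rewrite notin_setE => /u0 ->; rewrite add0r; case: ifP.
Qed.

(* [H_n >= gam - P_S] on [B n], tested on the eigenvectors. *)
Lemma low_eigenvalue n i : pos (gam - (hY n i + mu n)) <=
  \sum_(x <- fset_set (S `&` B n)) cabs (phiY n i x) ^+ 2.
Proof.
have [[lphi on] phiE eig comp] := basisY n; have pE := phiE i; have lp := lphi i.
set p := \sum_(x <- _) _; have p0 : 0 <= p by apply: sumr_ge0 => x _; exact: sqr_ge0.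
suff h : gam - (hY n i + mu n) <= p.
  by have [/posE -> //|/ltW /pos_le0 ->] := leP 0 (gam - (hY n i + mu n)).
have [lA nA] := @compress_bound R V (gball e o) AG _ s20 AG_bound n _ lp.
have SBfin : finite_set (S `&` B n) by apply: sub_finite_set (Bfin n); exact: subIsetr.
have n1 : l2norm (phiY n i) = 1.
  have h := inner_self lp; rewrite on eqxx -(rmorph1 toC) in h; move/toC_inj/esym/eqP: h.
  by rewrite sqrf_eq1 => /orP[/eqP //|/eqP hm]; have := l2norm_ge0 (phiY n i); rewrite hm oppr_ge0 ler10.
have e1 : inner (adjL e S o n (phiY n i)) (phiY n i) = toC (Z - mu n - hY n i).
  have -> : adjL e S o n (phiY n i) = fun y => toC (Z - mu n - hY n i) * phiY n i y + (fun=> 0) y.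
    apply/funext => y; have := congr1 (@^~ y) (eig i); rewrite /subop /scaleop /= addr0.
    by move=> hh; rewrite [toC (_ - hY n i)]rmorphB mulrBl -hh opprB addrC subrK.
  by rewrite inner_linl //; [rewrite on eqxx mulr1 inner0l addr0|exact: (proj1 (l2_0 R V))].
have e2 : inner (l2proj S (phiY n i)) (phiY n i) = toC p.
  rewrite (@inner_finl R V _ _ (fset_set (S `&` B n))).
    rewrite /p raddf_sum big_seq [RHS]big_seq; apply: eq_bigr => x.
    rewrite in_fset_set // => /set_mem [xS _].
    by rewrite /l2proj ifT /= ?cabs_sqr //; exact/mem_set.
  move=> x; rewrite in_fset_set // notin_setE /l2proj => hx; case: ifP => // /set_mem xS.
  by apply: (proj2 pE) => xB; exact: hx.
have lS : l2 (l2proj S (phiY n i)) by exact: (proj1 (l2proj_le _ lp)).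
rewrite adjL_split // inner_linl // mul1r e2 in e1.
have e3 : inner (compress (B n) AG (phiY n i)) (phiY n i) = toC (Z - mu n - hY n i - p).
  by rewrite [RHS]rmorphB /= -e1 addrK.
have := cauchy_schwarz lA lp; rewrite e3 cabs_toC n1 mulr1 => h1.
rewrite n1 mulr1 in nA; have := le_trans (ler_norm _) (le_trans h1 nA).
by lra.
Qed.

(** After exchanging the sums, each vertex of S_n contributes at most 1, by Bessel's inequality for
    [delta x]. *)
Lemma low_eigenvalues n : \sum_i pos (gam - (hY n i + mu n)) <= cardS n.
Proof.
have [on phiE _ _] := basisY n.
apply: (@le_trans _ _ (\sum_i \sum_(x <- fset_set (S `&` B n)) cabs (phiY n i x) ^+ 2)).
  by apply: ler_sum => i _; exact: low_eigenvalue.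
rewrite exchange_big /=.
apply: (@le_trans _ _ (\sum_(x <- fset_set (S `&` B n)) (1 : R))).
  apply: ler_sum => x _; have ld := l2_delta R x.
  have h := bessel on ld.
  have d1 : l2norm (delta R x) ^+ 2 = 1.
    by apply/toC_inj; rewrite -inner_self // inner_delta /delta eqxx rmorph1.
  rewrite d1 in h; apply: le_trans h; rewrite le_eqVlt; apply/orP; left; apply/eqP.
  by apply: eq_bigr => i _; rewrite inner_deltal cabs_conj.
by rewrite (@sum_const_fset R V _ _ 1) // mulr1.
Qed.

Hypothesis hvol : (fun n => l2norm (vn n) ^+ 2 * cardS n / cardB n) @ \oo --> (0 : R).

Lemma cardS_ratio_cvg : (fun n => cardS n / cardB n) @ \oo --> (0 : R).
Proof.
apply: cvg0_le hvol => [n|]; first by rewrite divr_ge0.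
near=> n; rewrite -mulrA -[leLHS]mul1r ler_wpM2r ?divr_ge0 //.
by rewrite expr_ge1 ?l2norm_ge0 // vn_norm_ge1.
Unshelve. all: by end_near.
Qed.

Variable N : probability (measurableTypeR R) R.
Hypothesis idsN : is_ids e S o N.

Lemma ids_eigen (f : R -> R) : rcont f ->
  (fun n => (\sum_i f (hY n i + mu n)) / cardB n) @ \oo --> \int[N]_h f h.
Proof.
move=> cf; have h := idsN (rcontE cf).
have h2 : (fun n => toC ((\sum_i f (hY n i + mu n)) / cardB n)) @ \oo --> toC (\int[N]_h f h).
  apply: cvg_trans h; apply: near_eq_cvg; near=> n.
  rewrite (trace_diag (F := fun t => f (t + mu n))); last by move=> x; exact: funcalc_diag.
  by rewrite [RHS]rmorphM fmorphV rmorph_nat.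
exact: (Re_cvg h2).
Unshelve. all: by end_near.
Qed.

Lemma ids_low_energy : \int[N]_h low_energy gam h = 0.
Proof.
have h1 := ids_eigen (rcont_low_energy gam).
apply: (cvg_unique _ h1) => //; apply: cvg0_le cardS_ratio_cvg => [n|].
  by rewrite divr_ge0 // sumr_ge0 // => i _; have /andP[] := low_energy_itv gam (hY n i + mu n).
near=> n; rewrite ler_pM2r ?invr_gt0 ?cardB_gt0 //.
apply: le_trans (low_eigenvalues n); apply: ler_sum => i _; exact: low_energy_le.
Unshelve. all: by end_near.
Qed.

Lemma density_dist : \forall n \near \oo,
  `|density e S o n (mu n) - (\sum_i bose_cutoff gam (hY n i + mu n)) / cardB n| <=
  `|mu n| * ((1 + (gam / 4)^-1) / (gam / 4)) +
  ((chem_gap n)^-1 + (gam / 2)^-1) * (gam / 2)^-1 * (cardS n / cardB n).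
Proof.
have g0 := spectral_gap; have g4 : 0 < gam / 4 by rewrite divr_gt0.
have [n0 _ hn0] := (cvgr0Pnorm_le _).1 hmu0 _ g4.
exists n0 => // n /= nn; have m1 := hn0 n nn; have mB := cardB_gt0 n.
rewrite trace_bose -mulrBl normrM [X in _ * X]ger0_norm ?invr_ge0 ?(ltW mB) //.
rewrite ler_pdivrMr //; set C1 := (1 + _) / _; set C2 := _ * (gam / 2)^-1.
have C20 : 0 <= C2.
  have e0 := chem_gap_gt0 n; have g2 : 0 < gam / 2 by rewrite divr_gt0.
  by rewrite mulr_ge0 ?addr_ge0 // invr_ge0 ltW.
rewrite -sumrB; apply: le_trans (ler_norm_sum _ _ _) _.
apply: (@le_trans _ _ (\sum_i (`|mu n| * C1 + C2 * pos (gam - (hY n i + mu n))))).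
  by apply: ler_sum => i _; apply: bose_cutoff_dist => //; [exact: chem_gap_gt0|exact: hY_ge].
rewrite big_split /= -mulr_sumr sumr_const card_ord [leRHS]mulrDl.
apply: lerD; first by rewrite -[C1 *+ _]mulr_natr mulrA.
by rewrite -mulr_sumr -(mulrA C2) divfK ?gt_eqF //; apply: ler_wpM2l => //; exact: low_eigenvalues.
Qed.

Lemma density_limit : (fun n => (density e S o n (mu n))%:E) @ \oo --> densityc N.
Proof.
have g0 := spectral_gap; rewrite (densityc_cutoff g0 ids_low_energy).
apply: cvg_EFin; first by near=> n.
rewrite (_ : fine \o _ = fun n => density e S o n (mu n)) //.
have h1 := ids_eigen (rcont_bose_cutoff g0).
have h2 : (fun n => `|mu n| * ((1 + (gam / 4)^-1) / (gam / 4)) +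
   ((chem_gap n)^-1 + (gam / 2)^-1) * (gam / 2)^-1 * (cardS n / cardB n)) @ \oo --> (0 : R).
  apply: cvg0_add.
    have hm : (fun n => `|mu n|) @ \oo --> (0 : R).
      by rewrite -[X in _ --> X](normr0 R); exact: cvg_norm.
    exact: (cvg0_mul hm (cvg_cst _)).
  (* The factor |v_n|^2 cancels between [hvol] and [hmuD], so the product of their limits, 0 times
     D, is the limit of |S_n| / (|Lambda_n| eps_n). *)
  have h3 : (fun n => (chem_gap n)^-1 * (cardS n / cardB n)) @ \oo --> (0 : R).
    have := cvg0_mul hvol hmuD; apply: cvg_trans; apply: near_eq_cvg; near=> n.
    have d0 := chem_gap_gt0 n; rewrite -/(chem_gap n).
    have lv := vn_norm_ge1 n; have v0 : 0 < l2norm (vn n) by exact: lt_le_trans lv.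
    by field; rewrite !gt_eqF ?cardB_gt0.
  have h4 := cvg0_add h3 (cvg0_scale (gam / 2)^-1 cardS_ratio_cvg).
  have := cvg0_scale (gam / 2)^-1 h4; apply: cvg_trans; apply: near_eq_cvg; near=> n.
  by rewrite -mulrDl mulrA [X in X * _ = _]mulrC.
have h3 : (fun n => density e S o n (mu n) -
    (\sum_i bose_cutoff gam (hY n i + mu n)) / cardB n) @ \oo --> (0 : R).
  by apply/norm_cvg0P; apply: cvg0_le h2 => [n|]; [exact: normr_ge0|exact: density_dist].
rewrite -[X in _ --> X]add0r (_ : (fun n => _) = fun n => (density e S o n (mu n) -
    (\sum_i bose_cutoff gam (hY n i + mu n)) / cardB n) +
    (\sum_i bose_cutoff gam (hY n i + mu n)) / cardB n); first exact: cvgD.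
by apply/funext => n; rewrite subrK.
Unshelve. all: by end_near.
Qed.

End GibbsStates.

Theorem proposition5p8 (R : realType) (V : choiceType) (e : rel V) (S : set V)
  (o : V) (Q : nat) (Y : pgraph)
  (hG : homogeneous_tree e setT Q)
  (hQ : admissible R Y Q)
  (hS : perturbed_set e Y S o)
  (hgap : forall q, Y = GQq q -> 2 * Num.sqrt (Q%:R - 1) < normY R e S)
  (vn : nat -> vec R V)
  (hvn : forall n, is_pfn e S o n (vn n))
  (D : R) (hD : 0 <= D)
  (mu : nat -> R)
  (hmu_lt : forall n, mu n < normY R e S - normL R e S o n)
  (hmu0 : mu @ \oo --> (0 : R))
  (hmuD : (fun n => (l2norm (vn n) ^+ 2 *
             (normY R e S - normL R e S o n - mu n))^-1) @ \oo --> D)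
  (hvol : (fun n => l2norm (vn n) ^+ 2 * (vcard (S `&` gball e o n))%:R
             / (vcard (gball e o n))%:R) @ \oo --> (0 : R))
  (hkrein : forall x : V, exists L : Cplx R,
     (fun z : R => inner (krein e S setT z (delta R x)) (delta R x))
       @ (normY R e S)^'+ --> L /\
     (fun n : nat =>
        let u := Qproj e o n (vn n) (delta R x) in
        inner (krein e S (gball e o n) (normY R e S - mu n) u) u)
       @ \oo --> L) :
  (forall x : V,
     inv_dom setT (sqrt_boseH e S) (delta R x) /\
     (fun n => omegan e S o n (mu n) (delta R x) (delta R x)) @ \oo
       --> omegaD e S D (pf R e S o Y Q) (delta R x) (delta R x)) /\
  (forall N : probability (measurableTypeR R) R, is_ids e S o N ->
     (fun n => (density e S o n (mu n))%:E) @ \oo --> densityc N).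
Proof.
split=> [x|N idsN]; first exact: (gibbs_limit hG hQ hS hgap hvn hmu_lt hmu0 hmuD hkrein).
exact: (density_limit hG hQ hS hgap hvn hmu_lt hmu0 hmuD hvol idsN).
Qed.
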